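(* Let $m\geq 2$ and let $Y$ be an $m$-dimensional variety over $\mathbf{C}$ with an embedding $i:Y\hookrightarrow\mathbf{P}^N$, of one of the following types: (a) a smooth projective bundle $Y=\mathbf{P}(E)$ of dimension $m$ over $\mathbf{P}^1$, where $E=\mathcal{O}_{\mathbf{P}^1}\oplus\mathcal{O}_{\mathbf{P}^1}(-e_1)\oplus\cdots\oplus\mathcal{O}_{\mathbf{P}^1}(-e_{m-1})$ with $0\le e_1\le\cdots\le e_{m-1}$, embedded as a non-degenerate variety in $\mathbf{P}^N$ by the complete linear series of a very ample divisor $aT+bF$, where $\mathcal{O}_Y(T)=\mathcal{O}_{\mathbf{P}(E)}(1)$ and $F\cong\mathbf{P}^{m-1}$ is a fiber of $Y\to\mathbf{P}^1$; (b) $Y=\mathbf{P}^m$, embedded as a non-degenerate variety in $\mathbf{P}^N$ by the complete linear series of $\mathcal{O}_{\mathbf{P}^m}(d)$ for some $d\ge1$; (c) a smooth quadric hypersurface $Y=\mathbf{Q}_m\subset\mathbf{P}^{m+1}$, embedded as a non-degenerate variety in $\mathbf{P}^N$ by the complete linear series of $\mathcal{O}_{\mathbf{Q}_m}(d)$ for some $d\ge 1$ if $m\ge3$, or by the complete linear series of $\mathcal{O}_{\mathbf{Q}_2}(a,b)$ for some $a\geq 1$, $b\ge1$ if $m=2$. Then there are no carpets inside $\mathbf{P}^N$, supported on $i(Y)$, that are canonically embedded in $\mathbf{P}^N$.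
   Context: Everything is over $\mathbf{C}$. For a vector bundle $E$ on $\mathbf{P}^1$ with projection $p:\mathbf{P}(E)\to\mathbf{P}^1$, the convention is $p_*\mathcal{O}_{\mathbf{P}(E)}(1)=E$. Let $Y$ be a smooth irreducible projective variety. A carpet on $Y$ (a rope of multiplicity $2$ on $Y$) is a scheme $\widetilde{Y}$ such that $\widetilde{Y}_{\mathrm{red}}=Y$, the ideal sheaf $\mathcal{I}_{Y,\widetilde{Y}}$ of $Y$ in $\widetilde{Y}$ satisfies $\mathcal{I}_{Y,\widetilde{Y}}^2=0$, and $\mathcal{I}_{Y,\widetilde{Y}}$ is a line bundle on $Y$ (called the conormal bundle of $\widetilde{Y}$). Given an embedding $i:Y\hookrightarrow\mathbf{P}^N$ and an embedding $\tilde{i}:\widetilde{Y}\hookrightarrow\mathbf{P}^N$ extending $i$, one says that $\widetilde{Y}$ is canonically embedded by $\tilde{i}$ (or that $\tilde{i}(\widetilde{Y})$ is a canonical carpet) if the dualizing sheaf $\omega_{\widetilde{Y}}$ is very ample and $\tilde{i}$ is induced by the complete linear series of $\omega_{\widetilde{Y}}$. *)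

(* Defs.v *)
From HB Require Import structures.
From mathcomp Require Import all_boot all_order all_algebra.
From mathcomp Require Import mpoly complex.
From mathcomp Require Import boolp reals.

Set Implicit Arguments.
Unset Strict Implicit.
Unset Printing Implicit Defensive.

Import GRing.Theory.
Local Open Scope ring_scope.

(* Schemes enter through Cox's homogeneous coordinates.  A [coxSpace] is the
   integral separated scheme with graded coordinate ring k[x_1, .., x_n]
   (variable x_i in degree [cox_wt i]), covered by the affine open sets
   U_c = {cox_mon c <> 0}, c : cox_chart, with
   O(U_c) = (k[x_1, .., x_n][1 / cox_mon c])_0.
   The two instances used are P^n and a projective bundle over P^1, see
   [proj] and [scroll] below. *)
Record coxSpace (k : fieldType) := CoxSpace {
  cox_var : nat;
  cox_grp : zmodType;
  cox_wt : 'I_cox_var -> cox_grp;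
  cox_chart : finType;
  cox_mon : cox_chart -> 'X_{1..cox_var} }.

Section CoxSpaces.
Context {k : fieldType}.
Implicit Type A : coxSpace k.

Definition cox_ring A := {mpoly k[cox_var A]}.

Definition cox_frac A := {fraction {mpoly k[cox_var A]}}.

Definition wdeg A (m : 'X_{1..cox_var A}) : cox_grp A :=
  \sum_i cox_wt i *+ m i.

Definition whomog A (g : cox_grp A) (p : cox_ring A) : Prop :=
  forall m, m \in msupp p -> wdeg m = g.

Definition wcomp A (g : cox_grp A) (p : cox_ring A) : cox_ring A :=
  \sum_(m <- msupp p | wdeg m == g) p@_m *: 'X_[m].

(* A closed subscheme is given by a homogeneous ideal.  Ideals are not assumed
   saturated, so distinct records may define the same subscheme; everything
   below depends only on the associated ideal sheaf. *)
Record subscheme A := Subscheme {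
  equations :> cox_ring A -> Prop;
  equations0 : equations 0;
  equationsD : forall p q, equations p -> equations q -> equations (p + q);
  equationsM : forall r p, equations p -> equations (r * p);
  equations_wcomp : forall g p, equations p -> equations (wcomp g p) }.

Lemma whole_wcomp A (g : cox_grp A) (p : cox_ring A) :
  p = 0 -> wcomp g p = 0.
Proof. by move=> ->; rewrite /wcomp msupp0 big_nil. Qed.

Lemma whole_mul A (r p : cox_ring A) : p = 0 -> r * p = 0.
Proof. by move=> ->; rewrite mulr0. Qed.

Lemma whole_add A (p q : cox_ring A) : p = 0 -> q = 0 -> p + q = 0.
Proof. by move=> -> ->; rewrite addr0. Qed.

Definition whole A : subscheme A :=
  @Subscheme A (fun p => p = 0) erefl (@whole_add A) (@whole_mul A)
    (@whole_wcomp A).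

(* For a set U of charts, [xprod U] is the product of the chart monomials, so
   that the intersection of the U_c, c in U, is the locus [xprod U] <> 0. *)
Definition xprod A (U : {set cox_chart A}) : cox_ring A :=
  \prod_(c in U) 'X_[cox_mon c].

Definition xdeg A (U : {set cox_chart A}) : cox_grp A :=
  \sum_(c in U) wdeg (cox_mon c).

(* Sections of O(g) over the intersection of the charts in U, as elements of
   the fraction field: the degree g part of k[x_1, .., x_n][1 / xprod U]. *)
Definition twist A (U : {set cox_chart A}) (g : cox_grp A)
    (phi : cox_frac A) : Prop :=
  exists l p, whomog (g + xdeg U *+ l) p /\
              phi = tofrac p / tofrac (xprod U) ^+ l.

(* The sections among these that lie in (ideal sheaf of Y) * O(g). *)
Definition itwist A (Y : subscheme A) (U : {set cox_chart A}) (g : cox_grp A)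
    (phi : cox_frac A) : Prop :=
  exists l p, [/\ Y p, whomog (g + xdeg U *+ l) p &
              phi = tofrac p / tofrac (xprod U) ^+ l].

(* A global section of O_Y(D): local sections on the charts, which agree
   modulo the ideal of Y on the overlaps. *)
Definition global_section A (Y : subscheme A) (D : cox_grp A)
    (u : cox_chart A -> cox_frac A) : Prop :=
  (forall c, twist [set c] D (u c)) /\
  (forall c d, itwist Y [set c; d] D (u c - u d)).

Definition scal A (a : k) : cox_frac A := tofrac (a%:MP : {mpoly k[_]}).

Definition basis_of_sections A (Y : subscheme A) (D : cox_grp A) (N : nat)
    (s : 'I_N.+1 -> cox_chart A -> cox_frac A) : Prop :=
  (forall j, global_section Y D (s j)) /\
  (forall u, global_section Y D u ->
     exists! a : 'rV[k]_N.+1, forall c,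
       itwist Y [set c] D (u c - \sum_j scal A (a 0 j) * s j c)).

(* Closed points are represented by coordinate vectors, up to the action of
   the torus Hom(cox_grp, k^x). *)
Definition coord A := 'I_(cox_var A) -> k.

Definition in_chart A (c : cox_chart A) (P : coord A) : Prop :=
  ('X_[cox_mon c] : {mpoly k[_]}).@[P] != 0.

Definition is_point A (P : coord A) : Prop := exists c, in_chart c P.

Definition same_point A (P Q : coord A) : Prop :=
  exists t : cox_grp A -> k,
    [/\ t 0 = 1, forall g h, t (g + h) = t g * t h &
        forall i, Q i = t (cox_wt i) * P i].

Definition point_of A (Y : subscheme A) (P : coord A) : Prop :=
  is_point P /\ forall p, Y p -> p.@[P] = 0.

Definition value_at A (phi : cox_frac A) (P : coord A) (v : k) : Prop :=
  exists p q : {mpoly k[_]},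
    [/\ q.@[P] != 0, phi = tofrac p / tofrac q & v = p.@[P] / q.@[P]].

(* Projective n-space. *)
Definition proj (n : nat) : coxSpace k :=
  {| cox_var := n.+1; cox_grp := int; cox_wt := fun=> 1;
     cox_chart := 'I_n.+1; cox_mon := fun i => U_(i)%MM |}.

(* P(E) for E = \bigoplus_i O(- e i) on P^1, with p_* O(1) = E.  The
   coordinates are (u, v; z_i)_(i < m); O(a T + b F) has degree (a, b), so that
   u, v are sections of O(F) and z_i is a section of O(T + e_i F). *)
Definition scroll (m : nat) (e : 'I_m -> nat) : coxSpace k :=
  {| cox_var := (2 + m)%N; cox_grp := (int * int)%type;
     cox_wt := fun i => match split i with
                        | inl _ => (0, 1)
                        | inr j => (1, (e j)%:Z)
                        end;
     cox_chart := ('I_2 * 'I_m)%type;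
     cox_mon := fun c => (U_(lshift m c.1) + U_(rshift 2 c.2))%MM |}.

(* F(s_0, .., s_N) on the chart c. *)
Definition pull A (N : nat) (s : 'I_N.+1 -> cox_chart A -> cox_frac A)
    (c : cox_chart A) (F : cox_ring (proj N)) : cox_frac A :=
  mmap (scal A) (fun j => s j c) F.

Definition maps_to A (N : nat) (s : 'I_N.+1 -> cox_chart A -> cox_frac A)
    (P : coord A) (y : coord (proj N)) : Prop :=
  exists c l, [/\ in_chart c P, l != 0 &
                  forall j, value_at (s j c) P (l * y j)].

(* The sections s_0, .., s_N of O_Y(D) define a closed immersion of Y in P^N
   with image W: the morphism is everywhere defined, injective and closed, the
   homomorphisms of local rings are surjective, and the homogeneous ideal of W
   is the kernel of F |-> F(s_0, .., s_N). *)
Record closed_immersion A (Y : subscheme A) (D : cox_grp A) (N : nat)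
    (s : 'I_N.+1 -> cox_chart A -> cox_frac A) (W : subscheme (proj N)) :
    Prop := ClosedImmersion {
  ci_defined : forall P, point_of Y P ->
    exists2 y : coord (proj N), is_point y & maps_to s P y;
  ci_inj : forall (P Q : coord A) (y : coord (proj N)),
    point_of Y P -> point_of Y Q -> is_point y ->
    maps_to s P y -> maps_to s Q y -> same_point P Q;
  ci_closed : forall K : subscheme A, exists K' : subscheme (proj N),
    forall y : coord (proj N), is_point y ->
      (point_of K' y <->
       exists P, [/\ point_of Y P, point_of K P & maps_to s P y]);
  ci_local : forall (P : coord A) (c : cox_chart A) (a : cox_frac A),
    point_of Y P -> in_chart c P -> twist [set c] 0 a ->
    exists (d : nat) (F H : cox_ring (proj N)) (b : cox_frac A) (v w : k),
      [/\ whomog (d%:Z : cox_grp (proj N)) F /\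
            whomog (d%:Z : cox_grp (proj N)) H,
          twist [set c] 0 b, value_at b P v /\ v != 0,
          value_at (pull s c H) P w /\ w != 0 &
          itwist Y [set c] (D *+ d) (b * (a * pull s c H - pull s c F))];
  ci_image : forall (d : nat) (F : cox_ring (proj N)),
    whomog (d%:Z : cox_grp (proj N)) F ->
    (W F <-> forall c, itwist Y [set c] (D *+ d) (pull s c F)) }.

(* Nonempty sets U of charts; U stands for the affine open set obtained by
   intersecting them, so [U \subset V] means that V is the smaller open set. *)
Definition opens A := {U : {set cox_chart A} | U != set0}.

Lemma set1_n0 A (c : cox_chart A) : [set c] != set0.
Proof. by apply/set0Pn; exists c; rewrite set11. Qed.

Lemma set2_n0 A (c d : cox_chart A) : [set c; d] != set0.
Proof. by apply/set0Pn; exists c; rewrite set21. Qed.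

Definition open1 A (c : cox_chart A) : opens A := exist (fun U => U != set0) _ (set1_n0 c).
Definition open2 A (c d : cox_chart A) : opens A := exist (fun U => U != set0) _ (set2_n0 c d).

Lemma face_n0 A (p : nat) (t : {ffun 'I_p.+1 -> cox_chart A}) :
  [set t i | i : 'I_p.+1] != set0.
Proof. by apply/set0Pn; exists (t ord0); apply: imset_f. Qed.

Definition openT A (p : nat) (t : {ffun 'I_p.+1 -> cox_chart A}) : opens A :=
  exist (fun U => U != set0) _ (face_n0 t).

(* The coordinate ring of the affine open set U. *)
Definition regular A (U : opens A) : {pred cox_frac A} :=
  fun phi => `[< twist (val U) 0 phi >].

End CoxSpaces.

Arguments proj k n : clear implicits.
Arguments scroll k {m} e.

Section Coordinates.
Context {k : fieldType}.
Implicit Type A : coxSpace k.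

Lemma wdegD A (m1 m2 : 'X_{1..cox_var A}) :
  wdeg (m1 + m2)%MM = wdeg m1 + wdeg m2.
Proof.
by rewrite /wdeg -big_split; apply: eq_bigr => i _; rewrite mnmDE mulrnDr.
Qed.

Lemma whomogD A (g : cox_grp A) (p q : cox_ring A) :
  whomog g p -> whomog g q -> whomog g (p + q).
Proof.
by move=> hp hq m /msuppD_le; rewrite mem_cat => /orP[/hp|/hq].
Qed.

Lemma whomogN A (g : cox_grp A) (p : cox_ring A) :
  whomog g p -> whomog g (- p).
Proof. by move=> hp m; rewrite (perm_mem (msuppN p)) => /hp. Qed.

Lemma whomogM A (g h : cox_grp A) (p q : cox_ring A) :
  whomog g p -> whomog h q -> whomog (g + h) (p * q).
Proof.
move=> hp hq m /msuppM_le /allpairsP[[m1 m2] /= [/hp <- /hq <- ->]].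
exact: wdegD.
Qed.

Lemma whomogC A (a : k) : whomog (0 : cox_grp A) (a%:MP : {mpoly k[_]}).
Proof.
move=> m; rewrite msuppC; case: ifP => // _; rewrite inE => /eqP->.
by rewrite /wdeg big1 // => i _; rewrite mnm0E.
Qed.

Lemma whomog_prod A (U : {set cox_chart A}) : whomog (xdeg U) (xprod U).
Proof.
apply: (big_rec2 (fun p g => whomog (g : cox_grp A) (p : cox_ring A))).
  by rewrite -mpolyC1; apply: whomogC.
move=> c p g _ hp; apply: whomogM => // m.
by rewrite msuppX inE => /eqP->.
Qed.

Lemma whomogX A (g : cox_grp A) (p : cox_ring A) l :
  whomog g p -> whomog (g *+ l) (p ^+ l).
Proof.
move=> hp; elim: l => [|l IH]; first by rewrite expr0 -mpolyC1; apply: whomogC.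
by rewrite exprS mulrS; apply: whomogM.
Qed.

Lemma xprod_neq0 A (U : {set cox_chart A}) : tofrac (xprod U) != 0.
Proof.
rewrite tofrac_eq0; apply/prodf_neq0 => c _.
apply/eqP => /(congr1 (mcoeff (cox_mon c))); rewrite mcoeffX eqxx mcoeff0.
by move/eqP; rewrite oner_eq0.
Qed.

Lemma twist_raise A (U : {set cox_chart A}) (l l' : nat) (p : cox_ring A) :
  whomog (0 + xdeg U *+ l) p ->
  whomog (0 + xdeg U *+ (l + l')) (p * xprod U ^+ l') /\
  tofrac p / tofrac (xprod U) ^+ l =
  tofrac (p * xprod U ^+ l') / tofrac (xprod U) ^+ (l + l') :> cox_frac A.
Proof.
move=> hp; split.
  by rewrite mulrnDr addrA; apply: whomogM => //; apply/whomogX/whomog_prod.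
rewrite tofracM tofracXn exprD invfM mulrACA divff ?mulr1 //.
exact/expf_neq0/xprod_neq0.
Qed.

Lemma regular_subring A (U : opens A) : subring_closed (regular U).
Proof.
split=> [|f g /asboolP[l [p [hp ->]]] /asboolP[l' [q [hq ->]]]
         |f g /asboolP[l [p [hp ->]]] /asboolP[l' [q [hq ->]]]].
- apply/asboolP; exists 0%N, 1; rewrite expr0 tofrac1 divr1 add0r.
  by split=> //; rewrite -mpolyC1; apply: whomogC.
- have [hp' ->] := twist_raise l' hp; have [hq' ->] := twist_raise l hq.
  apply/asboolP; exists (l + l')%N, (p * xprod (val U) ^+ l' - q * xprod (val U) ^+ l).
  split; first by apply: whomogD => //; apply: whomogN; rewrite addnC.
  by rewrite [(l' + l)%N]addnC -mulrBl -tofracB.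
- apply/asboolP; exists (l + l')%N, (p * q).
  split; last by rewrite mulrACA tofracM exprD invfM.
  by rewrite mulrnDr addrA; rewrite add0r in hq; apply: whomogM.
Qed.

HB.instance Definition _ A (U : opens A) :=
  GRing.isSubringClosed.Build (cox_frac A) (regular U) (regular_subring U).

Record regular_ring A (U : opens A) := Regular {
  regular_val : cox_frac A;
  regularP : regular_val \in regular U }.

HB.instance Definition _ A (U : opens A) :=
  [isSub of regular_ring U for @regular_val A U].
HB.instance Definition _ A (U : opens A) :=
  [Choice of regular_ring U by <:].
HB.instance Definition _ A (U : opens A) :=
  [SubChoice_isSubComNzRing of regular_ring U by <:].

Lemma const_regular A (U : opens A) (a : k) : scal A a \in regular U.
Proof.
apply/asboolP; exists 0%N, (a%:MP : {mpoly k[_]}).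
by rewrite expr0 divr1 mulr0n addr0; split=> //; apply: whomogC.
Qed.

Definition const A (U : opens A) (a : k) : regular_ring U :=
  Regular (const_regular U a).

Definition ideal_on A (Y : subscheme A) (U : opens A) (a : regular_ring U) :
  Prop := itwist Y (val U) 0 (val a).

(* A coherent sheaf on the closed subscheme X, given by its sections over the
   affine open sets [opens A].  [res] is meaningful only when V \subset U.
   In [res_surj] and [res_ker] the ring of V is the localization of the ring
   of U at the g that become invertible on V, and these axioms say that the
   sections over V are the corresponding localization. *)
Record coherent A (X : subscheme A) := Coherent {
  sect :> forall U : opens A, lmodType (regular_ring U);
  res : forall U V : opens A, sect U -> sect V;
  resD : forall (U V : opens A) (u v : sect U), val U \subset val V ->
    res V (u + v) = res V u + res V v;
  resZ : forall (U V : opens A) (a : regular_ring U) (b : regular_ring V)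
    (u : sect U), val U \subset val V -> val a = val b ->
    res V (a *: u) = b *: res V u;
  res_id : forall (U : opens A) (u : sect U), res U u = u;
  res_comp : forall (U V W : opens A) (u : sect U),
    val U \subset val V -> val V \subset val W ->
    res W (res V u) = res W u;
  res_surj : forall (U V : opens A) (v : sect V), val U \subset val V ->
    exists (g : regular_ring U) (h : regular_ring V) (u : sect U),
      val g * val h = 1 /\ v = h *: res V u;
  res_ker : forall (U V : opens A) (u : sect U), val U \subset val V ->
    res V u = 0 ->
    exists (g : regular_ring U) (h : regular_ring V),
      val g * val h = 1 /\ g *: u = 0;
  sect_supp : forall (U : opens A) (a : regular_ring U) (u : sect U),
    ideal_on X a -> a *: u = 0;
  sect_fg : forall U : opens A, exists (n : nat) (u : 'I_n -> sect U),
    forall v, exists a : 'I_n -> regular_ring U, v = \sum_i a i *: u i }.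

Definition is_hom A (X : subscheme A) (F G : coherent X)
    (f : forall U, F U -> G U) : Prop :=
  (forall U (a : regular_ring U) (u v : F U),
     f U (a *: u + v) = a *: f U u + f U v) /\
  (forall (U V : opens A) (u : F U), val U \subset val V ->
     f V (res V u) = res V (f U u)).

(* Cech cochains for the cover by the charts, indexed by all (p+1)-tuples of
   charts (neither ordered nor alternating). *)
Definition cochain A (X : subscheme A) (F : coherent X) (p : nat) :=
  forall t : {ffun 'I_p.+1 -> cox_chart A}, F (openT t).

Definition cech_d A (X : subscheme A) (F : coherent X) (p : nat)
    (z : cochain F p) : cochain F p.+1 :=
  fun t => \sum_(i < p.+2)
    (-1) ^+ i *: res (openT t) (z [ffun j => t (lift i j)]).

Definition cocycle A (X : subscheme A) (F : coherent X) (p : nat)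
    (z : cochain F p) : Prop := forall t, cech_d z t = 0.

Definition coboundary A (X : subscheme A) (F : coherent X) (p : nat) :
    cochain F p -> Prop :=
  match p with
  | 0 => fun z => forall t, z t = 0
  | q.+1 => fun z => exists y : cochain F q, forall t, z t = cech_d y t
  end.

(* The k-linear forms on H^p(X, F), as forms on cocycles that vanish on
   coboundaries. *)
Definition cohomology_form A (X : subscheme A) (F : coherent X) (p : nat)
    (l : cochain F p -> k) : Prop :=
  [/\ forall y z : cochain F p, cocycle y -> cocycle z ->
        l (fun t => y t + z t) = l y + l z,
      forall (a : k) (z : cochain F p), cocycle z ->
        l (fun t => const (openT t) a *: z t) = a * l z &
      forall z : cochain F p, coboundary z -> l z = 0].

(* W is a dualizing sheaf for X, of dimension m: there is a trace map
   tr : H^m(X, W) -> k such that f |-> tr \o H^m(f) is a bijection from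
   Hom(F, W) to the dual of H^m(X, F), for every coherent F. *)
Definition dualizing A (X : subscheme A) (m : nat) (W : coherent X) : Prop :=
  exists2 tr : cochain W m -> k, cohomology_form tr &
  forall (F : coherent X) (l : cochain F m -> k), cohomology_form l ->
    exists f : forall U, F U -> W U,
      [/\ is_hom f,
          forall z, cocycle z -> l z = tr (fun t => f _ (z t)) &
          forall f' : forall U, F U -> W U, is_hom f' ->
            (forall z, cocycle z -> l z = tr (fun t => f' _ (z t))) ->
            forall U u, f' U u = f U u].

(* For ideals I and J of B with J contained in I: I / J is an invertible
   B / I-module, i.e. free of rank 1 on the open sets h <> 0, for finitely
   many h that generate the unit ideal of B / I. *)
Definition invertible_quotient (B : comNzRingType) (I J : B -> Prop) : Prop :=
  exists (n : nat) (h : 'I_n -> B),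
    (exists b : 'I_n -> B, I (1 - \sum_i b i * h i)) /\
    forall i, exists g, [/\ I g,
      forall f, I f -> exists l a, J (h i ^+ l * f - a * g) &
      forall a, (exists l, J (h i ^+ l * (a * g))) <->
                exists l, I (h i ^+ l * a)].

(* Z is a carpet on W, where W and Z are closed subschemes. *)
Definition carpet A (W Z : subscheme A) : Prop :=
  forall U : opens A,
  [/\ forall a : regular_ring U, ideal_on W a <-> exists l, ideal_on Z (a ^+ l),
      forall a b : regular_ring U, ideal_on W a -> ideal_on W b ->
        ideal_on Z (a * b) &
      invertible_quotient (@ideal_on A W U) (@ideal_on A Z U)].

(* x_j / x_i *)
Definition xratio (N : nat) (i j : 'I_N.+1) : cox_frac (proj k N) :=
  tofrac 'X_j / tofrac 'X_i.

(* The inclusion of X in P^N is induced by the complete linear series of L: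
   L is isomorphic to O_X(1), the line bundle with free generators e_i on the
   charts and e_j = (x_j / x_i) e_i on the overlaps, and the resulting
   sections x_0, .., x_N form a basis of H^0(X, L). *)
Definition by_complete_series (N : nat) (X : subscheme (proj k N))
    (L : coherent X) : Prop :=
  exists e : forall i : cox_chart (proj k N), L (open1 i),
  [/\ forall i (u : L (open1 i)), exists a, u = a *: e i,
      forall i a, a *: e i = 0 <-> ideal_on X a,
      forall (i j : cox_chart (proj k N)) (a : regular_ring (open2 i j)),
        val a = @xratio N i j ->
        res (open2 i j) (e j) = a *: res (open2 i j) (e i) &
      forall u : (forall i : cox_chart (proj k N), L (open1 i)),
        (forall i j, res (open2 i j) (u i) = res (open2 i j) (u j)) ->
        exists! b : 'rV[k]_N.+1,
          forall (i : cox_chart (proj k N)) (a : regular_ring (open1 i)),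
            val a = \sum_j scal (proj k N) (b 0 j) * @xratio N i j ->
            u i = a *: e i].

(* X, of dimension m, is canonically embedded in P^N.  (A dualizing sheaf
   isomorphic to O_X(1) is in particular very ample.) *)
Definition canonically_embedded (N : nat) (X : subscheme (proj k N)) (m : nat) :
    Prop :=
  exists2 W : coherent X, dualizing m W & by_complete_series W.

Definition smooth_quadric (n : nat) (q : cox_ring (proj k n)) : Prop :=
  whomog (2 : cox_grp (proj k n)) q /\
  forall P : coord (proj k n), is_point P -> q.@[P] = 0 ->
    exists i, (q^`M(i)).@[P] != 0.

(* The m-dimensional varieties Y considered, with a line bundle O_Y(D).  The
   smooth quadric surface, on which O(a, b) is defined by means of an
   isomorphism with P^1 x P^1, is taken in the form P^1 x P^1 = P(O + O). *)
Inductive listed (m : nat) :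
    forall A : coxSpace k, subscheme A -> cox_grp A -> Prop :=
  | listed_scroll (e : 'I_m -> nat) (a b : int) :
      (forall i : 'I_m, i = 0%N :> nat -> e i = 0%N) ->
      (forall i j : 'I_m, (i <= j)%N -> (e i <= e j)%N) ->
      @listed m (scroll k e) (whole (scroll k e)) (a, b)
  | listed_proj (d : nat) : (0 < d)%N ->
      @listed m (proj k m) (whole (proj k m)) d%:Z
  | listed_quadric (q : cox_ring (proj k m.+1)) (Q : subscheme (proj k m.+1))
      (d : nat) : (3 <= m)%N -> smooth_quadric q ->
      (forall p, Q p <-> exists r, p = r * q) -> (0 < d)%N ->
      @listed m (proj k m.+1) Q d%:Z
  | listed_quadric_surface (a b : nat) : m = 2%N -> (0 < a)%N -> (0 < b)%N ->
      @listed m (scroll k (fun _ : 'I_2 => 0%N)) (whole (scroll k (fun=> 0%N)))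
        (a%:Z, b%:Z).

End Coordinates.

(* Main.v *)
(** Let I be the ideal sheaf of W = i(Y) in P^N and let Z be a canonical carpet
    on W, so that its dualizing sheaf is O_Z(1), with local generators e_i.
    The map a |-> (a / x_i) e_i sends I(1) to O_Z(1) and kills I^2(1), since
    I^2 is contained in the ideal of Z; it is thus a morphism from the coherent
    O_Z-module (I / I^2)(1) to the dualizing sheaf.  By the uniqueness part of
    duality it is zero as soon as H^m((I / I^2)(1)) = 0.  But then I is the
    ideal of Z, so the conormal sheaf of the carpet vanishes, although it is
    invertible on the nonempty W: a contradiction.

    The vanishing of H^m((I / I^2)(1)) comes from the conormal sequence of Y in
    P^N and from the Euler sequences of P^N and of the toric ambient space of Y,
    which is Y itself or, for a quadric q = 0, the projective space.  They
    express (I / I^2)(1) in terms of the sheaves O_Y, O_Y(D), the O_Y(D - w_i),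
    where w_i is the degree of the Cox coordinate x_i, and O_Y(D - deg q).  All
    of these have no cohomology in positive degree, so that a cocycle of degree
    m >= 2 can be lifted step by step to these sheaves and shown to be a
    coboundary.  In order to remain within polynomials, I^2 is replaced by the
    ideal of the forms in I all of whose derivatives are in I, which defines the
    same sheaf because Y is smooth. *)
Require Import Defs.
From HB Require Import structures.
From mathcomp Require Import all_boot all_order all_algebra.
From mathcomp Require Import mpoly complex.
From mathcomp Require Import boolp reals.
From mathcomp Require Import ring zify.

Set Implicit Arguments.
Unset Strict Implicit.
Unset Printing Implicit Defensive.

Import GRing.Theory.
Local Open Scope ring_scope.

(** * Identities in abelian groups *)

(** When Y is toric, the conormal sequence places H^m((I / I^2)(1)) between H^(m-1)(Omega_Y(1)) and
    H^m(Omega_P(1)|Y), and the Euler sequence places the former between H^(m-2)(O_Y(D))^r and the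
    H^(m-1)(O_Y(D - w_i)). For m = 2 the descent ends in degree 0, where nothing vanishes: the Euler
    map from the H^0(O_Y(D - w_i)) to H^0(O_Y(D))^r has to be onto instead. Euler's formula gives
    this after a division by degrees, which uses characteristic 0; for a scroll it also uses the
    positivity of D, extracted from the closed immersion.

    Cochains live on the opens s_j <> 0 induced by the coordinates of P^N, whereas vanishing is
    visible on monomials and coordinate loci; a double complex passes from one cover to the other.
    No sheaf of differentials is built: a form is a tuple of coefficients subject to Euler relations
    modulo q, and the local exactness of the conormal sequence becomes explicit polynomial lifts on
    charts where the Cox coordinates are restrictions of forms of P^N up to a character of the
    torus. *)

Section ZmodReflection.

Inductive zexp := ZVar of nat | ZAdd of zexp & zexp | ZOpp of zexp | ZZero.

Fixpoint zeval (V : zmodType) (env : seq V) (e : zexp) : V :=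
  match e with
  | ZVar i => nth 0 env i
  | ZAdd a b => zeval env a + zeval env b
  | ZOpp a => - zeval env a
  | ZZero => 0
  end.

Fixpoint zcoef (e : zexp) (i : nat) : int :=
  match e with
  | ZVar j => (i == j)%:Z
  | ZAdd a b => zcoef a i + zcoef b i
  | ZOpp a => - zcoef a i
  | ZZero => 0
  end.

Fixpoint zvars (e : zexp) : nat :=
  match e with
  | ZVar j => j.+1
  | ZAdd a b => maxn (zvars a) (zvars b)
  | ZOpp a => zvars a
  | ZZero => 0
  end.

Lemma zevalE (V : zmodType) (env : seq V) e n : (zvars e <= n)%N ->
  zeval env e = \sum_(i < n) nth 0 env i *~ zcoef e i.
Proof.
elim: e => [j|a IHa b IHb|a IH|] /= h.
- rewrite (bigD1 (Ordinal h)) //= eqxx mulr1z big1 ?addr0 // => i ne.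
  by rewrite (_ : (_ == _) = false) ?mulr0z //; apply/negbTE.
- move: h; rewrite geq_max => /andP[ha hb]; rewrite (IHa ha) (IHb hb) -big_split.
  by apply: eq_bigr => i _; rewrite mulrzDr.
- by rewrite (IH h) -sumrN; apply: eq_bigr => i _; rewrite mulrNz.
- by rewrite big1 // => i _; rewrite mulr0z.
Qed.

Lemma zeval_eq (V : zmodType) (env : seq V) a b :
  all (fun i => zcoef a i == zcoef b i) (iota 0 (maxn (zvars a) (zvars b))) ->
  zeval env a = zeval env b.
Proof.
move=> /allP h; rewrite (zevalE env (leq_maxl _ (zvars b))).
rewrite (zevalE env (leq_maxr (zvars a) _)); apply: eq_bigr => i _.
by rewrite (eqP (h i _)) // mem_iota /= add0n.
Qed.

End ZmodReflection.

Ltac zindex x env :=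
  match env with
  | ?y :: ?e => match constr:(tt) with
    | _ => let _ := match constr:(tt) with _ => unify x y end in constr:(0%N)
    | _ => let r := zindex x e in constr:(r.+1)
    end
  end.

Ltac zatoms x env :=
  match x with
  | 0 => env
  | (?a + ?b) => let e := zatoms a env in zatoms b e
  | (- ?a) => zatoms a env
  | _ => match constr:(tt) with
    | _ => let _ := zindex x env in env
    | _ => constr:(x :: env)
    end
  end.

Ltac zreify x env :=
  match x with
  | 0 => constr:(ZZero)
  | (?a + ?b) => let a' := zreify a env in let b' := zreify b env in
      constr:(ZAdd a' b')
  | (- ?a) => let a' := zreify a env in constr:(ZOpp a')
  | _ => let i := zindex x env in constr:(ZVar i)
  end.

(** Degrees live in an arbitrary abelian group, without multiplication. An identity between sums of
    atoms follows once each atom has the same integer coefficient on both sides; atoms are collected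
    up to unification. *)
Ltac zmod :=
  match goal with |- @eq ?V ?a ?b =>
    let env0 := constr:(@nil V) in
    let env1 := zatoms a env0 in
    let env := zatoms b env1 in
    let a' := zreify a env in
    let b' := zreify b env in
    refine (@zeval_eq _ env a' b' _); vm_compute; reflexivity
  end.

(** * Cech complexes on lists of indices *)

(* Cochains of all degrees at once: the value on [t] has degree [size t - 1],
   so that [dl f [:: i]] is the augmentation of [f [::]]. *)
Fixpoint dl (I : Type) (V : zmodType) (f : seq I -> V) (t : seq I) : V :=
  if t is i :: t' then f t' - dl (fun r => f (i :: r)) t' else 0.

Section ListCech.
Context {I : Type} {V : zmodType}.
Implicit Types (f g : seq I -> V) (t : seq I).

Lemma eq_dl f g t :
  (forall r, (size r).+1 = size t -> f r = g r) -> dl f t = dl g t.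
Proof.
elim: t f g => [|i t IH] f g e //=; congr (_ - _); first exact: e.
by apply: IH => r er; apply: e; rewrite /= er.
Qed.

Lemma dl_is_additive (W : zmodType) (h : V -> W) f t :
  {morph h : x y / x - y} -> h (dl f t) = dl (h \o f) t.
Proof.
move=> hB; have h0 : h 0 = 0 by rewrite -(subrr 0) hB subrr.
by elim: t f => [|i t IH] f //=; rewrite hB IH.
Qed.

Lemma dlD f g t : dl (fun r => f r + g r) t = dl f t + dl g t.
Proof.
elim: t f g => [|i t IH] f g /=; first by rewrite addr0.
by rewrite (IH (fun r => f (i :: r))) opprD addrACA.
Qed.

Lemma dlB f g t : dl (fun r => f r - g r) t = dl f t - dl g t.
Proof.
rewrite dlD; congr (_ + _); rewrite (dl_is_additive (h := -%R)) // => x y.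
by rewrite opprB opprK addrC.
Qed.

Lemma dl0 t : dl (fun _ => 0 : V) t = 0.
Proof. by elim: t => //= i t ->; rewrite subrr. Qed.

Lemma dl_sum (J : Type) (r : seq J) (P : pred J) (F : J -> seq I -> V) t :
  dl (fun u => \sum_(j <- r | P j) F j u) t = \sum_(j <- r | P j) dl (F j) t.
Proof.
elim: r => [|j r IH].
  by rewrite big_nil -[RHS](dl0 t); apply: eq_dl => u _; rewrite big_nil.
rewrite big_cons -IH; case: ifP => Pj.
  by rewrite -dlD; apply: eq_dl => u _; rewrite big_cons Pj.
by apply: eq_dl => u _; rewrite big_cons Pj.
Qed.

Lemma dl_dl f t : dl (dl f) t = 0.
Proof.
elim: t f => [|i t IH] f //=.
rewrite (dlB f (fun r => dl (fun r' => f (i :: r')) r)) IH subr0.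
by rewrite subrr.
Qed.

End ListCech.

Lemma dl_comm (I J : Type) (V : zmodType) (f : seq I -> seq J -> V) t u :
  dl (fun r => dl (f r) u) t = dl (fun v => dl (fun r => f r v) t) u.
Proof.
elim: t f => [|i t IH] f /=; first by rewrite dl0.
by rewrite (dlB (f t)) IH.
Qed.

Lemma dl_map (I J : Type) (V : zmodType) (h : I -> J) (f : seq J -> V) t :
  dl f (map h t) = dl (fun r => f (map h r)) t.
Proof. by elim: t f => [|i t IH] f //=; rewrite IH. Qed.

Section Membership.
Context {I : Type} {V : zmodType} (M : seq I -> V -> Prop).

Definition subgroups : Prop :=
  (forall t, M t 0) /\ (forall t x y, M t x -> M t y -> M t (x - y)).

(** Compatibility with restriction: one more index means a smaller open set. *)
Definition augments : Prop := forall i t u x, M (t ++ u) x -> M (t ++ i :: u) x.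

Lemma dl_mem (f : seq I -> V) n : subgroups -> augments ->
  (forall t, size t = n -> M t (f t)) ->
  forall t, size t = n.+1 -> M t (dl f t).
Proof.
move=> [M0 MB] Ma hf t st.
(* The recursion of [dl] moves indices into a prefix, so the claim is generalized over a prefix
   [u]. *)
suff H (u : seq I) (g : seq I -> V) :
    (forall r, (size r).+1 = size t -> M (u ++ r) (g r)) ->
    M (u ++ t) (dl g t).
  by apply: (H [::]) => r sr; apply: hf; apply: succn_inj; rewrite sr.
elim: t u g {st} => [|i t IH] u g hg /=; first by rewrite cats0.
apply: MB; first exact/Ma/hg.
by rewrite -cat_rcons; apply: IH => r sr; rewrite cat_rcons; apply: hg; rewrite /= sr.
Qed.

(* Exactness of the augmented complex of the subgroups [M t] in all degrees
   [size t = n.+1]. *)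
Definition acyclic : Prop := forall n (z : seq I -> V),
  (forall t, size t = n.+1 -> M t (z t)) ->
  (forall t, size t = n.+2 -> dl z t = 0) ->
  exists y, (forall t, size t = n -> M t (y t)) /\
            forall t, size t = n.+1 -> z t = dl y t.

End Membership.

(* [M t u] stands for the sections over the intersection of the opens [t_i] of
   a first cover and [u_j] of a second one. *)
Section Comparison.
Context {I J : Type} {V : zmodType} (i0 : I) (j0 : J).
Context (M : seq I -> seq J -> V -> Prop).
Hypotheses (Mg : forall u, subgroups (M^~ u)).
Hypotheses (MI : forall u, augments (M^~ u)) (MJ : forall t, augments (M t)).
Hypothesis acI : forall j u, acyclic (M^~ (j :: u)).
Hypothesis acJ : forall t, acyclic (M t).

Let bounded a b (y : seq I -> seq J -> V) :=
  forall t u, size t = a -> size u = b -> M t u (y t u).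
Let closedI a b (y : seq I -> seq J -> V) :=
  forall t u, size t = a -> size u = b -> dl (y^~ u) t = 0.
Let closedJ a b (y : seq I -> seq J -> V) :=
  forall t u, size t = a -> size u = b -> dl (y t) u = 0.

Let MgJ t : subgroups (M t).
Proof. by split=> [u|u]; [apply: (Mg u).1|apply: (Mg u).2]. Qed.

Let exactI a b y : bounded a.+1 b.+1 y -> closedI a.+2 b.+1 y ->
  exists2 x, bounded a b.+1 x &
    forall t u, size t = a.+1 -> size u = b.+1 -> y t u = dl (x^~ u) t.
Proof.
move=> yM cy.
have H u : exists x, size u = b.+1 ->
    (forall t, size t = a -> M t u (x t)) /\
    forall t, size t = a.+1 -> y t u = dl x t.
  case: u => [|j u]; first by exists (fun=> 0).
  have [su|nsu] := eqVneq (size (j :: u)) b.+1; last first.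
    by exists (fun=> 0) => su; rewrite su eqxx in nsu.
  have [t st|t st|x hx] := @acI j u a (y^~ (j :: u)); last by exists x.
  - exact: yM.
  - exact: cy.
have [x hx] := choice H.
by exists (fun t u => x u t) => t u st su; case: (hx u su) => h1 h2; [apply: h1|apply: h2].
Qed.

Let exactJ a b y : bounded a b.+1 y -> closedJ a b.+2 y ->
  exists2 x, bounded a b x &
    forall t u, size t = a -> size u = b.+1 -> y t u = dl (x t) u.
Proof.
move=> yM cy.
have H t : exists x, size t = a ->
    (forall u, size u = b -> M t u (x u)) /\
    forall u, size u = b.+1 -> y t u = dl x u.
  have [st|nst] := eqVneq (size t) a; last first.
    by exists (fun=> 0) => st; rewrite st eqxx in nst.
  have [u su|u su|x hx] := @acJ t b (y t); last by exists x.
  - exact: yM.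
  - exact: cy.
have [x hx] := choice H.
by exists x => t u st su; case: (hx t st) => h1 h2; [apply: h1|apply: h2].
Qed.

(** Staircase, by induction on [a]. A primitive [x] along I has a differential along J that is
    closed in both directions, hence equal to that of some [w] closed along I; then [x - w] has a
    primitive [v] along J, and the differential of [v] along I is the required cochain. *)
Let zigzag a b y : bounded a b.+1 y -> closedI a.+1 b.+1 y ->
  closedJ a b.+2 y ->
  exists x, [/\ bounded a b x, closedI a.+1 b x &
    forall t u, size t = a -> size u = b.+1 -> y t u = dl (x t) u].
Proof.
elim: a b y => [|a IH] b y yM cI cJ.
  (* For [a = 0], closedness on [[:: i0]] means that [y [::] u] is zero. *)
  exists (fun _ _ => 0); split.
  - by move=> t u _ _; apply: (Mg u).1.
  - by move=> t u _ _; rewrite dl0.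
  - move=> t u /size0nil-> su; rewrite dl0.
    by have /= := cI [:: i0] u erefl su; rewrite subr0.
have [x xM hx] := exactI yM cI.
have [] := IH b.+1 (fun t => dl (x t)).
- move=> t u st su; apply: (@dl_mem _ _ (M t) _ b.+1) => // u' su'.
  exact: xM.
- move=> t u st su; rewrite -dl_comm -(cJ t u) //.
  by apply: eq_dl => u' su'; rewrite hx //; apply: succn_inj; rewrite su'.
- by move=> t u st su; apply: dl_dl.
move=> w [wM cw hw].
have [||v vM hv] := @exactJ a b (fun t u => x t u - w t u).
- by move=> t u st su; apply: (Mg u).2; [apply: xM|apply: wM].
- by move=> t u st su; rewrite dlB hw ?subrr.
exists (fun t u => dl (v^~ u) t); split.
- move=> t u st su; apply: (@dl_mem _ _ (M^~ u) _ a) => // t' st'.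
  exact: vM.
- by move=> t u st su; apply: dl_dl.
- move=> t u st su; rewrite -dl_comm hx // -[LHS]subr0 -(cw t u) // -dlB.
  by apply: eq_dl => t' st'; rewrite -hv //; apply: succn_inj; rewrite st'.
Qed.

(** Comparison of two covers by their double complex. The complex of the first cover is only known
    to be exact over the opens of the second one; the primitives found there are corrected by
    [zigzag] so as to agree on overlaps, and then glued along J. *)
Lemma acyclic_comparison : acyclic (M^~ [::]).
Proof.
move=> n z zM cz.
have [||x xM hx] := @exactI n 0 (fun t _ => z t).
- move=> t [|j [|? ?]] // st _.
  exact: (@MJ t j [::] [::] _ (zM t st)).
- by move=> t u st su; apply: cz.
have [] := @zigzag n 1 (fun t => dl (x t)).
- move=> t u st su; apply: (@dl_mem _ _ (M t) _ 1) => // u' su'.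
  exact: xM.
- move=> t u st su; rewrite -dl_comm -(dl0 (V := V) u).
  case: u su => [|j [|j' [|? ?]]] //= _.
  by rewrite -!hx //= !subr0 subrr.
- by move=> t u st su; apply: dl_dl.
move=> w [wM cw hw].
have [||v vM hv] := @exactJ n 0 (fun t u => x t u - w t u).
- by move=> t u st su; apply: (Mg u).2; [apply: xM|apply: wM].
- by move=> t u st su; rewrite dlB hw ?subrr.
exists (v^~ [::]); split=> [t st|t st]; first exact: vM.
rewrite (hx t [:: j0]) // -[LHS]subr0 -(cw t [:: j0]) // -dlB.
apply: eq_dl => t' st'; rewrite hv //= ?subr0 //; apply: succn_inj.
by rewrite st'.
Qed.

End Comparison.

(** * Polynomials and their homogeneous components *)

Section Filter.
Context {k : fieldType} {n : nat}.
Implicit Types (p q : {mpoly k[n]}) (P : pred 'X_{1..n}).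

Definition mfilter P p : {mpoly k[n]} :=
  \sum_(m <- msupp p | P m) p@_m *: 'X_[m].

Lemma mcoeff_mfilter P p m : (mfilter P p)@_m = if P m then p@_m else 0.
Proof.
rewrite /mfilter raddf_sum /=.
under eq_bigr do rewrite mcoeffZ mcoeffX.
case: (boolP (m \in msupp p)) => hm.
  rewrite -big_filter (bigID (pred1 m)) /= [X in _ + X]big1 ?addr0; last first.
    by move=> i /negPf->; rewrite mulr0.
  rewrite -big_filter -filter_predI; case: ifP => Pm; last first.
    rewrite big_seq big1 // => i; rewrite mem_filter /=.
    by case: eqP => [->|//]; rewrite Pm.
  rewrite (_ : [seq x <- _ | _] = [:: m]) ?big_seq1 ?eqxx ?mulr1 //.
  have := filter_pred1_uniq (msupp_uniq p) hm.
  by move=> <-; apply: eq_filter => x /=; case: eqP => [->|].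
rewrite (memN_msupp_eq0 hm) if_same big_seq_cond big1 // => i /andP[hi _].
by case: eqP => [e|]; rewrite ?mulr0 //; move: hm; rewrite -e hi.
Qed.

Lemma mfilterB P : {morph mfilter P : p q / p - q}.
Proof.
move=> p q; apply/mpolyP => m; rewrite mcoeffB !mcoeff_mfilter mcoeffB.
by case: ifP; rewrite ?subrr.
Qed.

Lemma msupp_mfilter P p m : m \in msupp (mfilter P p) -> P m && (m \in msupp p).
Proof.
rewrite mcoeff_msupp mcoeff_mfilter mcoeff_msupp.
by case: ifP => //; rewrite eqxx.
Qed.

Lemma mpolyX_dvd (a : 'X_{1..n}) p :
  (forall m, m \in msupp p -> (a <= m)%MM) -> exists p', p = 'X_[a] * p'.
Proof.
move=> ha; exists (\sum_(m <- msupp p) p@_m *: 'X_[m - a]).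
rewrite {1}[p]mpolyE mulr_sumr big_seq [RHS]big_seq; apply: eq_bigr => m hm.
by rewrite -scalerAr -mpolyXD addmC submK // ha.
Qed.

Lemma msuppMX_ge (a m : 'X_{1..n}) p : m \in msupp ('X_[a] * p) -> (a <= m)%MM.
Proof.
move=> /msuppM_le /allpairsP[[m1 m2] /= [h1 _ ->]].
by move: h1; rewrite msuppX inE => /eqP->; apply: lem_addr.
Qed.

Lemma mpolyX_coprime (a b : 'X_{1..n}) p q :
  (forall i, a i = 0%N \/ b i = 0%N) -> 'X_[a] * p = 'X_[b] * q ->
  exists r, p = 'X_[b] * r.
Proof.
move=> ab e; apply: mpolyX_dvd => m hm.
have : (a + m)%MM \in msupp ('X_[b] * q).
  by rewrite -e mulrC mcoeff_msupp mcoeffMX -mcoeff_msupp.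
move/msuppMX_ge/mnm_lepP => hb; apply/mnm_lepP => i.
by case: (ab i) (hb i) => [|->//]; rewrite mnmDE => ->; rewrite add0n.
Qed.

Lemma mpoly_ring_ind (P : {mpoly k[n]} -> Prop) :
  (forall c, P c%:MP) -> (forall i, P 'X_i) ->
  (forall p q, P p -> P q -> P (p + q)) ->
  (forall p q, P p -> P q -> P (p * q)) -> forall p, P p.
Proof.
move=> hC hX hD hM p.
have h1 : P 1 by rewrite -mpolyC1.
rewrite [p]mpolyE; apply: (big_ind P) => //; first by rewrite -mpolyC0.
move=> m _; rewrite -mul_mpolyC; apply: (hM) => //; rewrite mpolyXE_id.
apply: (big_ind P) => // i _; elim: (m i) => [|j IH]; first by rewrite expr0.
by rewrite exprS; apply: hM.
Qed.

End Filter.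

Arguments mpoly_ring_ind [k n].

Section Homogeneous.
Context {k : fieldType} {A : coxSpace k}.
Local Notation S := (cox_ring A).
Local Notation G := (cox_grp A).
Implicit Types (p q : S) (g h : G).

Lemma wcompE g p : wcomp g p = mfilter (fun m => wdeg (A := A) m == g) p.
Proof. by []. Qed.

Lemma whomogP g p : whomog g p <-> forall m, p@_m != 0 -> wdeg (A := A) m = g.
Proof.
split=> h m; first by rewrite -mcoeff_msupp => /h.
by rewrite mcoeff_msupp => /h.
Qed.

Lemma whomog_eq g h p : whomog g p -> g = h -> whomog h p.
Proof. by move=> hp <-. Qed.

Lemma whomog0 g : whomog g (0 : S).
Proof. by move=> m; rewrite msupp0. Qed.

Lemma whomogB g p q : whomog g p -> whomog g q -> whomog g (p - q).
Proof. by move=> hp hq; apply: whomogD => //; apply: whomogN. Qed.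

Lemma whomog_sum (I : Type) (r : seq I) (P : pred I) (F : I -> S) g :
  (forall i, P i -> whomog g (F i)) -> whomog g (\sum_(i <- r | P i) F i).
Proof.
move=> h; apply: (big_ind (fun p : S => whomog g p)) => //.
- exact: whomog0.
- by move=> p q; apply: whomogD.
Qed.

Lemma whomogZ g (c : k) p : whomog g p -> whomog g (c *: p).
Proof. by move=> hp m /msuppZ_le /hp. Qed.

Lemma whomog1 : whomog 0 (1 : S).
Proof. by rewrite -mpolyC1; apply: whomogC. Qed.

Lemma whomogXm (m : 'X_{1..cox_var A}) : whomog (wdeg m) ('X_[m] : S).
Proof. by move=> m'; rewrite msuppX inE => /eqP->. Qed.

Lemma wdeg0 : wdeg (0%MM : 'X_{1..cox_var A}) = 0.
Proof. by rewrite /wdeg big1 // => i _; rewrite mnm0E. Qed.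

Lemma wdegU (i : 'I_(cox_var A)) : wdeg U_(i)%MM = cox_wt i.
Proof.
rewrite /wdeg (bigD1 i) //= mnm1E eqxx mulr1n big1 ?addr0 // => j ji.
by rewrite mnm1E eq_sym (negPf ji).
Qed.

Lemma whomogXi (i : 'I_(cox_var A)) : whomog (cox_wt i) ('X_i : S).
Proof. by rewrite -wdegU; apply: whomogXm. Qed.

Lemma whomog_wcomp g p : whomog g (wcomp g p).
Proof. by move=> m /msupp_mfilter/andP[/eqP]. Qed.

Lemma wcompB g : {morph @wcomp _ A g : p q / p - q}.
Proof. exact: mfilterB. Qed.

Lemma wcomp0 g : wcomp g (0 : S) = 0.
Proof. by rewrite -[X in wcomp _ X](subrr 0) wcompB subrr. Qed.

Lemma wcompD g : {morph @wcomp _ A g : p q / p + q}.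
Proof.
by move=> p q; rewrite -[q in LHS]opprK -[- q]sub0r wcompB wcompB wcomp0 sub0r opprK.
Qed.

Lemma wcomp_sum (I : Type) (r : seq I) (P : pred I) (F : I -> S) g :
  wcomp g (\sum_(i <- r | P i) F i) = \sum_(i <- r | P i) wcomp g (F i).
Proof. exact: (big_morph _ (wcompD g) (wcomp0 g)). Qed.

Lemma wcomp_homog g p : whomog g p -> wcomp g p = p.
Proof.
move=> /whomogP hp; apply/mpolyP => m; rewrite wcompE mcoeff_mfilter.
case: eqP => // ne; case: (eqVneq p@_m 0) => [->//|/hp e].
by case: ne.
Qed.

Lemma wcomp_neq g h p : whomog h p -> h != g -> wcomp g p = 0.
Proof.
move=> /whomogP hp ne; apply/mpolyP => m; rewrite wcompE mcoeff_mfilter mcoeff0.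
case: eqP => // e; case: (eqVneq p@_m 0) => [->//|/hp e'].
by rewrite -e' e eqxx in ne.
Qed.

Lemma wcompM g h p q : whomog h q -> wcomp g (p * q) = wcomp (g - h) p * q.
Proof.
move=> hq; elim/mpolyind: p => [|c m p _ _ IH]; first by rewrite mul0r !wcomp0 mul0r.
rewrite mulrDl !wcompD IH mulrDl; congr (_ + _).
have hm : whomog (wdeg m) (c *: 'X_[m] : S) by apply/whomogZ/whomogXm.
have hmq := whomogM hm hq.
case: (eqVneq (wdeg m) (g - h)) => e.
  rewrite (wcomp_homog (whomog_eq hm e)) wcomp_homog //.
  by apply: whomog_eq hmq _; rewrite e subrK.
rewrite (wcomp_neq hm e) mul0r; apply: wcomp_neq hmq _.
by rewrite -[g](subrK h) (inj_eq (addIr h)).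
Qed.

Lemma whomog_deriv g p i : whomog g p -> whomog (g - cox_wt i) (p^`M(i)).
Proof.
move=> /whomogP hp; apply/whomogP => m; rewrite mcoeff_mderiv => h.
have : p@_(m + U_(i)) != 0 by apply: contraNneq h => ->; rewrite mul0rn.
by move/hp => <-; rewrite wdegD wdegU addrK.
Qed.

(** A monomial is an eigenvector of each x_i d/dx_i, with its exponent as eigenvalue, so every
    additive function on degrees yields an Euler derivation. *)
Lemma euler (lam : G -> k) g p :
  (forall g h, lam (g + h) = lam g + lam h) -> whomog g p ->
  \sum_i (lam (cox_wt i) *: ('X_i * p^`M(i))) = lam g *: p.
Proof.
move=> lamD /whomogP hp.
have lam0 : lam 0 = 0 by apply: (addIr (lam 0)); rewrite -lamD !add0r.
have lamn h j : lam (h *+ j) = lam h *+ j.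
  by elim: j => [|j IH]; rewrite ?mulr0n // !mulrS lamD IH.
apply/mpolyP => m; rewrite mcoeffZ raddf_sum /=.
transitivity (\sum_i lam (cox_wt i) * (p@_m *+ m i)).
  apply: eq_bigr => i _; rewrite mcoeffZ; congr (_ * _).
  case: (posnP (m i)) => [mi0|mi].
    rewrite mi0 mulr0n; apply: memN_msupp_eq0; apply/negP => /msuppMX_ge.
    by move/mnm_lepP/(_ i); rewrite mnm1E eqxx mi0.
  have e : m = (U_(i) + (m - U_(i)))%MM.
    by rewrite addmC submK //; apply/mnm_lepP => j; rewrite mnm1E; case: eqP => [<-|].
  by rewrite {1}e mulrC mcoeffMX mcoeff_mderiv addmC -e mnmBE mnm1E eqxx subn1 prednK.
case: (eqVneq p@_m 0) => [->|/hp <-].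
  by rewrite mulr0 big1 // => i _; rewrite mul0rn mulr0.
rewrite /wdeg (big_morph _ lamD lam0) mulr_suml; apply: eq_bigr => i _.
by rewrite lamn mulrnAr mulrnAl.
Qed.

End Homogeneous.

(** * Localizations *)

Section Radical.
Context {R : comNzRingType} (J : R -> Prop).
Hypotheses (JD : forall x y, J x -> J y -> J (x + y)).
Hypotheses (JM : forall x y, J y -> J (x * y)).

Definition radical x : Prop := exists j, J (x ^+ j).

Lemma radicalD x y : J 0 -> radical x -> radical y -> radical (x + y).
Proof.
move=> J0 [a xa] [b yb]; exists (a + b)%N; rewrite exprDn.
apply: (big_ind J) => // i _; rewrite -mulr_natl; apply: JM.
case: (leqP b i) => bi.
  by rewrite -(subnK bi) exprD mulrA; apply: JM.
have ai : (a <= a + b - i)%N by lia.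
by rewrite -(subnK ai) exprD mulrAC; apply: JM.
Qed.

Lemma radicalM x y : radical y -> radical (x * y).
Proof. by move=> [a ya]; exists a; rewrite exprMn; apply: JM. Qed.

Lemma radical_sum (I : Type) (r : seq I) (P : pred I) (F : I -> R) : J 0 ->
  (forall i, P i -> radical (F i)) -> radical (\sum_(i <- r | P i) F i).
Proof.
move=> J0 hF; apply: (big_ind radical) => //; first by exists 1%N; rewrite expr1.
by move=> x y; apply: radicalD.
Qed.

End Radical.

Section Localization.
Context {k : fieldType} {A : coxSpace k} {K : fieldType}.
Context (io : {rmorphism cox_ring A -> K}).
Hypothesis io_inj : injective io.
Local Notation S := (cox_ring A).
Local Notation G := (cox_grp A).
Implicit Types (p : S) (g : G) (h : S * G) (hs us : seq (S * G)) (x y : K).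

Definition denom h : Prop := whomog h.2 h.1 /\ h.1 != 0.
Definition denoms hs : Prop := forall h, h \in hs -> denom h.
Definition prodh hs : S := \prod_(h <- hs) h.1.
Definition degh hs : G := \sum_(h <- hs) h.2.

(* The sections of O(g) over the locus where all the [h.1], h in [hs], are
   invertible. *)
Definition loc hs g x : Prop := exists us p,
  [/\ {subset us <= hs}, whomog (g + degh us) p & x * io (prodh us) = io p].

Lemma prodh_cat us us' : prodh (us ++ us') = prodh us * prodh us'.
Proof. exact: big_cat. Qed.

Lemma degh_cat us us' : degh (us ++ us') = degh us + degh us'.
Proof. exact: big_cat. Qed.

Lemma prodh_cons h us : prodh (h :: us) = h.1 * prodh us.
Proof. exact: big_cons. Qed.

Lemma degh_cons h us : degh (h :: us) = h.2 + degh us.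
Proof. exact: big_cons. Qed.

Lemma prodh_perm us us' : perm_eq us us' -> prodh us = prodh us'.
Proof. by move=> pe; apply: perm_big. Qed.

Lemma degh_perm us us' : perm_eq us us' -> degh us = degh us'.
Proof. by move=> pe; apply: perm_big. Qed.

Lemma prodh_nseq j h : prodh (nseq j h) = h.1 ^+ j.
Proof. by rewrite /prodh big_nseq; elim: j => // j; rewrite exprS /= => ->. Qed.

Lemma degh_nseq j h : degh (nseq j h) = h.2 *+ j.
Proof. by rewrite /degh big_nseq; elim: j => //= j ->; rewrite mulrS. Qed.

Lemma prodh_flatten j us : prodh (flatten (nseq j us)) = prodh us ^+ j.
Proof.
elim: j => [|j IH]; first by rewrite /prodh big_nil.
by rewrite /= prodh_cat IH exprS.
Qed.

Lemma degh_flatten j us : degh (flatten (nseq j us)) = degh us *+ j.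
Proof.
elim: j => [|j IH]; first by rewrite /degh big_nil.
by rewrite /= degh_cat IH mulrS.
Qed.

Lemma prodh_neq0 us : denoms us -> prodh us != 0.
Proof. by move=> du; rewrite prodf_seq_neq0; apply/allP => h /du[]. Qed.

Lemma io_neq0 p : p != 0 -> io p != 0.
Proof. by rewrite -(inj_eq io_inj) rmorph0. Qed.

Lemma whomog_prodh us : denoms us -> whomog (degh us) (prodh us).
Proof.
rewrite /degh /prodh; elim: us => [|h us IH] du; first by rewrite !big_nil; apply: whomog1.
rewrite !big_cons; apply: whomogM; first by apply: (du h _).1; rewrite inE eqxx.
by apply: IH => h' hu; apply: du; rewrite inE hu orbT.
Qed.

Lemma denoms_sub hs us : denoms hs -> {subset us <= hs} -> denoms us.
Proof. by move=> dh uh h /uh/dh. Qed.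

Lemma loc_sub hs hs' g x : {subset hs <= hs'} -> loc hs g x -> loc hs' g x.
Proof. by move=> hh [us [p [uh hp e]]]; exists us, p; split=> // h /uh/hh. Qed.

Lemma loc_poly hs g p : whomog g p -> loc hs g (io p).
Proof.
by exists [::], p; split=> //; rewrite /degh /prodh ?big_nil ?addr0 // rmorph1 mulr1.
Qed.

Lemma loc_inv hs h : denom h -> h \in hs -> loc hs (- h.2) (io h.1)^-1.
Proof.
move=> [hh h0] hin; exists [:: h], 1; split.
- by move=> h'; rewrite inE => /eqP->.
- by rewrite /degh big_seq1 addNr; apply: whomog1.
- by rewrite /prodh big_seq1 mulVf ?io_neq0 // rmorph1.
Qed.

Lemma loc0 hs g : loc hs g 0.
Proof. by rewrite -(rmorph0 io); apply/loc_poly/whomog0. Qed.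

Section Closure.
Context (hs : seq (S * G)) (dh : denoms hs).

Lemma locB g x y : loc hs g x -> loc hs g y -> loc hs g (x - y).
Proof.
move=> [us [p [uh hp e]]] [us' [p' [uh' hp' e']]].
exists (us ++ us'), (p * prodh us' - p' * prodh us); split.
- by move=> h; rewrite mem_cat => /orP[/uh|/uh'].
- rewrite degh_cat; apply: whomogB; first rewrite addrA.
    exact/whomogM/whomog_prodh/denoms_sub/uh'.
  by rewrite addrCA addrC; apply/whomogM/whomog_prodh/denoms_sub/uh.
- by rewrite prodh_cat !rmorphB !rmorphM -e -e' /=; ring.
Qed.

Lemma locN g x : loc hs g x -> loc hs g (- x).
Proof. by rewrite -sub0r; apply/locB/loc0. Qed.

Lemma locD g x y : loc hs g x -> loc hs g y -> loc hs g (x + y).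
Proof. by rewrite -[y in x + y]opprK => hx hy; apply/locB/locN. Qed.

Lemma loc_sum (I : Type) (r : seq I) (P : pred I) (F : I -> K) g :
  (forall i, P i -> loc hs g (F i)) -> loc hs g (\sum_(i <- r | P i) F i).
Proof.
by move=> hF; apply: (big_ind (loc hs g)) => //; [apply: loc0|apply: locD].
Qed.

Lemma locM g g' x y : loc hs g x -> loc hs g' y -> loc hs (g + g') (x * y).
Proof.
move=> [us [p [uh hp e]]] [us' [p' [uh' hp' e']]].
exists (us ++ us'), (p * p'); split.
- by move=> h; rewrite mem_cat => /orP[/uh|/uh'].
- by rewrite degh_cat addrACA; apply: whomogM.
- by rewrite prodh_cat !rmorphM -e -e' /=; ring.
Qed.

Lemma locX g x j : loc hs g x -> loc hs (g *+ j) (x ^+ j).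
Proof.
move=> hx; elim: j => [|j IH]; last by rewrite exprS mulrS; apply: locM.
by rewrite expr0 mulr0n -(rmorph1 io); apply/loc_poly/whomog1.
Qed.

Lemma prodh_dvd us : {subset us <= hs} -> forall l, (size us <= l)%N ->
  exists2 p, prodh us * p = prodh hs ^+ l &
    whomog (degh hs *+ l - degh us) p.
Proof.
elim: us => [|h us IH] uh l.
  move=> _; exists (prodh hs ^+ l); first by rewrite /prodh big_nil mul1r.
  by rewrite /degh big_nil subr0; apply/whomogX/whomog_prodh.
case: l => // l; rewrite /= ltnS => ul.
have [|p e hp] := IH _ l ul.
  by move=> h' hu; apply: uh; rewrite inE hu orbT.
have /perm_to_rem ph : h \in hs by apply: uh; rewrite inE eqxx.
exists (prodh (rem h hs) * p).
  by rewrite exprS -e (prodh_perm ph) !prodh_cons; ring.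
have -> : degh hs *+ l.+1 - degh (h :: us) =
    degh (rem h hs) + (degh hs *+ l - degh us).
  rewrite mulrS {1}(degh_perm ph) !degh_cons [h.2 + _]addrC opprD -!addrA.
  by congr (_ + _); rewrite addrCA [h.2 + _]addrA subrr add0r.
apply: whomogM => //; apply: whomog_prodh => h' hh'; apply: dh.
exact: mem_rem hh'.
Qed.

Lemma loc_den g x : loc hs g x -> exists l0, forall l, (l0 <= l)%N ->
  exists2 p, whomog (g + degh hs *+ l) p & x * io (prodh hs) ^+ l = io p.
Proof.
move=> [us [p [uh hp e]]]; exists (size us) => l /(prodh_dvd uh)[r er hr].
exists (p * r); last by rewrite -rmorphXn -er !rmorphM -e /=; ring.
by apply: whomog_eq (whomogM hp hr) _; rewrite addrACA subrr addr0.
Qed.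

End Closure.

(** A power of [h] absorbs the copies of [h] among the denominators, and every larger power does so
    as well. *)
Lemma loc_cons h hs g x : denoms (h :: hs) -> loc (h :: hs) g x ->
  exists j0, forall j, (j0 <= j)%N -> loc hs (g + h.2 *+ j) (x * io h.1 ^+ j).
Proof.
move=> dh [us [p [uh hp e]]]; exists (count_mem h us) => j jc.
have dh1 := dh h (mem_head _ _).
have pu : perm_eq us (filter (pred1 h) us ++ filter (predC (pred1 h)) us).
  by rewrite perm_sym perm_filterC.
have ef : filter (pred1 h) us = nseq (count_mem h us) h.
  by rewrite -size_filter; apply/all_pred1P/filter_all.
pose vs := filter (predC (pred1 h)) us.
have ep : prodh us = h.1 ^+ count_mem h us * prodh vs.
  by rewrite {1}(prodh_perm pu) ef prodh_cat prodh_nseq.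
have ed : degh us = h.2 *+ count_mem h us + degh vs.
  by rewrite {1}(degh_perm pu) ef degh_cat degh_nseq.
exists vs, (p * h.1 ^+ (j - count_mem h us)); split.
- move=> h'; rewrite mem_filter /= => /andP[ne /uh].
  by rewrite inE (negPf ne).
- have H := whomogM hp (whomogX (l := (j - count_mem h us)%N) dh1.1).
  apply: whomog_eq H _; rewrite ed -[in RHS](subnK jc) mulrnDr -!addrA.
  by congr (_ + _); rewrite addrA addrC.
- rewrite -[in LHS](subnK jc) exprD [in RHS]rmorphM -e ep !rmorphM !rmorphXn /=.
  by rewrite mulrA -!mulrA; congr (_ * _); rewrite mulrC mulrA.
Qed.

Section PartitionOfUnity.
Context {I : finType} (e : I -> S * G) (hs : seq (S * G)) (g : G).
Hypotheses (de : forall i, denom (e i)) (dh : denoms hs).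

(** The loci [e i] <> 0 cover that of the [hs]: a unit of the latter lies in the ideal of the j-th
    powers of the [e i], for every j and with homogeneous coefficients. *)
Definition covers : Prop := forall j, exists us (c : I -> S),
  [/\ {subset us <= hs}, forall i, whomog (degh us - (e i).2 *+ j) (c i) &
      prodh us = \sum_i c i * (e i).1 ^+ j].

Lemma denoms_map t : denoms (map e t ++ hs).
Proof. by move=> h; rewrite mem_cat => /orP[/mapP[i _ ->]|/dh]. Qed.

(** The usual contraction on an affine open: a partition of unity by j-th powers combines the
    [z (i :: t)] into a primitive. The exponent j has to clear the denominators in [e i] of all the
    [z (i :: t)] at once; they are finitely many, since lists of size n are tuples in a finite
    type. *)
Lemma acyclic_cover : covers -> acyclic (fun t => loc (map e t ++ hs) g).
Proof.
move=> cov n z zM cz.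
have H (iu : I * n.-tuple I) : exists j0, forall j, (j0 <= j)%N ->
    loc (map e iu.2 ++ hs) (g + (e iu.1).2 *+ j)
      (z (iu.1 :: iu.2) * io (e iu.1).1 ^+ j).
  apply: (@loc_cons (e iu.1)); last first.
    by apply: (zM (iu.1 :: iu.2)); rewrite /= size_tuple.
  exact: (@denoms_map (iu.1 :: iu.2)).
have [j0 hj] := choice H.
have [us [c [uh ch ce]]] := cov (\max_iu j0 iu).
set j := \max_iu j0 iu in ch ce.
have u0 : io (prodh us) != 0.
  by apply/io_neq0/prodh_neq0/denoms_sub/uh.
exists (fun t => \sum_i io (c i) * (z (i :: t) * io (e i).1 ^+ j) / io (prodh us)).
split=> t st.
  have dt := @denoms_map t.
  apply: loc_sum => // i _; rewrite -[g](addrNK (degh us)) -[_ - _]/(g - degh us).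
  have -> : g - degh us + degh us =
      (degh us - (e i).2 *+ j) + (g + (e i).2 *+ j) - degh us.
    by rewrite addrNK [g + _]addrC addrA addrNK [degh us + g]addrC addrK.
  apply: locM; first apply: locM.
  - exact: loc_poly.
  - have := hj (i, tcast st (in_tuple t)) j; rewrite /= val_tcast; apply.
    exact: (leq_bigmax (i, tcast st (in_tuple t))).
  - exists us, 1; split.
    + by move=> h /uh hh; rewrite mem_cat hh orbT.
    + by rewrite addNr; apply: whomog1.
    + by rewrite mulVf // rmorph1.
rewrite dl_sum; transitivity (\sum_i io (c i * (e i).1 ^+ j) / io (prodh us) * z t).
  by rewrite -mulr_suml -mulr_suml -rmorph_sum -ce divff // mul1r.
apply: eq_bigr => i _.
have := cz (i :: t); rewrite /= st => /(_ erefl)/eqP; rewrite subr_eq0 => /eqP->.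
rewrite (dl_is_additive (h := fun x => io (c i * (e i).1 ^+ j) / io (prodh us) * x)); last first.
  by move=> x y; rewrite mulrBr.
by apply: eq_dl => r _ /=; rewrite rmorphM rmorphXn /=; ring.
Qed.

(** First powers suffice: the unit then lies in the radical of the ideal of the j-th powers, and a
    homogeneous component of the resulting identity has coefficients of the right degrees. *)
Lemma covers_radical us (c : I -> S) : {subset us <= hs} ->
  prodh us = \sum_i c i * (e i).1 -> covers.
Proof.
move=> uh ce j.
pose J (p : S) := exists c : I -> S, p = \sum_i c i * (e i).1 ^+ j.
have J0 : J 0 by exists (fun=> 0); rewrite big1 // => i _; rewrite mul0r.
have JD (x y : S) : J x -> J y -> J (x + y).
  move=> [a ->] [b ->]; exists (fun i => a i + b i); rewrite -big_split.
  by apply: eq_bigr => i _; rewrite mulrDl.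
have JM (x y : S) : J y -> J (x * y).
  move=> [a ->]; exists (fun i => x * a i); rewrite mulr_sumr.
  by apply: eq_bigr => i _; rewrite mulrA.
have : radical J (prodh us).
  rewrite ce; apply: radical_sum => // i _; apply: radicalM => //.
  exists j; exists (fun i' => (i' == i)%:R).
  rewrite (bigD1 i) //= eqxx mul1r big1 ?addr0 // => i' /negPf->.
  by rewrite mul0r.
move=> [a [b hb]]; exists (flatten (nseq a us)), (fun i => wcomp (degh us *+ a - (e i).2 *+ j) (b i)).
rewrite degh_flatten; split=> //.
- by move=> h /flattenP[v /nseqP[-> _]]; apply: uh.
- by move=> i; apply: whomog_wcomp.
have du := denoms_sub dh uh.
rewrite prodh_flatten -[LHS](wcomp_homog (whomogX (l := a) (whomog_prodh du))) hb wcomp_sum.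
by apply: eq_bigr => i _; rewrite (wcompM _ _ (whomogX (l := j) (de i).1)).
Qed.

End PartitionOfUnity.

End Localization.

(** * Acyclicity of monomial covers *)

Section MonomialCover.
Context {k : fieldType} {A : coxSpace k} {K : fieldType}.
Context (io : {rmorphism cox_ring A -> K}).
Hypothesis io_inj : injective io.
Local Notation S := (cox_ring A).
Local Notation G := (cox_grp A).
Local Notation n := (cox_var A).

Definition var (i : 'I_n) : S * G := ('X_i, cox_wt i).

Definition mcst (L : nat) : 'X_{1..n} := [multinom L | _ < n].

Lemma mpolyX_neq0 (m : 'X_{1..n}) : ('X_[m] : S) != 0.
Proof.
apply/eqP => /(congr1 (mcoeff m)); rewrite mcoeffX eqxx mcoeff0.
by move/eqP; rewrite oner_eq0.
Qed.

Lemma denom_var i : denom (var i).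
Proof. by split; [apply: whomogXi|apply: mpolyX_neq0]. Qed.

Lemma denoms_var B : denoms (map var B).
Proof. by move=> h /mapP[i _ ->]; apply: denom_var. Qed.

Lemma prodh_var (us : seq (S * G)) B : {subset us <= map var B} ->
  exists m : 'X_{1..n}, [/\ prodh us = 'X_[m], degh us = wdeg m,
    forall i, i \notin B -> m i = 0%N & forall i, (m i <= size us)%N].
Proof.
elim: us => [|h us IH] uB.
  exists 0%MM; split=> [||i _|i]; rewrite ?mnm0E //.
    by rewrite /prodh big_nil mpolyX0.
  by rewrite /degh big_nil wdeg0.
have [|m [ep ed m0 ms]] := IH; first by move=> h' hu; apply: uB; rewrite inE hu orbT.
have /mapP[i iB ->] : h \in map var B by apply: uB; rewrite inE eqxx.
exists (U_(i) + m)%MM; split.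
- by rewrite prodh_cons ep mpolyXD.
- by rewrite degh_cons ed wdegD wdegU.
- by move=> j jB; rewrite mnmDE m0 // mnm1E; case: eqP jB => // <-; rewrite iB.
- move=> j; rewrite mnmDE mnm1E /= -add1n leq_add //; case: eqP => //.
Qed.

Lemma var_prodh (m : 'X_{1..n}) B : (forall i, i \notin B -> m i = 0%N) ->
  exists us, [/\ {subset us <= map var B}, prodh us = 'X_[m] & degh us = wdeg m].
Proof.
move=> mB; exists (flatten [seq nseq (m i) (var i) | i <- enum 'I_n]); split.
- move=> h /flattenP[v /mapP[i _ ->] /nseqP[-> mi]]; apply: map_f.
  by apply: contraLR mi => /mB ->.
- rewrite mpolyXE_id -[RHS]big_enum; elim: (enum _) => [|i s IH] /=; first by rewrite /prodh !big_nil.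
  by rewrite prodh_cat IH big_cons prodh_nseq.
- rewrite /wdeg -[RHS]big_enum; elim: (enum _) => [|i s IH] /=; first by rewrite /degh !big_nil.
  by rewrite degh_cat IH big_cons degh_nseq.
Qed.

(** A section cleared of the denominator (x_1 ... x_n)^L: a monomial [m] of [p] stands for the
    Laurent monomial with exponents [m i - L], and [L <= m i] means that it has no pole along x_i =
    0. *)
Definition laurent (B : seq (ordinal n)) g L x (p : S) : Prop :=
  x * io 'X_[mcst L] = io p /\ forall m, m \in msupp p ->
  wdeg m = g + wdeg (mcst L) /\ forall i, i \notin B -> (L <= m i)%N.

Lemma loc_laurent B g x : loc io (map var B) g x ->
  exists L0, forall L, (L0 <= L)%N -> exists p, laurent B g L x p.
Proof.
move=> [us [p [/prodh_var[mu [ep ed m0 ms]] hp e]]]; exists (size us) => L sL.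
have eL : mcst L = ((mcst L - mu) + mu)%MM.
  by rewrite submK //; apply/mnm_lepP => i; rewrite mnmE (leq_trans (ms i)).
exists ('X_[mcst L - mu] * p); split.
  by rewrite {1}eL mpolyXD -ep rmorphM mulrCA e -rmorphM.
move=> m hm; split.
  rewrite (whomogM (@whomogXm _ A (mcst L - mu)%MM) hp hm) {2}eL wdegD ed.
  by rewrite addrCA.
move=> i iB; have /mnm_lepP/(_ i) := msuppMX_ge hm.
by rewrite mnmBE m0 // subn0 mnmE.
Qed.

Lemma laurent_loc B g L x p : laurent B g L x p -> loc io (map var B) g x.
Proof.
move=> [e hp].
pose a : 'X_{1..n} := [multinom (if i \in B then 0 else L)%N | i < n].
pose b : 'X_{1..n} := [multinom (if i \in B then L else 0)%N | i < n].
have eab : mcst L = (a + b)%MM.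
  by apply/mnmP => i; rewrite mnmDE !mnmE; case: ifP; rewrite ?addn0.
have [m hm|p' ep] := @mpolyX_dvd _ _ a p.
  apply/mnm_lepP => i; rewrite mnmE; case: ifPn => // iB.
  by case: (hp m hm) => _; apply.
have [|us [uB eu du]] := @var_prodh b B.
  by move=> i /negPf iB; rewrite mnmE iB.
exists us, p'; split; first exact: uB.
- move=> m hm; have := (hp (a + m)%MM); rewrite ep mulrC mcoeff_msupp mcoeffMX.
  rewrite -mcoeff_msupp => /(_ hm)[+ _]; rewrite eab !wdegD du.
  by rewrite [wdeg a + wdeg b]addrC [wdeg a + _]addrC addrA => /addIr.
- apply: (mulIf (io_neq0 io_inj (mpolyX_neq0 a))).
  rewrite -[RHS]rmorphM [p' * _]mulrC -ep -e eab mpolyXD eu rmorphM; ring.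
Qed.

Section Acyclic.
Context {J : finType} (v : J -> 'I_n) (B : seq 'I_n) (g : G).

(* A Laurent monomial of degree [g] which is regular outside the base and
   the cover has a nonnegative exponent on some variable of the cover. *)
Hypothesis monomials : forall (m : 'X_{1..n}) L,
  wdeg m = g + wdeg (mcst L) ->
  (forall i, i \notin B -> (forall j, v j != i) -> (L <= m i)%N) ->
  exists j, (L <= m (v j))%N.

(** The complex splits by Laurent monomials. For a monomial that is regular in the variable [v j],
    putting the index [j] in front is a contraction; the hypothesis supplies such a [j] for each
    monomial that occurs. *)
Lemma acyclic_monomials :
  acyclic (fun t => loc io (map (var \o v) t ++ map var B) g).
Proof.
move=> l z zM cz.
have em t : map (var \o v) t ++ map var B = map var (map v t ++ B).
  by rewrite map_cat -map_comp.
have H (t : l.+1.-tuple J) : exists L0, forall L, (L0 <= L)%N ->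
    exists p, laurent (map v t ++ B) g L (z t) p.
  by apply: loc_laurent; rewrite -em; apply: zM; rewrite size_tuple.
have [L0 hL0] := choice H; pose L := (\max_t L0 t)%N.
have /choice[p hp] t : exists p, size t = l.+1 -> laurent (map v t ++ B) g L (z t) p.
  have [st|st] := eqVneq (size t) l.+1; last first.
    by exists 0 => e; rewrite e eqxx in st.
  have [|q hq] := hL0 (tcast st (in_tuple t)) L.
    exact: (leq_bigmax (tcast st (in_tuple t))).
  by exists q; rewrite val_tcast in hq.
have XL0 := io_neq0 io_inj (mpolyX_neq0 (mcst L)).
(* The index attached to a monomial depends on the monomial alone, so that the filtering commutes
   with [dl]. *)
pose pj j (m : 'X_{1..n}) := [pick j | (L <= m (v j))%N] == Some j.
exists (fun t => \sum_j io (mfilter (pj j) (p (j :: t))) / io 'X_[mcst L]).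
split=> t st.
  apply: loc_sum => [|j _].
    by move=> h; rewrite em => /mapP[i _ ->]; apply: denom_var.
  rewrite em; apply: (@laurent_loc _ _ L _ (mfilter (pj j) (p (j :: t)))).
  split; first by rewrite divfK.
  move=> m /msupp_mfilter/andP[pjm hm].
  have [|_ hpt] := hp (j :: t); first by rewrite /= st.
  have [-> hi] := hpt m hm; split=> // i; rewrite mem_cat => iB.
  have [->|ne] := eqVneq i (v j).
    by move: pjm; rewrite /pj; case: pickP => // j' hj' /eqP[<-].
  by apply: hi; rewrite mem_cat inE (negPf ne).
(* The cocycle condition on [j :: t], read on numerators. *)
have pd j : p t = dl (fun r => p (j :: r)) t.
  apply: io_inj; rewrite (dl_is_additive (h := io)); last exact: rmorphB.
  have [e _] := hp t st; rewrite -e.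
  have := cz (j :: t); rewrite /= st => /(_ erefl)/eqP; rewrite subr_eq0 => /eqP->.
  rewrite (dl_is_additive (h := fun x => x * io 'X_[mcst L])); last first.
    by move=> x y; rewrite mulrBl.
  apply: eq_dl => r sr /=; have [|-> //] := hp (j :: r).
  by rewrite /= sr st.
have ps : p t = \sum_j mfilter (pj j) (p t).
  apply/mpolyP => m; rewrite raddf_sum /=.
  under eq_bigr do rewrite mcoeff_mfilter.
  have [hm|hm] := boolP (m \in msupp (p t)); last first.
    by rewrite (memN_msupp_eq0 hm) big1 // => j _; rewrite if_same.
  have [_ /(_ m hm)[dm mB]] := hp t st.
  have [j hj] : exists j, (L <= m (v j))%N.
    apply: (monomials dm) => i iB vi; apply: mB; rewrite mem_cat negb_or iB andbT.
    by apply/mapP => -[j _ e]; move: (vi j); rewrite e eqxx.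
  rewrite /pj; case: pickP => [j1 _|/(_ j)]; last by rewrite hj.
  rewrite (bigD1 j1) //= eqxx big1 ?addr0 // => j2 ne.
  by case: eqP => // -[e]; rewrite e eqxx in ne.
rewrite dl_sum; have [ez _] := hp t st.
apply: (mulIf XL0); rewrite ez ps rmorph_sum mulr_suml; apply: eq_bigr => j _.
rewrite (dl_is_additive (h := fun x => x * io 'X_[mcst L])); last first.
  by move=> x y; rewrite mulrBl.
rewrite (pd j) (dl_is_additive (h := fun x => io (mfilter (pj j) x))); last first.
  by move=> x y; rewrite mfilterB rmorphB.
by apply: eq_dl => r _ /=; rewrite divfK.
Qed.

End Acyclic.

End MonomialCover.

(** * Acyclicity of covers by divisors *)

Lemma mem_catCA (T : eqType) (a b c : seq T) : a ++ (b ++ c) =i b ++ (a ++ c).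
Proof. by move=> x; rewrite !mem_cat orbCA. Qed.

Section Covers.
Context {k : fieldType} {A : coxSpace k} {K : fieldType}.
Context (io : {rmorphism cox_ring A -> K}).
Hypothesis io_inj : injective io.
Local Notation S := (cox_ring A).
Local Notation G := (cox_grp A).
Local Notation n := (cox_var A).

Lemma acyclic_ext (I : Type) (V : zmodType) (M M' : seq I -> V -> Prop) :
  (forall t x, M t x <-> M' t x) -> acyclic M -> acyclic M'.
Proof.
move=> e ac l z zM cz; have [|y [yM hy]] := ac l z _ cz.
  by move=> t /zM/e.
by exists y; split=> // t /yM/e.
Qed.

Lemma acyclic_loc_sub (I : Type) (f f' : seq I -> seq (S * G)) g :
  (forall t, f t =i f' t) -> acyclic (fun t => loc io (f t) g) ->
  acyclic (fun t => loc io (f' t) g).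
Proof.
move=> e; apply: acyclic_ext => t x.
by split; apply: loc_sub => h; rewrite e.
Qed.

(** The divisors [e i] are compared with the coordinate loci of the [v j]. The latter give an
    acyclic cover globally by counting monomials, and over each [e i] because [e i] is in the ideal
    of the [v j]. What remains is the cover by the [e i] over the loci of the [v j], which is the
    last hypothesis. *)
Lemma acyclic_divisors (I J : finType) (e : I -> S * G) (v : J -> 'I_n)
    (B : seq 'I_n) g (i0 : I) (j0 : J) :
  (forall i, denom (e i)) ->
  (forall i, exists c, (e i).1 = \sum_j c j * 'X_(v j)) ->
  (forall (m : 'X_{1..n}) L, wdeg m = g + wdeg (@mcst _ A L) ->
    (forall i, i \notin B -> (forall j, v j != i) -> (L <= m i)%N) ->
    exists j, (L <= m (v j))%N) ->
  (forall j u, acyclic (fun t =>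
    loc io (map e t ++ map (@var _ A) (map v (j :: u) ++ B)) g)) ->
  acyclic (fun t => loc io (map e t ++ map (@var _ A) B) g).
Proof.
move=> de he hm hb.
have dB := @denoms_var _ A.
have dt t B' : denoms (map e t ++ map (@var _ A) B').
  by move=> h; rewrite mem_cat => /orP[/mapP[i _ ->]|/dB].
have em u : map (@var _ A) (map v u ++ B) = map (@var _ A \o v) u ++ map (@var _ A) B.
  by rewrite map_cat -map_comp.
apply: (acyclic_comparison i0 j0
  (M := fun t u => loc io (map e t ++ map (@var _ A) (map v u ++ B)) g)) => //.
- move=> u; split=> [t|t x y]; first exact: loc0.
  exact/locB/dt.
- move=> u i t t' x; apply: loc_sub => h /=; rewrite !map_cat /= !mem_cat inE.
  by case/orP=> [/orP[->|->]|->]; rewrite ?orbT.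
- move=> t j u u' x; apply: loc_sub => h /=; rewrite !map_cat /= !mem_cat inE.
  by case/or3P=> [->|/orP[->|->]|->]; rewrite ?orbT.
- move=> [|i t].
    apply: acyclic_loc_sub (acyclic_monomials io_inj hm) => u h /=.
    by rewrite map_cat -map_comp.
  apply: (@acyclic_loc_sub _ (fun u => map (@var _ A \o v) u ++
      (map e (i :: t) ++ map (@var _ A) B))).
    by move=> u; rewrite em; apply: mem_catCA.
  have dv j : denom ((@var _ A \o v) j) by apply: denom_var.
  apply: acyclic_cover => //; have [c hc] := he i.
  apply: (covers_radical dv (@dt (i :: t) B) (us := [:: e i]) (c := c)) => //.
    by move=> h; rewrite !inE => /eqP->; rewrite eqxx.
  by rewrite prodh_cons /prodh big_nil mulr1.
Qed.

Lemma denoms_mapf (I : Type) (e : I -> S * G) t :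
  (forall i, denom (e i)) -> denoms (map e t).
Proof.
by move=> de; elim: t => [|i t IH] h //=; rewrite inE => /orP[/eqP->|/IH].
Qed.

Lemma loc_subgroups (I : Type) (e : I -> S * G) g : (forall i, denom (e i)) ->
  subgroups (fun t => loc io (map e t) g).
Proof.
by move=> de; split=> [t|t x y]; [apply: loc0|apply/locB/denoms_mapf].
Qed.

Lemma loc_augments (I : Type) (e : I -> S * G) g :
  augments (fun t => loc io (map e t) g).
Proof.
move=> i t u x; apply: loc_sub => h /=; rewrite !map_cat /= !mem_cat inE.
by case/orP=> ->; rewrite ?orbT.
Qed.

Section Modulo.
Context (q : S) (gq : G) (hq : whomog gq q).

(** Divisibility by [q] on the open set, without degrees; for a homogeneous section [loc_qmod] gives
    a quotient of the right degree. *)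
Definition qmod (hs : seq (S * G)) (x : K) : Prop := exists us p,
  {subset us <= hs} /\ x * io (prodh us) = io (q * p).

(** Exactness of the augmented Cech complex of O_Y(g), where Y is q = 0: cochains are lifted to the
    ambient space and compared modulo [q]. In the lowest degree it says that global sections come
    from polynomials. *)
Definition acyclic_mod (I : Type) (e : I -> S * G) (g : G) : Prop :=
  forall l (z : seq I -> K),
  (forall t, size t = l.+1 -> loc io (map e t) g (z t)) ->
  (forall t, size t = l.+2 -> qmod (map e t) (dl z t)) ->
  exists y, (forall t, size t = l -> loc io (map e t) g (y t)) /\
            forall t, size t = l.+1 -> qmod (map e t) (z t - dl y t).

Lemma qmod_sub hs hs' x : {subset hs <= hs'} -> qmod hs x -> qmod hs' x.
Proof. by move=> hh [us [p [uh e]]]; exists us, p; split=> // h /uh/hh. Qed.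

Lemma qmod0 hs : qmod hs 0.
Proof. by exists [::], 0; rewrite mul0r mulr0 rmorph0. Qed.

Lemma qmodB hs x y : qmod hs x -> qmod hs y -> qmod hs (x - y).
Proof.
move=> [us [p [uh e]]] [us' [p' [uh' e']]].
exists (us ++ us'), (p * prodh us' - p' * prodh us); split.
  by move=> h; rewrite mem_cat => /orP[/uh|/uh'].
rewrite prodh_cat mulrBr rmorphB !mulrA !rmorphM /= -!rmorphM.
by rewrite [io (q * p * _)]rmorphM [io (q * p' * _)]rmorphM -e -e' rmorphM; ring.
Qed.

Lemma qmodN hs x : qmod hs x -> qmod hs (- x).
Proof. by rewrite -sub0r; apply/qmodB/qmod0. Qed.

Lemma qmodD hs x y : qmod hs x -> qmod hs y -> qmod hs (x + y).
Proof. by rewrite -[y in x + y]opprK => hx hy; apply/qmodB/qmodN. Qed.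

Lemma qmod_sum (I : Type) (r : seq I) (P : pred I) (F : I -> K) hs :
  (forall i, P i -> qmod hs (F i)) -> qmod hs (\sum_(i <- r | P i) F i).
Proof.
by move=> hF; apply: (big_ind (qmod hs)) => //; [apply: qmod0|apply: qmodD].
Qed.

Lemma qmodMl hs us p x y : {subset us <= hs} -> x * io (prodh us) = io p ->
  qmod hs y -> qmod hs (x * y).
Proof.
move=> uh e [us' [p' [uh' e']]].
exists (us ++ us'), (p * p'); split.
  by move=> h; rewrite mem_cat => /orP[/uh|/uh'].
by rewrite prodh_cat mulrCA !rmorphM -e mulrACA e' rmorphM; ring.
Qed.

Lemma qmodM hs g x y : loc io hs g x -> qmod hs y -> qmod hs (x * y).
Proof. by move=> [us [p [uh _ e]]]; apply: qmodMl e. Qed.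

Lemma qmod_poly hs p : qmod hs (io (q * p)).
Proof. by exists [::], p; rewrite /prodh big_nil rmorph1 mulr1. Qed.

Lemma qmod_subr hs x y : qmod hs (x - y) -> qmod hs y -> qmod hs x.
Proof. by move=> h1 /(qmodD h1); rewrite subrK. Qed.

Lemma loc_qmod hs g x : denoms hs -> loc io hs g x -> qmod hs x ->
  exists2 r, loc io hs (g - gq) r & x = io q * r.
Proof.
move=> dh [us [p [uh hp e]]] [us' [p' [uh' e']]].
have u0 := io_neq0 io_inj (prodh_neq0 (denoms_sub dh uh)).
have u0' := io_neq0 io_inj (prodh_neq0 (denoms_sub dh uh')).
have hu := whomog_prodh (denoms_sub dh uh).
have hu' := whomog_prodh (denoms_sub dh uh').
pose r := wcomp (g + degh us' - gq) p'.
have E : p * prodh us' = r * (q * prodh us).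
  rewrite -(wcomp_homog (whomogM hp hu')) /r.
  have -> : p * prodh us' = p' * (q * prodh us).
    apply: io_inj; rewrite rmorphM -e mulrAC e' -rmorphM; congr (io _); ring.
  rewrite (wcompM _ _ (whomogM hq hu)); congr (wcomp _ _ * _).
  by rewrite opprD (addrAC g) addrACA subrr addr0.
have xE : x * io (prodh us') = io q * io r.
  apply: (mulIf u0); rewrite mulrAC e -[LHS]rmorphM E !rmorphM /=.
  by rewrite mulrCA mulrA.
exists (io r / io (prodh us')); last by rewrite mulrA -xE mulfK.
exists us', r; split=> //; last by rewrite divfK.
by rewrite /r; apply: whomog_eq (@whomog_wcomp _ _ _ _) _; rewrite addrAC.
Qed.

Lemma loc_qmod_unit hs g x : (q, gq) \in hs -> loc io hs g x -> qmod hs x.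
Proof.
move=> hq' [us [p [uh _ e]]]; exists ((q, gq) :: us), p; split.
  by move=> h; rewrite inE => /orP[/eqP->|/uh].
by rewrite prodh_cons rmorphM mulrCA e -rmorphM.
Qed.

Lemma acyclic_mod0 (I : Type) (e : I -> S * G) g : q = 0 ->
  (forall i, denom (e i)) -> acyclic (fun t => loc io (map e t) g) ->
  acyclic_mod e g.
Proof.
move=> q0 de ac l z zM cz; have [t st|y [yM hy]] := ac l z zM.
  have [us [p [uh]]] := cz t st; rewrite q0 mul0r rmorph0 => /eqP.
  have us0 := prodh_neq0 (denoms_sub (@denoms_mapf _ e t de) uh).
  by rewrite mulf_eq0 (negPf (io_neq0 io_inj us0)) orbF => /eqP.
exists y; split=> // t st; rewrite hy // subrr; exact: qmod0.
Qed.

(** The sequence 0 -> O(g - gq) -> O(g) -> O_Y(g) -> 0: the differential of [z] is [q] times a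
    cocycle, and a primitive [r] of the latter makes [z - q * r] a cocycle. *)
Lemma acyclic_mod_lift (I : Type) (e : I -> S * G) g : q != 0 ->
  (forall i, denom (e i)) -> acyclic (fun t => loc io (map e t) g) ->
  acyclic (fun t => loc io (map e t) (g - gq)) -> acyclic_mod e g.
Proof.
move=> q0 de acg acq l z zM cz; have iq0 := io_neq0 io_inj q0.
have dt t := @denoms_mapf _ e t de.
have [|t st|r [rM hr]] := @acq l.+1 (fun t => dl z t / io q).
- move=> t st.
  have hl := dl_mem (n := l.+1) (loc_subgroups g de) (@loc_augments _ e g) zM st.
  by have [r rM ->] := loc_qmod (dt t) hl (cz t st); rewrite mulrAC divff ?mul1r.
- rewrite -(dl_is_additive (h := fun x => x / io q)) ?dl_dl ?mul0r //.
  by move=> x y; rewrite mulrBl.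
have [|t st|y [yM hy]] := @acg l (fun t => z t - io q * r t).
- move=> t st; apply: (locB (dt t)); first exact: zM.
  by rewrite -[g](subrK gq) addrC; apply: locM; [apply: loc_poly|apply: rM].
- rewrite dlB -(dl_is_additive (h := fun x => io q * x)); last first.
    by move=> x y; rewrite mulrBr.
  by rewrite -hr // mulrC divfK ?subrr.
exists y; split=> // t st; rewrite -hy // opprB addrCA subrr addr0.
have [us [p [uh _ ep]]] := rM t st; exists us, p; split=> //.
by rewrite -mulrA ep rmorphM.
Qed.

(* Adding the locus [q] <> 0 to a cover of [q] = 0 changes nothing modulo
   [q], and makes it a cover of the ambient space. *)
Definition with_complement (I : Type) (e : I -> S * G) (i : option I) : S * G :=
  if i is Some i' then e i' else (q, gq).

Lemma acyclic_mod_complement (I : eqType) (e : I -> S * G) g :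
  q != 0 -> (forall i, denom (e i)) ->
  acyclic_mod (with_complement e) g -> acyclic_mod e g.
Proof.
move=> q0 de ac l z zM cz.
have de' i : denom (with_complement e i) by case: i => [i|//]; apply: de.
pose e' := with_complement e.
(* Lists through the locus q <> 0 get the value 0: there every section is a multiple of [q], so the
   cocycle condition survives. *)
pose z' t := if all (fun i => i != None) t then z (pmap id t) else 0.
have zS r : z' (map Some r) = z r.
  rewrite /z' all_map all_predT /=; congr z.
  by elim: r => //= i r ->.
have eS r : map e' (map Some r) = map e r by rewrite -map_comp.
have allS t : all (fun i => i != None) t -> exists r, t = map Some r.
  elim: t => [|[i|] t IH] //=; first by exists [::].
  by move=> /IH[r ->]; exists (i :: r).
have zM' t : size t = l.+1 -> loc io (map e' t) g (z' t).
  move=> st; have [/allS[r er]|na] := boolP (all (fun i => i != None) t).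
    by rewrite er zS eS; apply: zM; rewrite -st er size_map.
  by rewrite /z' (negPf na); apply: loc0.
have [t st|y [yM hy]] := @ac l z' zM'.
  have [/allS[r er]|na] := boolP (all (fun i => i != None) t).
    rewrite er eS dl_map (eq_dl (g := z)); last by move=> u _; rewrite zS.
    by apply: cz; rewrite -st er size_map.
  have hq' : (q, gq) \in map e' t.
    have /hasP[i it /negbNE/eqP i0] : has (predC (fun i => i != None)) t.
      by rewrite has_predC.
    by apply/mapP; exists i => //; rewrite i0.
  apply: loc_qmod_unit hq' _.
  exact: (dl_mem (n := l.+1) (loc_subgroups g de') (@loc_augments _ e' g) zM').
exists (fun t => y (map Some t)); split=> t st.
  by rewrite -eS; apply: yM; rewrite size_map.
by rewrite -dl_map -zS -eS; apply: hy; rewrite size_map.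
Qed.

End Modulo.
End Covers.

(** * Substitutions *)

Section Substitution.
Context {k : fieldType}.

Lemma mmap_ext (n : nat) (R : comNzRingType) (f : {rmorphism k -> R})
    (a b : 'I_n -> R) p : a =1 b -> mmap f a p = mmap f b p.
Proof.
by move=> ab; apply: eq_bigr => m _; congr (_ * _); apply: eq_bigr => i _; rewrite ab.
Qed.

Lemma mmap_Xi (n : nat) (R : comNzRingType) (f : {rmorphism k -> R})
    (a : 'I_n -> R) i : mmap f a 'X_i = a i.
Proof. by rewrite mmapX mmap1U. Qed.

Lemma mmap_comp (n : nat) (R R' : comNzRingType) (f : {rmorphism k -> R})
    (h : {rmorphism R -> R'}) (a : 'I_n -> R) p :
  h (mmap f a p) = mmap (h \o f) (h \o a) p.
Proof.
rewrite /mmap rmorph_sum; apply: eq_bigr => m _; rewrite rmorphM rmorph_prod.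
by congr (_ * _); apply: eq_bigr => i _; rewrite rmorphXn.
Qed.

Definition subst (n n' : nat) (a : 'I_n -> {mpoly k[n']}) (p : {mpoly k[n]}) :
  {mpoly k[n']} := mmap (@mpolyC n' k) a p.

Lemma mderivXi (n : nat) (i j : 'I_n) :
  ('X_j : {mpoly k[n]})^`M(i) = (j == i)%:R.
Proof.
rewrite mderivX mnm1E; case: eqP => [->|_]; last by rewrite scale0r.
by rewrite scale1r -{1}[U_(i)%MM]add0m addmK mpolyX0.
Qed.

Section Ring.
Context {n n' : nat} (a : 'I_n -> {mpoly k[n']}).
Implicit Types (p : {mpoly k[n]}).

Lemma substC c : subst a c%:MP = c%:MP. Proof. exact: mmapC. Qed.
Lemma substX i : subst a 'X_i = a i. Proof. exact: mmap_Xi. Qed.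
Lemma substD p p' : subst a (p + p') = subst a p + subst a p'.
Proof. exact: mmapD. Qed.
Lemma substB p p' : subst a (p - p') = subst a p - subst a p'.
Proof. exact: mmapB. Qed.
Lemma substM p p' : subst a (p * p') = subst a p * subst a p'.
Proof. exact: (rmorphM (mmap (@mpolyC n' k) a)). Qed.
Lemma substXn p j : subst a (p ^+ j) = subst a p ^+ j.
Proof. exact: (rmorphXn (mmap (@mpolyC n' k) a)). Qed.
Lemma subst0 : subst a 0 = 0. Proof. exact: mmap0. Qed.
Lemma subst_nat j : subst a j%:R = j%:R.
Proof. by rewrite -mpolyC_nat substC mpolyC_nat. Qed.
Lemma substZ c p : subst a (c *: p) = c *: subst a p.
Proof. by rewrite -!mul_mpolyC substM substC. Qed.
Lemma subst_sum (I : Type) (r : seq I) (P : pred I) F :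
  subst a (\sum_(i <- r | P i) F i) = \sum_(i <- r | P i) subst a (F i).
Proof. exact: (big_morph _ substD subst0). Qed.

Lemma chain_rule p i : (subst a p)^`M(i) = \sum_j subst a p^`M(j) * (a j)^`M(i).
Proof.
elim/mpoly_ring_ind: p => [c|j|p p' IH IH'|p p' IH IH'].
- by rewrite substC mderivC big1 // => j _; rewrite mderivC subst0 mul0r.
- rewrite substX (bigD1 j) //= mderivXi eqxx subst_nat mul1r.
  rewrite big1 ?addr0 // => j' ne.
  by rewrite mderivXi eq_sym (negPf ne) subst0 mul0r.
- rewrite substD mderivD IH IH' -big_split; apply: eq_bigr => j _.
  by rewrite mderivD substD mulrDl.
- rewrite substM mderivM IH IH' mulr_suml mulr_sumr -big_split.
  apply: eq_bigr => j _; rewrite mderivM substD !substM /=; ring.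
Qed.

End Ring.

(** Only the shape of the second-order remainder matters; such expansions hold for constants and
    variables and pass to sums and products. *)
Lemma taylor (n n' : nat) (a b : 'I_n -> {mpoly k[n']}) p : exists g : 'I_n -> 'I_n -> _,
  subst (fun j => a j + b j) p = subst a p + \sum_j subst a p^`M(j) * b j +
    \sum_i \sum_j g i j * (b i * b j).
Proof.
pose ab j := a j + b j.
pose good (x y : {mpoly k[n']}) (z : 'I_n -> {mpoly k[n']}) := exists g : 'I_n -> 'I_n -> {mpoly k[n']},
  x = y + \sum_j z j * b j + \sum_i \sum_j g i j * (b i * b j).
have Q0 : \sum_i \sum_j (0 : {mpoly k[n']}) * (b i * b j) = 0.
  by rewrite big1 // => i _; rewrite big1 // => j _; rewrite mul0r.
suff : good (subst ab p) (subst a p) (fun j => subst a p^`M(j)) by [].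
elim/mpoly_ring_ind: p => [c|i|p p' [g e] [g' e']|p p' [g e] [g' e']].
- exists (fun _ _ => 0); rewrite Q0 addr0 !substC big1 ?addr0 // => j _.
  by rewrite mderivC subst0 mul0r.
- exists (fun _ _ => 0); rewrite Q0 addr0 !substX (bigD1 i) //= mderivXi eqxx subst_nat mul1r.
  rewrite big1 ?addr0 // => j ne.
  by rewrite mderivXi eq_sym (negPf ne) subst0 mul0r.
- exists (fun i j => g i j + g' i j); rewrite !substD e e'.
  under [in RHS]eq_bigr do rewrite mderivD substD mulrDl.
  rewrite big_split.
  have -> : \sum_i \sum_j (g i j + g' i j) * (b i * b j) =
    \sum_i \sum_j g i j * (b i * b j) + \sum_i \sum_j g' i j * (b i * b j).
    rewrite -big_split; apply: eq_bigr => i _; rewrite -big_split.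
    by apply: eq_bigr => j _; rewrite mulrDl.
  by rewrite /=; ring.
- pose u := subst a p; pose u' := subst a p'.
  pose d j := subst a p^`M(j); pose d' j := subst a p'^`M(j).
  pose x := subst ab p; pose x' := subst ab p'.
  exists (fun i j => g i j * x' + (u + \sum_j d j * b j) * g' i j + d i * d' j).
  rewrite !substM e e' -/u -/u' -/d -/d'.
  under [X in _ = _ + X + _]eq_bigr do rewrite mderivM substD !substM mulrDl -/u -/u'.
  have -> : \sum_i \sum_j (g i j * x' + (u + \sum_j d j * b j) * g' i j + d i * d' j) * (b i * b j) =
    (\sum_i \sum_j g i j * (b i * b j)) * x' +
    (u + \sum_j d j * b j) * (\sum_i \sum_j g' i j * (b i * b j)) +
    (\sum_i d i * b i) * (\sum_j d' j * b j).
    rewrite [X in _ = X + _ + _]mulr_suml [X in _ = _ + X + _]mulr_sumr.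
    rewrite [X in _ = _ + _ + X]mulr_suml -!big_split; apply: eq_bigr => i _ /=.
    rewrite [X in _ = X + _ + _]mulr_suml [X in _ = _ + X + _]mulr_sumr.
    rewrite [X in _ = _ + _ + X]mulr_sumr -!big_split; apply: eq_bigr => j _ /=.
    ring.
  rewrite {1}/x' e' -/u' big_split /=.
  have -> : \sum_j subst a p^`M(j) * u' * b j = (\sum_j d j * b j) * u'.
    by rewrite mulr_suml; apply: eq_bigr => j _; rewrite mulrAC.
  have -> : \sum_j u * subst a p'^`M(j) * b j = u * (\sum_j d' j * b j).
    by rewrite mulr_sumr; apply: eq_bigr => j _; rewrite mulrA.
  rewrite -/(d' _); set sd := \sum_j d j * b j; set sd' := \sum_j d' j * b j.
  ring.
Qed.

Lemma subst_comp (n n' n'' : nat) (a : 'I_n -> {mpoly k[n']})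
    (b : 'I_n' -> {mpoly k[n'']}) p :
  subst b (subst a p) = subst (fun i => subst b (a i)) p.
Proof.
elim/mpoly_ring_ind: p => [c|i|p p' e e'|p p' e e'].
- by rewrite !substC.
- by rewrite !substX.
- by rewrite !substD e e'.
- by rewrite !substM e e'.
Qed.

Lemma subst_ext (n n' : nat) (a b : 'I_n -> {mpoly k[n']}) p :
  a =1 b -> subst a p = subst b p.
Proof. exact: mmap_ext. Qed.

Definition dvdm (n : nat) (q p : {mpoly k[n]}) := exists r, p = q * r.

Section Dvd.
Context {n : nat} (q : {mpoly k[n]}).
Implicit Types p : {mpoly k[n]}.

Lemma dvdm0 : dvdm q 0. Proof. by exists 0; rewrite mulr0. Qed.
Lemma dvdmD p p' : dvdm q p -> dvdm q p' -> dvdm q (p + p').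
Proof. by move=> [r ->] [r' ->]; exists (r + r'); rewrite mulrDr. Qed.
Lemma dvdmN p : dvdm q p -> dvdm q (- p).
Proof. by move=> [r ->]; exists (- r); rewrite mulrN. Qed.
Lemma dvdmB p p' : dvdm q p -> dvdm q p' -> dvdm q (p - p').
Proof. by move=> h h'; apply/dvdmD/dvdmN. Qed.
Lemma dvdmM p p' : dvdm q p' -> dvdm q (p * p').
Proof. by move=> [r ->]; exists (p * r); rewrite mulrCA. Qed.
Lemma dvdmMr p p' : dvdm q p' -> dvdm q (p' * p).
Proof. by rewrite mulrC; apply: dvdmM. Qed.
Lemma dvdmm p : dvdm q (q * p). Proof. by exists p. Qed.
Lemma dvdm_sum (I : Type) (r : seq I) (P : pred I) F :
  (forall i, P i -> dvdm q (F i)) -> dvdm q (\sum_(i <- r | P i) F i).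
Proof.
by move=> h; apply: (big_ind (dvdm q)) => //; [apply: dvdm0|apply: dvdmD].
Qed.
Lemma dvdm_sub p p' : dvdm q (p - p') -> dvdm q p' -> dvdm q p.
Proof. by move=> h /(dvdmD h); rewrite subrK. Qed.
Lemma dvdm_subC p p' : dvdm q (p - p') -> dvdm q (p' - p).
Proof. by move/dvdmN; rewrite opprB. Qed.
Lemma dvdm_trans p p' p'' : dvdm q (p - p') -> dvdm q (p' - p'') -> dvdm q (p - p'').
Proof. by move=> h /(dvdmD h); rewrite addrA subrK. Qed.
Lemma dvdmMM p p' r r' :
  dvdm q (p - p') -> dvdm q (r - r') -> dvdm q (p * r - p' * r').
Proof.
move=> h h'; have -> : p * r - p' * r' = r * (p - p') + p' * (r - r') by ring.
by apply: dvdmD; apply: dvdmM.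
Qed.
Lemma dvdmXX p p' j : dvdm q (p - p') -> dvdm q (p ^+ j - p' ^+ j).
Proof.
move=> h; elim: j => [|j IH]; first by rewrite subrr; apply: dvdm0.
by rewrite !exprS; apply: dvdmMM.
Qed.

Lemma dvdm_subst (n0 : nat) (a b : 'I_n0 -> {mpoly k[n]}) (p : {mpoly k[n0]}) :
  (forall i, dvdm q (a i - b i)) -> dvdm q (subst a p - subst b p).
Proof.
move=> ab; elim/mpoly_ring_ind: p => [c|i|p p' h h'|p p' h h'].
- by rewrite !substC subrr; apply: dvdm0.
- by rewrite !substX.
- by rewrite !substD opprD addrACA; apply: dvdmD.
- by rewrite !substM; apply: dvdmMM.
Qed.

End Dvd.

End Substitution.

Section HomogeneousSubstitution.
Context {k : fieldType} {A B : coxSpace k}.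
Context (nu : cox_grp A -> cox_grp B) (X : 'I_(cox_var A) -> cox_ring B).
Hypothesis nuD : forall g h, nu (g + h) = nu g + nu h.
Hypothesis hX : forall i, whomog (nu (cox_wt i)) (X i).

Lemma whomog_subst g (p : cox_ring A) : whomog g p -> whomog (nu g) (subst X p).
Proof.
have nu0 : nu 0 = 0 by apply: (addIr (nu 0)); rewrite -nuD !add0r.
have nun h j : nu (h *+ j) = nu h *+ j.
  by elim: j => [|j IH]; rewrite ?mulr0n // !mulrS nuD IH.
move=> hp; rewrite [subst X p]/subst /mmap big_seq; apply: whomog_sum => m hm.
rewrite mul_mpolyC; apply: whomogZ; rewrite -(hp m hm) /wdeg (big_morph _ nuD nu0).
apply: (big_rec2 (fun g p => whomog (g : cox_grp B) (p : cox_ring B))); first exact: whomog1.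
move=> i h p' _ hp'; apply: whomogM => //.
by rewrite nun; apply: whomogX.
Qed.

End HomogeneousSubstitution.

Lemma subst_scale (k : fieldType) (N d : nat) (u p : cox_ring (proj k N)) :
  whomog (d%:Z : cox_grp (proj k N)) p ->
  subst (fun j : 'I_N.+1 => 'X_j * u) p = u ^+ d * p.
Proof.
move=> hp; rewrite [in RHS](mpolyE p) /subst /mmap mulr_sumr big_seq [RHS]big_seq.
apply: eq_bigr => m hm; rewrite mul_mpolyC -scalerAr; congr (_ *: _).
rewrite /mmap1; under eq_bigr do rewrite exprMn.
rewrite big_split -mpolyXE_id mulrC; congr (_ * _).
rewrite prodrXr; congr (_ ^+ _).
by apply/eqP; rewrite -eqz_nat -(hp m hm) /wdeg /= -natr_sum natz.
Qed.

Lemma subst_prod (k : fieldType) n n' (a : 'I_n -> {mpoly k[n']}) (I : Type)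
    (r : seq I) (P : pred I) F :
  subst a (\prod_(i <- r | P i) F i) = \prod_(i <- r | P i) subst a (F i).
Proof. by apply: (big_morph _ (substM a)); rewrite -mpolyC1 substC mpolyC1. Qed.

Section Span.
Context {k : fieldType} {A : coxSpace k}.
Local Notation S := (cox_ring A).
Context (q : S) (D : cox_grp A) (N : nat) (s : 'I_N.+1 -> S).
Local Notation R := (cox_ring (proj k N)).
Hypothesis span : forall p, whomog D p -> exists a, dvdm q (p - \sum_j a j *: s j).

Lemma lin_exists : exists lin : S -> R, forall p, whomog D p ->
  whomog (1 : cox_grp (proj k N)) (lin p) /\ dvdm q (subst s (lin p) - p).
Proof.
have /choice[lin h] p : exists l : R, whomog D p ->
    whomog (1 : cox_grp (proj k N)) l /\ dvdm q (subst s l - p).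
  case: (pselect (whomog D p)) => [hp|]; last by exists 0.
  have [a ha] := span hp; exists (\sum_j a j *: 'X_j) => _; split.
    by apply: whomog_sum => j _; apply: whomogZ; have := @whomogXi _ (proj k N) j.
  rewrite subst_sum -[X in dvdm _ X]opprB; apply: dvdmN.
  by under [X in _ - X]eq_bigr do rewrite substZ substX.
by exists lin.
Qed.

Context (I : finType) (l : I -> R).

(** The polynomials of P^N whose restriction to Y is in the ideal of the restrictions of the [l i].
    That the opens [l i] <> 0 cover Y is expressed by powers of all coordinates belonging to it. *)
Definition cover_ideal (x : R) : Prop :=
  exists c : I -> R, dvdm q (subst s (x - \sum_i c i * l i)).

Lemma cover_ideal0 : cover_ideal 0.
Proof.
exists (fun=> 0); rewrite big1 ?subrr ?subst0; first exact: dvdm0.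
by move=> i _; rewrite mul0r.
Qed.

Lemma cover_idealD x y : cover_ideal x -> cover_ideal y -> cover_ideal (x + y).
Proof.
move=> [c hc] [c' hc']; exists (fun i => c i + c' i).
under eq_bigr do rewrite mulrDl.
by rewrite big_split opprD addrACA substD; apply: dvdmD.
Qed.

Lemma cover_idealM x y : cover_ideal y -> cover_ideal (x * y).
Proof.
move=> [c hc]; exists (fun i => x * c i).
under eq_bigr do rewrite -mulrA.
by rewrite -mulr_sumr -mulrBr substM; apply: dvdmM.
Qed.

Lemma cover_ideal_mod x y : cover_ideal y -> dvdm q (subst s (x - y)) ->
  cover_ideal x.
Proof.
move=> [c hc] h; exists c; rewrite -[x](subrK y) -addrA substD.
exact: dvdmD.
Qed.

Lemma cover_ideal_l i : cover_ideal (l i).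
Proof.
exists (fun i' => (i' == i)%:R).
rewrite (bigD1 i) //= eqxx mul1r big1 ?addr0 ?subrr ?subst0; first exact: dvdm0.
by move=> i' /negPf->; rewrite mul0r.
Qed.

Lemma cover_radical_mod x y : radical cover_ideal y -> dvdm q (subst s (x - y)) ->
  radical cover_ideal x.
Proof.
move=> [b hb] h; exists b; apply: cover_ideal_mod hb _.
by rewrite substB !substXn; apply: dvdmXX; rewrite -substB.
Qed.

(** On Y the coordinate ['X_j] agrees with a combination of the linear forms attached to the
    monomials of [s j], so it is enough to treat monomials of degree D. *)
Lemma cover_monomials (lin : S -> R) :
  (forall p, whomog D p -> dvdm q (subst s (lin p) - p)) ->
  (forall j, whomog D (s j)) ->
  (forall m : 'X_{1..cox_var A}, wdeg m = D -> radical cover_ideal (lin 'X_[m])) ->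
  forall j : 'I_N.+1, exists a (c : I -> R),
    dvdm q (subst s ('X_j ^+ a - \sum_i c i * l i)).
Proof.
move=> hlin hs hm j; suff : radical cover_ideal ('X_j : R) by [].
pose y : R := \sum_(m <- msupp (s j)) mpolyC N.+1 (s j)@_m * lin 'X_[m].
apply: (@cover_radical_mod _ y); rewrite /y.
  rewrite big_seq; apply: radical_sum; [exact: cover_idealD|exact: cover_idealM|exact: cover_ideal0|].
  by move=> m /(hs j) /hm; apply: radicalM; apply: cover_idealM.
rewrite substB substX subst_sum {1}(mpolyE (s j)) -sumrB big_seq; apply: dvdm_sum => m hm'.
rewrite substM substC mul_mpolyC -scalerBr -mul_mpolyC; apply: dvdmM.
rewrite -opprB; apply: dvdmN; apply: hlin; rewrite -(hs j m hm').
exact: whomogXm.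
Qed.

End Span.

(** * Embeddings by Cox coordinates *)

Section Embedding.
Context {k : fieldType} {A : coxSpace k} {K : fieldType}.
Context (io : {rmorphism cox_ring A -> K}).
Local Notation S := (cox_ring A).
Local Notation G := (cox_grp A).
Local Notation n := (cox_var A).
Context (q : S) (gq D : G) (N : nat) (s : 'I_N.+1 -> S).
Local Notation R := (cox_ring (proj k N)).

Definition divisor (j : 'I_N.+1) : S * G := (s j, D).

(* An open set l <> 0 of Y, where l is the restriction of a linear form of
   P^N, isomorphic to the locus where some of the Cox coordinates are
   invertible: up to a character [ch_chi] of the torus, i.e. a Laurent monomial
   in these coordinates, the coordinate x_i is the restriction of the
   polynomial [ch_X i] on P^N. *)
Record chart (nu : G -> int) (ni : 'I_n -> nat) (r : nat)
    (lam : 'I_r -> G -> k) (e : nat) := Chart {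
  ch_l : R;
  ch_l0 : S;
  ch_X : 'I_n -> R;
  ch_T : 'I_n -> S;
  ch_chi : G -> K;
  ch_deg : nat;
  ch_E : 'I_n -> S;
  ch_dT : 'I_r -> 'I_n -> S;
  ch_lP : whomog (1 : cox_grp (proj k N)) ch_l;
  ch_l0_neq0 : ch_l0 != 0;
  ch_l0P : whomog D ch_l0;
  ch_ll0 : dvdm q (subst s ch_l - ch_l0);
  ch_XP : forall i, whomog ((ni i)%:Z : cox_grp (proj k N)) (ch_X i);
  ch_TP : forall i, whomog (D *+ ni i - cox_wt i) (ch_T i);
  ch_EP : forall i, whomog (D *+ e + cox_wt i - D *+ ni i) (ch_E i);
  ch_XT : forall i, dvdm q (subst s (ch_X i) - 'X_i * ch_T i);
  ch_chiD : forall g h, ch_chi (g + h) = ch_chi g * ch_chi h;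
  ch_chi0 : forall g, ch_chi g != 0;
  ch_chiT : forall i, io (ch_T i) = ch_chi (cox_wt i);
  ch_chil : ch_chi D = io ch_l0 ^+ ch_deg;
  ch_degP : nu D = ch_deg.+1%:Z;
  ch_ET : forall i, ch_E i * ch_T i = ch_l0 ^+ e;
  ch_dTP : forall i i', ch_E i * (ch_T i)^`M(i') =
    \sum_a lam a (cox_wt i) *: ch_dT a i' }.

(* Y is the locus [q] = 0, embedded in P^N by the s_j; [q] = 0 is allowed. *)
Record embedding := Embedding {
  em_q : whomog gq q;
  em_s : forall j, whomog D (s j);
  em_s0 : forall j, s j != 0;
  em_D : forall z : int, D *~ z = 0 -> z = 0;
  em_acyclic : forall g, [\/ g = 0, g = D, exists i, g = D - cox_wt i |
    q != 0 /\ g = D - gq] -> acyclic_mod io q divisor g;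
  em_r : nat;
  em_lam : 'I_em_r -> G -> k;
  em_lamD : forall a g h, em_lam a (g + h) = em_lam a g + em_lam a h;
  em_euler : forall (j : nat) (kappa : 'I_em_r -> S),
    (forall a, whomog (D *+ j.+1) (kappa a)) ->
    exists kappa' : 'I_n -> S,
      (forall i, whomog (D *+ j.+1 - cox_wt i) (kappa' i)) /\
      forall a, \sum_i em_lam a (cox_wt i) *: ('X_i * kappa' i) = kappa a;
  em_smooth : forall r, (forall i, dvdm q (r * q^`M(i))) ->
    dvdm (q * q) (q * r);
  em_nu : G -> int;
  em_nuD : forall g h, em_nu (g + h) = em_nu g + em_nu h;
  em_ni : 'I_n -> nat;
  em_nuE : forall i, em_nu (cox_wt i) = (em_ni i)%:Z;
  em_nulam : exists c : 'I_em_r -> k, forall g,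
    (em_nu g)%:~R = \sum_a c a * em_lam a g;
  em_e : nat;
  em_C : finType;
  em_chart : em_C -> chart em_nu em_ni em_lam em_e;
  em_cover : forall j : 'I_N.+1, exists a (c : em_C -> R),
    dvdm q (subst s ('X_j ^+ a - \sum_i c i * ch_l (em_chart i))) }.

End Embedding.

Arguments ch_lP {k A K io q D N s nu ni r lam e} c _ _.
Arguments ch_l0P {k A K io q D N s nu ni r lam e} c _ _.
Arguments ch_XP {k A K io q D N s nu ni r lam e} c i _ _.
Arguments ch_TP {k A K io q D N s nu ni r lam e} c i _ _.
Arguments ch_EP {k A K io q D N s nu ni r lam e} c i _ _.
Arguments em_s {k A K io q gq D N s} e j _ _.
Arguments em_q {k A K io q gq D N s} e _ _.
Arguments em_chart {k A K io q gq D N s} e c.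
Arguments em_lam {k A K io q gq D N s} e a g.
Arguments em_nu {k A K io q gq D N s} e g.
Arguments em_ni {k A K io q gq D N s} e i.

Definition eventually (P : nat -> Prop) := exists l0, forall l, (l0 <= l)%N -> P l.

Lemma eventually_and (P Q : nat -> Prop) : eventually P -> eventually Q -> eventually (fun l => P l /\ Q l).
Proof.
move=> [a ha] [b hb]; exists (maxn a b) => l; rewrite geq_max => /andP[/ha ? /hb].
by split.
Qed.

Lemma eventually_all (I : finType) (P : I -> nat -> Prop) :
  (forall i, eventually (P i)) -> eventually (fun l => forall i, P i l).
Proof.
move=> /choice[l0 h]; exists (\max_i l0 i)%N => l hl i; apply: h.
exact: leq_trans (leq_bigmax i) hl.
Qed.

Lemma eventually_ex (P : nat -> Prop) : eventually P -> exists l, P l.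
Proof. by move=> [l h]; exists l; apply: h. Qed.

Section Powers.
Context {k : fieldType} {A : coxSpace k} {K : fieldType}.
Context (io : {rmorphism cox_ring A -> K}) (io_inj : injective io).
Local Notation S := (cox_ring A).
Local Notation G := (cox_grp A).
Context (q : S) (gq D : G) (N : nat) (s : 'I_N.+1 -> S).
Local Notation R := (cox_ring (proj k N)).
Context (em : embedding io q gq D s).

Lemma ev_homog (d : int) (P : R) :
  whomog (d : cox_grp (proj k N)) P -> whomog (D *~ d) (subst s P).
Proof.
apply: (whomog_subst (A := proj k N) (nu := fun z : int => D *~ z)).
  by move=> g h; rewrite mulrzDr.
by move=> j /=; rewrite mulr1z; apply: (em_s em).
Qed.

(** D has infinite order, so distinct degrees on P^N stay distinct after restriction to Y. *)
Lemma ev_wcomp (d : int) (P : R) :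
  wcomp (D *~ d) (subst s P) = subst s (wcomp (d : cox_grp (proj k N)) P).
Proof.
elim/mpolyind: P => [|c m P _ _ IH].
  by rewrite subst0 !wcomp0 subst0.
rewrite wcompD !substD wcompD IH; congr (_ + _).
have hm : whomog (wdeg (m : 'X_{1..cox_var (proj k N)})) (c *: 'X_[m] : R).
  by apply/whomogZ/whomogXm.
have hs := ev_homog hm.
case: (eqVneq (wdeg (m : 'X_{1..cox_var (proj k N)})) d) => e.
  by rewrite wcomp_homog -?e // wcomp_homog // -e.
rewrite [in RHS](wcomp_neq hm e) subst0; apply: wcomp_neq hs _.
apply: contraNneq e => /eqP; rewrite -subr_eq0 -mulrzBr => /eqP/(em_D em)/eqP.
by rewrite subr_eq0.
Qed.

Lemma dvdm_wcomp g p : dvdm q p -> dvdm q (wcomp g p).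
Proof.
by move=> [r ->]; rewrite mulrC (wcompM _ _ (em_q em)) mulrC; apply: dvdmm.
Qed.

(** The linear forms of the charts may be replaced by powers, the covering condition being one on
    radicals; homogeneous components then fix the degrees of the coefficients. *)
Lemma em_cover_powers (j : 'I_N.+1) M : exists a (c : em_C em -> R),
  (forall i, whomog (a%:Z - M%:Z : cox_grp (proj k N)) (c i)) /\
  dvdm q (subst s ('X_j ^+ a - \sum_i c i * ch_l (em_chart em i) ^+ M)).
Proof.
pose l i := ch_l (em_chart em i) ^+ M.
have [a [c hc]] := em_cover em j.
have [b [c' hc']] : radical (cover_ideal q s l) ('X_j ^+ a).
  apply: cover_radical_mod hc.
  apply: radical_sum; [exact: cover_idealD|exact: cover_idealM|exact: cover_ideal0|].
  move=> i _; apply: radicalM; first exact: cover_idealM.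
  exists M; exact: (@cover_ideal_l _ _ q N s _ l i).
exists (a * b)%N, (fun i => wcomp (((a * b)%N%:Z - M%:Z) : cox_grp (proj k N)) (c' i)).
split=> [i|]; first exact: whomog_wcomp.
have := dvdm_wcomp (D *~ (a * b)%N%:Z) hc'; rewrite ev_wcomp wcompB exprM.
rewrite wcomp_homog; last first.
  rewrite -exprM.
  have := whomogX (l := (a * b)%N) (@whomogXi _ (proj k N) j).
  by move=> h; apply: whomog_eq h _; rewrite /= natz.
rewrite wcomp_sum; congr (dvdm _ (subst _ (_ - _))); apply: eq_bigr => i _.
have h := whomogX (l := M) (ch_lP (em_chart em i)).
by rewrite (wcompM _ _ h) /= natz.
Qed.

End Powers.

Lemma whomog_neg (k : fieldType) (N : nat) (d : int) (p : cox_ring (proj k N)) :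
  whomog (d : cox_grp (proj k N)) p -> (d < 0)%O -> p = 0.
Proof.
move=> hp d0; apply: msuppnil0; case e: (msupp p) => [//|m l].
have := hp m; rewrite e mem_head /wdeg /= => /(_ isT) ed.
by move: d0; rewrite -ed -natr_sum natz.
Qed.

(** * The ideal of the image, modulo its square *)

Section Conormal.
Context {k : fieldType} {A : coxSpace k} {K : fieldType}.
Context (io : {rmorphism cox_ring A -> K}) (io_inj : injective io).
Local Notation S := (cox_ring A).
Local Notation G := (cox_grp A).
Local Notation n := (cox_var A).
Context (q : S) (gq D : G) (N : nat) (s : 'I_N.+1 -> S).
Local Notation R := (cox_ring (proj k N)).
Context (em : embedding io q gq D s).
Local Notation nu := (em_nu em).
Local Notation homogR d p := (whomog (d : cox_grp (proj k N)) (p : R)).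

Definition vanishes (p : R) : Prop := dvdm q (subst s p).

Inductive square : R -> Prop :=
| square_gen c a b d d' : homogR d a -> homogR d' b -> vanishes a ->
    vanishes b -> square (c * (a * b))
| square_add a b : square a -> square b -> square (a + b).

Lemma square0 : square 0.
Proof.
rewrite -(mul0r (0 * 0)); apply: (@square_gen 0 0 0 0 0); try exact: whomog0;
by rewrite /vanishes subst0; apply: dvdm0.
Qed.

Lemma squareM r a : square a -> square (r * a).
Proof.
elim=> [c x y d d' hx hy vx vy|x y _ hx _ hy].
  by rewrite mulrA; apply: square_gen hx hy vx vy.
by rewrite mulrDr; apply: square_add.
Qed.

Lemma squareN a : square a -> square (- a).
Proof. by rewrite -mulN1r; apply: squareM. Qed.

Lemma square_sum (I : Type) (r : seq I) (P : pred I) F :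
  (forall i, P i -> square (F i)) -> square (\sum_(i <- r | P i) F i).
Proof.
by move=> h; apply: (big_ind square) => //; [apply: square0|apply: square_add].
Qed.

Lemma vanishesD a b : vanishes a -> vanishes b -> vanishes (a + b).
Proof. by rewrite /vanishes substD; apply: dvdmD. Qed.

Lemma vanishesM r a : vanishes a -> vanishes (r * a).
Proof. by rewrite /vanishes substM; apply: dvdmM. Qed.

Lemma vanishes_sum (I : Type) (r : seq I) (P : pred I) F :
  (forall i, P i -> vanishes (F i)) -> vanishes (\sum_(i <- r | P i) F i).
Proof. by move=> h; rewrite /vanishes subst_sum; apply: dvdm_sum. Qed.

Lemma square_vanishes a : square a ->
  vanishes a /\ forall j, vanishes a^`M(j).
Proof.
elim=> [c x y d d' _ _ vx vy|x y _ [vx dx] _ [vy dy]].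
  split; first by apply/vanishesM/vanishesM.
  move=> j; rewrite !mderivM; apply: vanishesD; first by apply/vanishesM/vanishesM.
  apply: vanishesM; apply: vanishesD; first exact: vanishesM.
  by rewrite mulrC; apply: vanishesM.
split; first exact: vanishesD.
by move=> j; rewrite mderivD; apply: vanishesD.
Qed.

Lemma nu0 : nu 0 = 0.
Proof. by apply: (addIr (nu 0)); rewrite -(em_nuD em) !add0r. Qed.

Section Chart.
Context (c : em_C em).
Local Notation ch := (em_chart em c).
Local Notation l := (ch_l ch).
Local Notation n1 := (ch_deg ch).

(** [chart_sub f] extends the form [f] from Y to P^N, up to a character of the torus, and
    [chart_tw f] is its restriction to Y modulo [q]. The [chart_gen j] express on P^N that x_j
    equals s_j computed in the coordinates of the chart; together with [chart_sub q] they generate,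
    on the chart, the ideal of the image modulo its square. *)
Definition chart_sub (f : S) : R := subst (ch_X ch) f.
Definition chart_tw (f : S) : S := subst (fun i => 'X_i * ch_T ch i) f.
Definition chart_gen (j : 'I_N.+1) : R := chart_sub (s j) - 'X_j * l ^+ n1.

Lemma chart_subP g f : whomog g f -> homogR (nu g) (chart_sub f).
Proof.
apply: (whomog_subst (nu := nu : G -> cox_grp (proj k N))).
  exact: em_nuD.
by move=> i; rewrite (em_nuE em); apply: (ch_XP ch).
Qed.

Lemma chart_sub_tw f : dvdm q (subst s (chart_sub f) - chart_tw f).
Proof.
rewrite /chart_sub subst_comp; apply: dvdm_subst => i.
exact: ch_XT.
Qed.

Lemma chart_chi0 : ch_chi ch 0 = 1.
Proof.
by apply: (mulIf (ch_chi0 ch 0)); rewrite -ch_chiD add0r mul1r.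
Qed.

Lemma chart_chi_wdeg (m : 'X_{1..n}) :
  ch_chi ch (wdeg m) = io (\prod_i ch_T ch i ^+ m i).
Proof.
rewrite /wdeg (big_morph _ (ch_chiD ch) chart_chi0) rmorph_prod.
apply: eq_bigr => i _; rewrite rmorphXn /= ch_chiT.
elim: (m i) => [|j IH]; first by rewrite chart_chi0.
by rewrite exprS mulrS ch_chiD IH.
Qed.

(** Multiplying the coordinates by the [ch_T i] is an action of the torus, through the character
    [ch_chi]. *)
Lemma io_chart_tw g f : whomog g f -> io (chart_tw f) = ch_chi ch g * io f.
Proof.
move=> hf; rewrite [in RHS](mpolyE f) [chart_tw f]/chart_tw /subst /mmap.
rewrite !rmorph_sum mulr_sumr big_seq [RHS]big_seq; apply: eq_bigr => m hm.
rewrite -mul_mpolyC !rmorphM /= mulrCA; congr (_ * _).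
rewrite /mmap1; under eq_bigr do rewrite exprMn.
rewrite big_split -mpolyXE_id /= rmorphM mulrC; congr (_ * _).
by rewrite -(hf m hm) chart_chi_wdeg.
Qed.

Lemma vanishes_chart_sub_q : vanishes (chart_sub q).
Proof.
apply: dvdm_sub (chart_sub_tw q) _.
have [->|q0] := eqVneq q 0; first by rewrite /chart_tw subst0; apply: dvdm0.
have [m hm] : exists m, m \in msupp q.
  by move: q0; rewrite -msupp_eq0; case: (msupp q) => // m l' _; exists m; rewrite mem_head.
exists (\prod_i ch_T ch i ^+ m i); apply: io_inj.
rewrite (io_chart_tw (em_q em)) rmorphM mulrC; congr (_ * _).
by rewrite -chart_chi_wdeg (em_q em _ hm).
Qed.

Lemma chart_genP j : homogR n1.+1%:Z (chart_gen j).
Proof.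
apply: whomogB; first by rewrite -(ch_degP ch); apply/chart_subP/(em_s em).
have h := whomogM (@whomogXi _ (proj k N) j) (whomogX (l := n1) (ch_lP ch)).
by apply: whomog_eq h _; rewrite /= natz -add1n PoszD.
Qed.

Lemma chart_l0X j : dvdm q (subst s l ^+ j - ch_l0 ch ^+ j).
Proof. by apply: dvdmXX; apply: ch_ll0. Qed.

Lemma vanishes_chart_gen j : vanishes (chart_gen j).
Proof.
rewrite /vanishes substB substM substX substXn.
have -> : subst s (chart_sub (s j)) - s j * subst s l ^+ n1 =
    (subst s (chart_sub (s j)) - chart_tw (s j)) -
    s j * (subst s l ^+ n1 - ch_l0 ch ^+ n1).
  have -> : chart_tw (s j) = s j * ch_l0 ch ^+ n1.
    apply: io_inj; rewrite (io_chart_tw (em_s em j)) ch_chil rmorphM rmorphXn.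
    by rewrite mulrC.
  by ring.
apply: dvdmB; first exact: chart_sub_tw.
by apply: dvdmM; apply: chart_l0X.
Qed.

(* Taylor's formula at (x_j l^n1)_j, for the increments [chart_gen j]. *)
Lemma chart_expansion (e : nat) (p : R) : homogR e%:Z p -> exists g : _ -> _ -> R,
  chart_sub (subst s p) = l ^+ (n1 * e) * p +
    \sum_j l ^+ (n1 * e.-1) * p^`M(j) * chart_gen j +
    \sum_i \sum_j g i j * (chart_gen i * chart_gen j).
Proof.
move=> hp; have [g eg] := taylor (fun j => 'X_j * l ^+ n1) chart_gen p.
exists g; rewrite /chart_sub subst_comp.
transitivity (subst (fun j => 'X_j * l ^+ n1 + chart_gen j) p).
  by apply: subst_ext => j; rewrite addrC subrK.
rewrite {}eg (subst_scale _ hp) -exprM; congr (_ + _ + _).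
apply: eq_bigr => j _; congr (_ * _).
have hd := @whomog_deriv _ (proj k N) _ _ j hp; case: e hp hd => [|e] hp hd.
  by rewrite (whomog_neg hd) // subst0 mulr0.
rewrite (subst_scale (d := e)) -?exprM //.
by apply: whomog_eq hd _; rewrite /= -addn1 PoszD addrK.
Qed.

(** With p(s) = q r, the Taylor expansion of p(s) in the coordinates of the chart expresses a power
    of [l] times [p] through [chart_sub q] and the [chart_gen j], up to products of two
    generators. *)
Lemma chart_vanishes_gen (e : nat) (p : R) : homogR e%:Z p -> vanishes p ->
  exists M (h : option 'I_N.+1 -> R), square (l ^+ M * p -
    \sum_x h x * (if x is Some j then chart_gen j else chart_sub q)).
Proof.
move=> hp [r er]; have [g] := chart_expansion hp.
rewrite er /chart_sub substM -!/(chart_sub _) => eg.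
exists (n1 * e)%N, (fun x => if x is Some j then - (l ^+ (n1 * e.-1) * p^`M(j))
  else chart_sub r).
have -> : \sum_x (if x is Some j then - (l ^+ (n1 * e.-1) * p^`M(j)) else chart_sub r) *
    (if x is Some j then chart_gen j else chart_sub q) =
    chart_sub q * chart_sub r - \sum_j l ^+ (n1 * e.-1) * p^`M(j) * chart_gen j.
  rewrite (bigD1 None) //= mulrC; congr (_ + _).
  rewrite -sumrN (reindex_omap Some id) /=; last by case.
  by apply: eq_big => [j|j _]; rewrite ?eqxx ?mulNr.
rewrite eg; move: (\sum_j _ * _ * _) (l ^+ _ * p) => y x; set z := \sum_i _.
have -> : x - (x + y + z - y) = - z by ring.
apply/squareN/square_sum => i _; apply: square_sum => j _.
apply: square_gen; [exact: chart_genP|exact: chart_genP|exact: vanishes_chart_gen|].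
exact: vanishes_chart_gen.
Qed.

(** Write p(s) = q r. If the derivatives of [p] vanish on Y, then so do the products of r with the
    derivatives of q, and smoothness makes q r divisible by q^2. Every term of the expansion is then
    a product of two elements of the ideal. *)
Lemma chart_vanishes_square (e : nat) (p : R) : homogR e%:Z p -> vanishes p ->
  (forall j, vanishes p^`M(j)) -> exists M, square (l ^+ M * p).
Proof.
move=> hp [r er] dp; have [g] := chart_expansion hp.
have [|u eu] := em_smooth em (r := r).
  move=> i; have : dvdm q ((subst s p)^`M(i)).
    by rewrite chain_rule; apply: dvdm_sum => j _; apply: dvdmMr; apply: dp.
  rewrite er mderivM => h; have := dvdmB h (dvdmm q r^`M(i)).
  by rewrite addrK mulrC.
rewrite er eu => eg; exists (n1 * e)%N.
have -> : l ^+ (n1 * e) * p = chart_sub (q * q * u) -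
    (\sum_j l ^+ (n1 * e.-1) * p^`M(j) * chart_gen j +
    \sum_i \sum_j g i j * (chart_gen i * chart_gen j)).
  by rewrite eg -[X in _ = X - _]addrA addrK.
apply: square_add.
  rewrite /chart_sub !substM mulrC; apply: square_gen.
  - exact: chart_subP (em_q em).
  - exact: chart_subP (em_q em).
  - exact: vanishes_chart_sub_q.
  - exact: vanishes_chart_sub_q.
apply/squareN/square_add.
  apply: square_sum => j _; rewrite -mulrA; apply: square_gen.
  - exact: whomog_deriv hp.
  - exact: chart_genP.
  - exact: dp.
  - exact: vanishes_chart_gen.
apply: square_sum => i _; apply: square_sum => j _.
apply: square_gen; [exact: chart_genP|exact: chart_genP|exact: vanishes_chart_gen|].
exact: vanishes_chart_gen.
Qed.

End Chart.

Lemma whomogXj (j : 'I_N.+1) a : homogR a%:Z ('X_j ^+ a).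
Proof.
have h := whomogX (l := a) (@whomogXi _ (proj k N) j).
by apply: whomog_eq h _; rewrite /= natz.
Qed.

Lemma whomog_lX (c : em_C em) a : homogR a%:Z (ch_l (em_chart em c) ^+ a).
Proof.
have h := whomogX (l := a) (ch_lP (em_chart em c)).
by apply: whomog_eq h _; rewrite /= natz.
Qed.

Lemma square_cover (p : R) (e : nat) : homogR e%:Z p -> vanishes p ->
  (forall c, exists M, square (ch_l (em_chart em c) ^+ M * p)) ->
  forall j : 'I_N.+1, exists a, square ('X_j ^+ a * p).
Proof.
move=> hp vp /choice[M hM] j.
have [a [c [hc vc]]] := em_cover_powers em j (\max_i M i).
exists a; set u := \sum_i _ in vc.
rewrite -['X_j ^+ a](subrK u) mulrDl; apply: square_add.
  (* The difference between ['X_j ^+ a] and its expression by the cover vanishes on Y, so its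
     product with [p] is in the square. *)
  rewrite -[_ * p]mul1r; apply: (@square_gen _ _ _ a%:Z e%:Z) => //.
  apply: whomogB; first exact: whomogXj.
  apply: whomog_sum => i _.
  by apply: whomog_eq (whomogM (hc i) (@whomog_lX i (\max_i M i))) _; rewrite subrK.
rewrite mulr_suml; apply: square_sum => i _; rewrite -mulrA; apply: squareM.
by rewrite -(subnK (leq_bigmax i)) exprD -mulrA; apply: squareM.
Qed.

Lemma vanishes_square (e : nat) (p : R) : homogR e%:Z p -> vanishes p ->
  (forall j, vanishes p^`M(j)) ->
  forall j : 'I_N.+1, exists a, square ('X_j ^+ a * p).
Proof.
move=> hp vp dp; apply: (square_cover hp vp) => c.
exact: chart_vanishes_square hp vp dp.
Qed.

Definition conormal_gen (x : em_C em * option 'I_N.+1) : R :=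
  if x.2 is Some j then chart_gen x.1 j else chart_sub x.1 q.

Definition conormal_deg (x : em_C em * option 'I_N.+1) : int :=
  if x.2 is Some j then (ch_deg (em_chart em x.1)).+1%:Z else nu gq.

Lemma conormal_genP x :
  homogR (conormal_deg x) (conormal_gen x) /\ vanishes (conormal_gen x).
Proof.
case: x => c [j|]; split; rewrite /conormal_deg /conormal_gen /=.
- exact: chart_genP.
- exact: vanishes_chart_gen.
- exact: chart_subP (em_q em).
- exact: vanishes_chart_sub_q.
Qed.

(** The generators found on the charts are combined through the cover; this yields the finite
    generation of I / I^2 on the opens of P^N. *)
Lemma vanishes_gen (e : nat) (p : R) : homogR e%:Z p -> vanishes p ->
  forall j : 'I_N.+1, exists a (h : _ -> R),
    square ('X_j ^+ a * p - \sum_x h x * conormal_gen x).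
Proof.
move=> hp vp j.
have H c := chart_vanishes_gen c hp vp.
have [M hM] := choice H; have [h hh] := choice hM.
have [a [c [hc vc]]] := em_cover_powers em j (\max_i M i).
exists a, (fun x => c x.1 * ch_l (em_chart em x.1) ^+ (\max_i M i - M x.1) * h x.1 x.2).
set u := \sum_i _ in vc.
rewrite -['X_j ^+ a](subrK u) mulrDl -addrA; apply: square_add.
  rewrite -[_ * p]mul1r; apply: (@square_gen _ _ _ a%:Z e%:Z) => //.
  apply: whomogB; first exact: whomogXj.
  apply: whomog_sum => i _.
  by apply: whomog_eq (whomogM (hc i) (@whomog_lX i (\max_i M i))) _; rewrite subrK.
rewrite -(pair_bigA _ (fun x1 x2 => c x1 * ch_l (em_chart em x1) ^+ (\max_i M i - M x1) * h x1 x2 * conormal_gen (x1, x2))) /=.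
rewrite mulr_suml -sumrB; apply: square_sum => i _.
rewrite -{1}(subnK (leq_bigmax i)) exprD -!mulrA.
set v := \sum_j _; have -> : v = c i * (ch_l (em_chart em i) ^+ (\max_i M i - M i) *
    \sum_x h i x * conormal_gen (i, x)).
  by rewrite !mulr_sumr; apply: eq_bigr => x _; rewrite !mulrA.
rewrite -!mulrBr; do 2 apply: squareM.
exact: hh.
Qed.

End Conormal.

Arguments chart_subP {k A K io q gq D N s em} c {g f} _ _ _.
Arguments chart_genP {k A K io q gq D N s em} c j _ _.
Arguments whomog_lX {k A K io q gq D N s em} c a _ _.
Arguments whomogXj {k N} j a _ _.

(** * Local lifts *)

Section Lifts.
Context {k : fieldType} {A : coxSpace k} {K : fieldType}.
Context (io : {rmorphism cox_ring A -> K}) (io_inj : injective io).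
Local Notation S := (cox_ring A).
Local Notation G := (cox_grp A).
Local Notation n := (cox_var A).
Context (q : S) (gq D : G) (N : nat) (s : 'I_N.+1 -> S).
Local Notation R := (cox_ring (proj k N)).
Context (em : embedding io q gq D s).
Local Notation lam := (em_lam em).
Local Notation homogR d p := (whomog (d : cox_grp (proj k N)) (p : R)).
Local Notation dv := (divisor D s).
Implicit Types t u : seq 'I_N.+1.

Definition locs t g x := loc io (map dv t) g x.
Definition qms t x := qmod io q (map dv t) x.

Lemma denom_dv j : denom (dv j).
Proof. by split; [apply: (em_s em)|apply: (em_s0 em)]. Qed.

Lemma denoms_dv t : denoms (map dv t).
Proof. exact/denoms_mapf/denom_dv. Qed.

Lemma locs_eq t g h x : locs t g x -> g = h -> locs t h x.
Proof. by move=> hx <-. Qed.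

Lemma qmodMp hs p x : qmod io q hs x -> qmod io q hs (io p * x).
Proof.
move=> [us [p' [uh e]]]; exists us, (p * p'); split=> //.
by rewrite -mulrA e -rmorphM mulrCA.
Qed.

Lemma qmod_dvdm hs p : dvdm q p -> qmod io q hs (io p).
Proof. by move=> [r ->]; apply: qmod_poly. Qed.

Lemma qmod_den hs x : denoms hs -> qmod io q hs x ->
  eventually (fun l => exists p, x * io (prodh hs) ^+ l = io (q * p)).
Proof.
move=> dh [us [p [uh e]]]; exists (size us) => l /(prodh_dvd dh uh)[r er _].
by exists (p * r); rewrite -rmorphXn -er rmorphM mulrA e -rmorphM mulrA.
Qed.

Lemma dvdm_homog g p : whomog g p -> dvdm q p ->
  exists2 r, whomog (g - gq) r & p = q * r.
Proof.
move=> hp [r er]; exists (wcomp (g - gq) r); first exact: whomog_wcomp.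
by rewrite mulrC -(wcompM _ _ (em_q em)) mulrC -er wcomp_homog.
Qed.

Lemma ev_euler (d : nat) (P : R) : homogR d%:Z P ->
  \sum_j s j * subst s P^`M(j) = d%:R *: subst s P.
Proof.
move=> hP; have := euler (A := proj k N) (lam := fun z : int => z%:~R) _ hP.
move=> /(_ (fun g h => intrD _ g h))/(congr1 (subst s)); rewrite substZ => <-.
rewrite subst_sum; apply: eq_bigr => j _ /=.
by rewrite mulr1z scale1r substM substX.
Qed.

Section Chart.
Context (c : em_C em).
Local Notation ch := (em_chart em c).

Lemma chart_rest : exists h : 'I_n -> S, forall i,
  whomog (D *+ em_ni em i - gq) (h i) /\
  subst s (ch_X ch i) = 'X_i * ch_T ch i + q * h i.
Proof.
suff /choice[h hh] i : exists h, whomog (D *+ em_ni em i - gq) h /\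
  subst s (ch_X ch i) = 'X_i * ch_T ch i + q * h by exists h.
have [||r hr er] := @dvdm_homog (D *+ em_ni em i) (subst s (ch_X ch i) - 'X_i * ch_T ch i).
- apply: whomogB; first exact: (ev_homog em (ch_XP ch i)).
  apply: whomog_eq (whomogM (@whomogXi _ A i) (ch_TP ch i)) _.
  by rewrite addrC subrK.
- exact: ch_XT.
by exists r; split=> //; rewrite -er addrC subrK.
Qed.

Lemma chart_lift_form t (theta : 'I_n -> K) :
  (forall i, locs t (D - cox_wt i) (theta i)) ->
  (forall a, qms t (\sum_i io ((lam a (cox_wt i))%:MP * 'X_i) * theta i)) ->
  exists (v : 'I_N.+1 -> K) (sg : K),
    [/\ forall j, locs t (D *+ em_e em) (v j),
        locs t (D *+ em_e em + (D - gq)) sg,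
        qms t (\sum_j v j * io (s j)) &
        forall i, qms t (io (ch_l0 ch ^+ em_e em) * theta i -
          \sum_j v j * io (s j)^`M(i) - sg * io q^`M(i))].
Proof.
move=> ht he; have [h hh] := chart_rest; have dt := @denoms_dv t.
have [cn hcn] := em_nulam em.
exists (fun j => \sum_i theta i * io (ch_E ch i * subst s (ch_X ch i)^`M(j))).
exists (- \sum_i theta i * io (ch_E ch i * h i)); split.
- move=> j; apply: (loc_sum dt) => i _.
  have hE := whomogM (ch_EP ch i) (ev_homog em (@whomog_deriv _ (proj k N) _ _ j (ch_XP ch i))).
  apply: locs_eq (locM (ht i) (loc_poly io _ hE)) _.
  by rewrite /= mulrzBr mulr1z -pmulrn; zmod.
- apply: (locN dt); apply: (loc_sum dt) => i _.
  have hE := whomogM (ch_EP ch i) (hh i).1.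
  by apply: locs_eq (locM (ht i) (loc_poly io _ hE)) _; zmod.
(* Euler's formula multiplies the term of X_i by its degree [em_ni em i], which is a combination of
   the [lam a (cox_wt i)], so that the Euler relations apply. *)
- have -> : \sum_j (\sum_i theta i * io (ch_E ch i * subst s (ch_X ch i)^`M(j))) * io (s j) =
      \sum_a io ((cn a)%:MP * ch_l0 ch ^+ em_e em) *
        (\sum_i io ((lam a (cox_wt i))%:MP * 'X_i) * theta i) +
      \sum_i theta i * io (q * ((em_ni em i)%:R *: (ch_E ch i * h i))).
    under eq_bigr do rewrite mulr_suml.
    rewrite exchange_big /=.
    under [X in _ = X + _]eq_bigr do rewrite mulr_sumr.
    rewrite [X in _ = X + _]exchange_big -big_split; apply: eq_bigr => i _ /=.
    have -> : \sum_j theta i * io (ch_E ch i * subst s (ch_X ch i)^`M(j)) * io (s j) =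
        theta i * io (ch_E ch i * ((em_ni em i)%:R *: subst s (ch_X ch i))).
      rewrite -(ev_euler (ch_XP ch i)) mulr_sumr rmorph_sum mulr_sumr.
      by apply: eq_bigr => j _ /=; rewrite -mulrA -rmorphM; congr (_ * io _); ring.
    have -> : \sum_a io ((cn a)%:MP * ch_l0 ch ^+ em_e em) *
        (io ((lam a (cox_wt i))%:MP * 'X_i) * theta i) =
        theta i * io ((em_ni em i)%:R *: ('X_i * ch_l0 ch ^+ em_e em)).
      have -> : ((em_ni em i)%:R : k) = \sum_a cn a * lam a (cox_wt i).
        by rewrite -hcn em_nuE.
      rewrite scaler_suml rmorph_sum mulr_sumr; apply: eq_bigr => a _ /=.
      rewrite mulrA mulrC -rmorphM; congr (_ * io _).
      by rewrite -mul_mpolyC mpolyCM; ring.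
    rewrite -mulrDr -rmorphD; congr (_ * io _).
    rewrite -(ch_ET ch i) (hh i).2 -!mul_mpolyC; ring.
  apply: qmodD; first by apply: qmod_sum => a _; apply: qmodMp; apply: he.
  by apply: qmod_sum => i _; apply: qmodM (ht i) _; apply: qmod_poly.
- move=> i'.
  have -> : \sum_j (\sum_i theta i * io (ch_E ch i * subst s (ch_X ch i)^`M(j))) * io (s j)^`M(i') =
      io (ch_l0 ch ^+ em_e em) * theta i' +
      \sum_a io (ch_dT ch a i') *
        (\sum_i io ((lam a (cox_wt i))%:MP * 'X_i) * theta i) +
      (\sum_i theta i * io (ch_E ch i * h i)) * io q^`M(i') +
      \sum_i theta i * io (q * (ch_E ch i * (h i)^`M(i'))).
    have -> : io (ch_l0 ch ^+ em_e em) * theta i' =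
        \sum_i theta i * io ((i == i')%:R * ch_l0 ch ^+ em_e em).
      rewrite (bigD1 i') //= eqxx mul1r mulrC big1 ?addr0 // => i /negPf->.
      by rewrite mul0r rmorph0 mulr0.
    under eq_bigr do rewrite mulr_suml.
    rewrite exchange_big mulr_suml /=.
    under [X in _ = _ + X + _ + _]eq_bigr do rewrite mulr_sumr.
    rewrite [X in _ = _ + X + _ + _]exchange_big -!big_split.
    apply: eq_bigr => i _ /=.
    have -> : \sum_j theta i * io (ch_E ch i * subst s (ch_X ch i)^`M(j)) * io (s j)^`M(i') =
        theta i * io (ch_E ch i * (subst s (ch_X ch i))^`M(i')).
      rewrite chain_rule mulr_sumr rmorph_sum mulr_sumr.
      by apply: eq_bigr => j _ /=; rewrite -mulrA -rmorphM mulrA.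
    have -> : \sum_a io (ch_dT ch a i') * (io ((lam a (cox_wt i))%:MP * 'X_i) * theta i) =
        theta i * io ('X_i * (ch_E ch i * (ch_T ch i)^`M(i'))).
      rewrite ch_dTP mulr_sumr rmorph_sum mulr_sumr; apply: eq_bigr => a _ /=.
      by rewrite mulrA mulrC -rmorphM -mul_mpolyC; congr (_ * io _); ring.
    rewrite -(mulrA _ _ (io q^`M(i'))) -rmorphM -!mulrDr -!rmorphD; congr (_ * io _).
    rewrite (hh i).2 mderivD !mderivM mderivXi -(ch_ET ch i); ring.
  set x := io _ * theta i'; set y := \sum_a _; set z := \sum_i _; set w := \sum_i _.
  have -> : x - (x + y + z * io q^`M(i') + w) - - z * io q^`M(i') = - (y + w) by ring.
  apply/qmodN/qmodD; first by apply: qmod_sum => a _; apply: qmodMp; apply: he.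
  by apply: qmod_sum => i _; apply: qmodM (ht i) _; apply: qmod_poly.
Qed.

End Chart.
Lemma locs_invX t i0 a : i0 \in t -> locs t (- D *+ a) (io (s i0) ^+ a)^-1.
Proof.
move=> ht; rewrite -exprVn; apply: locX.
exact: (loc_inv io_inj (denom_dv i0) (map_f dv ht)).
Qed.

Lemma em_cover_l0 (j : 'I_N.+1) M : exists a (c : em_C em -> R),
  (forall i, homogR (a%:Z - M%:Z) (c i)) /\
  dvdm q (s j ^+ a - \sum_i subst s (c i) * ch_l0 (em_chart em i) ^+ M).
Proof.
have [a [c [hc vc]]] := em_cover_powers em j M; exists a, c; split=> //.
move: vc; rewrite substB substXn substX subst_sum => vc.
apply: dvdm_trans vc _; rewrite -sumrB; apply: dvdm_sum => i _.
rewrite substM substXn -mulrBr; apply/dvdmM/dvdmXX; exact: ch_ll0.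
Qed.

(** Surjectivity of Omega_P(1) -> Omega_Y(1) over an affine open inside x_i0 <> 0: the lifts on the
    charts are combined through the relation that expresses a power of [s i0] by the [ch_l0]. *)
Lemma lift_form t i0 (theta : 'I_n -> K) : i0 \in t ->
  (forall i, locs t (D - cox_wt i) (theta i)) ->
  (forall a, qms t (\sum_i io ((lam a (cox_wt i))%:MP * 'X_i) * theta i)) ->
  exists (v : 'I_N.+1 -> K) (sg : K),
    [/\ forall j, locs t 0 (v j), locs t (D - gq) sg,
        qms t (\sum_j v j * io (s j)) &
        forall i, qms t (theta i -
          \sum_j v j * io (s j)^`M(i) - sg * io q^`M(i))].
Proof.
move=> it ht he; have dt := @denoms_dv t.
have /choice[vs hvs] c : exists p : ('I_N.+1 -> K) * K,
    [/\ forall j, locs t (D *+ em_e em) (p.1 j),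
        locs t (D *+ em_e em + (D - gq)) p.2,
        qms t (\sum_j p.1 j * io (s j)) &
        forall i, qms t (io (ch_l0 (em_chart em c) ^+ em_e em) * theta i -
          \sum_j p.1 j * io (s j)^`M(i) - p.2 * io q^`M(i))].
  by have [v [sg h]] := chart_lift_form c ht he; exists (v, sg).
have [a [b [hb vb]]] := em_cover_l0 i0 (em_e em).
have i00 := io_neq0 io_inj (em_s0 em i0).
have ia0 : io (s i0) ^+ a != 0 by apply: expf_neq0.
have iV := locs_invX a it.
have hbs c : locs t (D *~ (a%:Z - (em_e em)%:Z)) (io (subst s (b c))).
  by apply: loc_poly; apply: (ev_homog em (hb c)).
have hdeg : D *~ (a%:Z - (em_e em)%:Z) = D *+ a - D *+ em_e em.
  by rewrite mulrzBr -!pmulrn.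
exists (fun j => (\sum_c io (subst s (b c)) * (vs c).1 j) / io (s i0) ^+ a).
exists ((\sum_c io (subst s (b c)) * (vs c).2) / io (s i0) ^+ a); split.
- move=> j; have h : locs t (D *+ a) (\sum_c io (subst s (b c)) * (vs c).1 j).
    apply: (loc_sum dt) => c _; have [h _ _ _] := hvs c.
    by apply: locs_eq (locM (hbs c) (h j)) _; rewrite hdeg; zmod.
  by apply: locs_eq (locM h iV) _; rewrite mulNrn; zmod.
- have h : locs t (D *+ a + (D - gq)) (\sum_c io (subst s (b c)) * (vs c).2).
    apply: (loc_sum dt) => c _; have [_ h _ _] := hvs c.
    by apply: locs_eq (locM (hbs c) h) _; rewrite hdeg; zmod.
  by apply: locs_eq (locM h iV) _; rewrite mulNrn; zmod.
- have -> : \sum_j (\sum_c io (subst s (b c)) * (vs c).1 j) / io (s i0) ^+ a * io (s j) =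
      (io (s i0) ^+ a)^-1 * \sum_c io (subst s (b c)) * (\sum_j (vs c).1 j * io (s j)).
    rewrite mulr_sumr; under [RHS]eq_bigr do rewrite !mulr_sumr.
    rewrite [RHS]exchange_big; apply: eq_bigr => j _ /=.
    rewrite !mulr_suml; apply: eq_bigr => c _; ring.
  apply: qmodM iV _; apply: qmod_sum => c _; apply: qmodMp.
  by have [] := hvs c.
- move=> i.
  have -> : theta i - \sum_j (\sum_c io (subst s (b c)) * (vs c).1 j) / io (s i0) ^+ a * io (s j)^`M(i)
      - (\sum_c io (subst s (b c)) * (vs c).2) / io (s i0) ^+ a * io q^`M(i) =
      (io (s i0) ^+ a)^-1 * (
      theta i * io (s i0 ^+ a - \sum_c subst s (b c) * ch_l0 (em_chart em c) ^+ em_e em) +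
      \sum_c io (subst s (b c)) * (io (ch_l0 (em_chart em c) ^+ em_e em) * theta i -
        \sum_j (vs c).1 j * io (s j)^`M(i) - (vs c).2 * io q^`M(i))).
    have -> : \sum_c io (subst s (b c)) * (io (ch_l0 (em_chart em c) ^+ em_e em) * theta i -
        \sum_j (vs c).1 j * io (s j)^`M(i) - (vs c).2 * io q^`M(i)) =
        theta i * io (\sum_c subst s (b c) * ch_l0 (em_chart em c) ^+ em_e em) -
        (\sum_j (\sum_c io (subst s (b c)) * (vs c).1 j) * io (s j)^`M(i)) -
        (\sum_c io (subst s (b c)) * (vs c).2) * io q^`M(i).
      rewrite [X in theta i * X]rmorph_sum [X in _ = X - _ - _]mulr_sumr [X in _ = _ - _ - X]mulr_suml.
      under [X in _ = _ - X - _]eq_bigr do rewrite mulr_suml.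
      rewrite [X in _ = _ - X - _]exchange_big -!sumrB; apply: eq_bigr => c _ /=.
      rewrite !mulrBr mulr_sumr rmorphM; congr (_ - _ - _); try ring.
      by apply: eq_bigr => j _; rewrite mulrA.
    rewrite rmorphB rmorphXn /= mulrBr.
    have -> : \sum_j (\sum_c io (subst s (b c)) * (vs c).1 j) / io (s i0) ^+ a * io (s j)^`M(i) =
        (io (s i0) ^+ a)^-1 * \sum_j (\sum_c io (subst s (b c)) * (vs c).1 j) * io (s j)^`M(i).
      by rewrite mulr_sumr; apply: eq_bigr => j _; ring.
    set x := \sum_c _; set y := io (\sum_c _); set z := \sum_j _.
    move: (io (s i0) ^+ a) ia0 => w w0; field; exact: w0.
  apply: qmodM iV _; apply: qmodD.
    exact: qmodM (ht i) (qmod_dvdm _ vb).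
  by apply: qmod_sum => c _; apply: qmodMp; have [_ _ _ h] := hvs c; apply: h.
Qed.

End Lifts.

(** * Lifting differentials of P^N to the ideal of the image *)

Section ConormalLifts.
Context {k : fieldType} {A : coxSpace k} {K : fieldType}.
Context (io : {rmorphism cox_ring A -> K}) (io_inj : injective io).
Local Notation S := (cox_ring A).
Local Notation G := (cox_grp A).
Local Notation n := (cox_var A).
Context (q : S) (gq D : G) (N : nat) (s : 'I_N.+1 -> S).
Local Notation R := (cox_ring (proj k N)).
Context (em : embedding io q gq D s).
Local Notation nu := (em_nu em).
Local Notation homogR d p := (whomog (d : cox_grp (proj k N)) (p : R)).
Local Notation locs := (locs io D s).
Local Notation qms := (qms io q D s).
Local Notation vanishes := (vanishes q s).

Lemma nuMn g j : nu (g *+ j) = nu g *+ j.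
Proof.
by elim: j => [|j IH]; rewrite ?mulr0n ?(nu0 em) // !mulrS (em_nuD em) IH.
Qed.

Lemma ev_deriv_mul (a b : R) j : vanishes b ->
  dvdm q (subst s (a * b)^`M(j) - subst s a * subst s b^`M(j)).
Proof.
move=> vb; rewrite mderivM substD !substM addrK; exact: dvdmM.
Qed.

Section Chart.
Context (c : em_C em).
Local Notation ch := (em_chart em c).
Local Notation l := (ch_l ch).
Local Notation l0 := (ch_l0 ch).
Local Notation n1 := (ch_deg ch).
Local Notation sub := (chart_sub c).
Local Notation tw := (chart_tw c).
Local Notation gen := (chart_gen c).

Lemma dvdm_chart_tw p : dvdm q p -> dvdm q (tw p).
Proof.
move=> [r ->]; rewrite /chart_tw substM; apply: dvdmMr.
have := dvdmB (vanishes_chart_sub_q io_inj c) (chart_sub_tw c q).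
by rewrite opprB addrCA subrr addr0.
Qed.

Lemma chart_tw_pow e f : whomog (D *+ e) f -> tw f = l0 ^+ (n1 * e) * f.
Proof.
move=> hf; apply: io_inj; rewrite (io_chart_tw c hf) rmorphM rmorphXn exprM.
congr (_ * _); rewrite -(ch_chil ch); elim: e {hf} => [|e IH].
  exact: chart_chi0.
by rewrite mulrS ch_chiD IH exprS.
Qed.

(** Exactness of the conormal sequence in the middle: [b] combines the local generators with the
    coefficients g and -f_j. On Y, its derivative along x_j has three parts: one from g dq minus the
    sum of the f_j' ds_j', zero by the last hypothesis; a multiple of the sum of the f_j' s_j', zero
    by the one before; and the part of x_j l^n1, which is the wanted multiple of f_j. *)
Lemma chart_lift_conormal e (f : 'I_N.+1 -> S) (g : S) :
  (forall j, whomog (D *+ e) (f j)) -> whomog (D *+ e + (D - gq)) g ->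
  dvdm q (\sum_j f j * s j) ->
  (forall i, dvdm q (\sum_j f j * (s j)^`M(i) - g * q^`M(i))) ->
  exists M (b : R), [/\ homogR (M + e).+1%:Z b, vanishes b &
    forall j, dvdm q (subst s b^`M(j) - l0 ^+ M * f j)].
Proof.
(* A form of degree [D *+ e] is twisted by [l0 ^+ (n1 * e)], and the term ['X_j * l ^+ n1] of
   [chart_gen] brings one more [l0 ^+ n1]. *)
move=> hf hg e1 e2; exists (n1 * e.+1)%N.
exists (sub g * sub q - \sum_j sub (f j) * gen j); split.
- apply: whomogB.
    have h := whomogM (chart_subP c hg) (chart_subP c (em_q em)).
    apply: whomog_eq h _; rewrite /= -(em_nuD em).
    rewrite (_ : D *+ e + (D - gq) + gq = D *+ e.+1); last by rewrite mulrS; zmod.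
    rewrite nuMn (ch_degP ch); lia.
  apply: whomog_sum => j _.
  have h := whomogM (chart_subP c (hf j)) (chart_genP c j).
  by apply: whomog_eq h _; rewrite /= nuMn (ch_degP ch); lia.
- rewrite /vanishes substB; apply: dvdmB.
    by apply: vanishesM; apply: (vanishes_chart_sub_q io_inj c).
  apply: vanishes_sum => j _; apply: vanishesM.
  exact: (vanishes_chart_gen io_inj c j).
move=> j.
pose d i := subst s (ch_X ch i)^`M(j).
pose la := subst s (l ^+ n1)^`M(j).
have tsub p : dvdm q (subst s (sub p) - tw p) by exact: chart_sub_tw.
have dsub p : dvdm q (subst s (sub p)^`M(j) - \sum_i tw p^`M(i) * d i).
  rewrite /chart_sub chain_rule subst_sum -sumrB; apply: dvdm_sum => i _.
  by rewrite substM -mulrBl; apply/dvdmMr/tsub.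
have dgen j' : dvdm q (subst s (gen j')^`M(j) -
    (\sum_i tw (s j')^`M(i) * d i - ((j' == j)%:R * l0 ^+ n1 + s j' * la))).
  rewrite /chart_gen mderivB substB mderivM substD !substM substX mderivXi.
  rewrite subst_nat substXn -/la.
  set x := subst s _; set y := \sum_i _; set z := _%:R.
  have -> : x - (z * subst s l ^+ n1 + s j' * la) - (y - (z * l0 ^+ n1 + s j' * la)) =
      (x - y) - z * (subst s l ^+ n1 - l0 ^+ n1) by ring.
  by apply: dvdmB; [apply: dsub|apply: dvdmM; apply: chart_l0X].
have d1 : dvdm q (subst s (sub g * sub q)^`M(j) - tw g * \sum_i tw q^`M(i) * d i).
  apply: dvdm_trans (ev_deriv_mul _ j (vanishes_chart_sub_q io_inj c)) _.
  by apply: dvdmMM; [apply: tsub|apply: dsub].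
have d2 j' : dvdm q (subst s (sub (f j') * gen j')^`M(j) - tw (f j') *
    (\sum_i tw (s j')^`M(i) * d i - ((j' == j)%:R * l0 ^+ n1 + s j' * la))).
  apply: dvdm_trans (ev_deriv_mul _ j (vanishes_chart_gen io_inj c j')) _.
  by apply: dvdmMM; [apply: tsub|apply: dgen].
rewrite mderivB substB.
have -> : (\sum_j' sub (f j') * gen j')^`M(j) = \sum_j' (sub (f j') * gen j')^`M(j).
  exact: (big_morph _ (mderivD j) (mderiv0 k j)).
rewrite [X in _ - X - _]subst_sum.
pose u := tw g * (\sum_i tw q^`M(i) * d i) - \sum_j' tw (f j') *
    (\sum_i tw (s j')^`M(i) * d i - ((j' == j)%:R * l0 ^+ n1 + s j' * la)).
apply: (dvdm_trans (p' := u)).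
  rewrite /u; set x := subst s _; set x' := tw g * _; set y := \sum_j' _.
  set y' := \sum_j' _; have -> : x - y - (x' - y') = (x - x') - (y - y') by ring.
  by apply: dvdmB; [apply: d1|rewrite -sumrB; apply: dvdm_sum => j' _; apply: d2].
have -> : u = l0 ^+ (n1 * e.+1) * f j + l0 ^+ (n1 * e) * la * (\sum_j' f j' * s j') -
    \sum_i tw (\sum_j' f j' * (s j')^`M(i) - g * q^`M(i)) * d i.
  have -> : \sum_i tw (\sum_j' f j' * (s j')^`M(i) - g * q^`M(i)) * d i =
      (\sum_j' tw (f j') * \sum_i tw (s j')^`M(i) * d i) - tw g * \sum_i tw q^`M(i) * d i.
    under [X in _ = X - _]eq_bigr do rewrite mulr_sumr.
    rewrite [X in _ = X - _]exchange_big mulr_sumr -sumrB.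
    apply: eq_bigr => i _ /=; rewrite {1}/chart_tw substB subst_sum substM -!/(tw _).
    rewrite mulrBl mulr_suml; congr (_ - _); last by rewrite mulrA.
    by apply: eq_bigr => j' _; rewrite /chart_tw substM mulrA.
  have -> : l0 ^+ (n1 * e.+1) * f j = \sum_j' tw (f j') * ((j' == j)%:R * l0 ^+ n1).
    rewrite (bigD1 j) //= eqxx mul1r big1 ?addr0 => [|j' /negPf->]; last by rewrite mul0r mulr0.
    by rewrite (chart_tw_pow (hf j)) mulnS exprD; ring.
  have -> : l0 ^+ (n1 * e) * la * (\sum_j' f j' * s j') = \sum_j' tw (f j') * (s j' * la).
    rewrite mulr_sumr; apply: eq_bigr => j' _; rewrite (chart_tw_pow (hf j')); ring.
  rewrite /u; under [X in _ - X = _]eq_bigr do rewrite mulrBr mulrDr.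
  rewrite sumrB big_split /=.
  set x := tw g * _; set y := \sum_j' _; set z := \sum_j' _; set w := \sum_j' _; ring.
set x := _ * f j; set y := _ * \sum_j' _; set z := \sum_i _.
have -> : x + y - z - x = y - z by ring.
apply: dvdmB; first exact: dvdmM.
by apply: dvdm_sum => i _; apply: dvdmMr; apply: dvdm_chart_tw.
Qed.

Lemma chart_lift_conormal_raise e (f : 'I_N.+1 -> S) M (b : R) M' :
  (M <= M')%N -> homogR (M + e).+1%:Z b -> vanishes b ->
  (forall j, dvdm q (subst s b^`M(j) - l0 ^+ M * f j)) ->
  [/\ homogR (M' + e).+1%:Z (l ^+ (M' - M) * b), vanishes (l ^+ (M' - M) * b) &
    forall j, dvdm q (subst s (l ^+ (M' - M) * b)^`M(j) - l0 ^+ M' * f j)].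
Proof.
move=> MM hb vb db; split.
- have h := whomogM (whomog_lX c (M' - M)) hb.
  by apply: whomog_eq h _; rewrite /=; lia.
- by rewrite /vanishes substM; apply: dvdmM.
- move=> j; apply: dvdm_trans (ev_deriv_mul _ j vb) _.
  rewrite -[in X in _ - X](subnK MM) exprD -mulrA substXn.
  by apply: dvdmMM => //; apply: chart_l0X.
Qed.

End Chart.

End ConormalLifts.

(** * Derivatives of sections of the ideal *)

Section Cochains.
Context {k : fieldType} {A : coxSpace k} {K K' : fieldType}.
Context (io : {rmorphism cox_ring A -> K}) (io_inj : injective io).
Local Notation S := (cox_ring A).
Local Notation G := (cox_grp A).
Local Notation n := (cox_var A).
Context (q : S) (gq D : G) (N : nat) (s : 'I_N.+1 -> S).
Local Notation R := (cox_ring (proj k N)).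
Context (io' : {rmorphism R -> K'}) (io'_inj : injective io').
Context (em : embedding io q gq D s).
Local Notation homogR d p := (whomog (d : cox_grp (proj k N)) (p : R)).
Local Notation dv := (divisor D s).
Local Notation locs := (locs io D s).
Local Notation qms := (qms io q D s).
Local Notation vanishes := (vanishes q s).
Local Notation lam := (em_lam em).
Implicit Types (t u : seq 'I_N.+1).

Definition Xw u : R := \prod_(j <- u) 'X_j.

Lemma Xw_cat u u' : Xw (u ++ u') = Xw u * Xw u'.
Proof. exact: big_cat. Qed.

Lemma Xw_nseq d i : Xw (nseq d i) = 'X_i ^+ d.
Proof. by elim: d => [|d IH]; rewrite /Xw ?big_nil // big_cons exprS -IH. Qed.

Lemma Xw_neq0 u : io' (Xw u) != 0.
Proof.
apply/(io_neq0 io'_inj); rewrite prodf_seq_neq0; apply/allP => j _.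
exact: (@mpolyX_neq0 _ (proj k N)).
Qed.

Lemma whomog_Xw u : homogR (size u)%:Z (Xw u).
Proof.
elim: u => [|j u IH]; first by rewrite /Xw big_nil; apply: whomog1.
rewrite /Xw big_cons -/(Xw u).
by apply: whomog_eq (whomogM (@whomogXi _ (proj k N) j) IH) _; rewrite /=; lia.
Qed.

Lemma ev_Xw u : subst s (Xw u) = prodh (map dv u).
Proof.
elim: u => [|j u IH].
  by rewrite /Xw /prodh !big_nil -mpolyC1 substC.
by rewrite /Xw big_cons substM substX -/(Xw u) IH [RHS]prodh_cons.
Qed.

Lemma evXw_neq0 u : io (subst s (Xw u)) != 0.
Proof. by rewrite ev_Xw; apply/(io_neq0 io_inj)/prodh_neq0/(denoms_dv em). Qed.

Lemma denoms_dv_sub u t : {subset u <= t} -> {subset map dv u <= map dv t}.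
Proof. by move=> ut h /mapP[j /ut ? ->]; apply: map_f. Qed.

(* The sections of I(1) over the open set x_t <> 0, and those of its subsheaf
   of the sections all of whose derivatives are in I. *)
Definition ideal_sec t (x : K') : Prop := exists u P, [/\ {subset u <= t},
  homogR (size u).+1%:Z P, vanishes P & x * io' (Xw u) = io' P].

Definition square_sec t (x : K') : Prop := exists u P, [/\ {subset u <= t},
  homogR (size u).+1%:Z P, vanishes P /\ forall j, vanishes P^`M(j) &
  x * io' (Xw u) = io' P].

(* [psi] is the family of the derivatives of the section [x] of I(1),
   restricted to Y, and [v] the restriction of [x] to Y. *)
Definition derivs t (x : K') (psi : 'I_N.+1 -> K) (v : K) : Prop :=
  exists u P, [/\ {subset u <= t}, homogR (size u).+1%:Z P /\ vanishes P,
    x * io' (Xw u) = io' P, v * io (subst s (Xw u)) = io (subst s P) &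
    forall j, qms t (psi j - io (subst s P^`M(j)) / io (subst s (Xw u)))].

Lemma loc_frac t u g p : {subset u <= t} -> whomog (g + degh (map dv u)) p ->
  locs t g (io p / io (subst s (Xw u))).
Proof.
move=> ut hp; exists (map dv u), p; split=> //; first exact: denoms_dv_sub.
by rewrite -ev_Xw divfK // evXw_neq0.
Qed.

Lemma qms_frac t u p : {subset u <= t} -> dvdm q p ->
  qms t (io p / io (subst s (Xw u))).
Proof.
move=> ut [r ->]; exists (map dv u), r; split; first exact: denoms_dv_sub.
by rewrite -ev_Xw divfK // evXw_neq0.
Qed.

Lemma degh_dv u : degh (map dv u) = D *+ size u.
Proof.
elim: u => [|j u IH]; first by rewrite /degh big_nil.
by rewrite /= degh_cons IH mulrS.
Qed.

Lemma derivs_exist t x : ideal_sec t x -> exists psi v,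
  [/\ derivs t x psi v, forall j, locs t 0 (psi j), locs t D v & qms t v].
Proof.
move=> [u [P [ut hP vP e]]].
exists (fun j => io (subst s P^`M(j)) / io (subst s (Xw u))).
exists (io (subst s P) / io (subst s (Xw u))); split.
- exists u, P; split=> //; first by rewrite divfK // evXw_neq0.
  by move=> j; rewrite subrr; apply: qmod0.
- move=> j; apply: (loc_frac ut).
  have h := ev_homog em (@whomog_deriv _ (proj k N) _ _ j hP).
  apply: whomog_eq h _; rewrite /= degh_dv mulrzBr -pmulrn mulr1z mulrS; zmod.
- apply: (loc_frac ut); apply: whomog_eq (ev_homog em hP) _.
  by rewrite degh_dv /= -pmulrn mulrS.
- exact: qms_frac.
Qed.

Lemma derivs_sub t t' x psi v : {subset t <= t'} ->
  derivs t x psi v -> derivs t' x psi v.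
Proof.
move=> tt [u [P [ut hP e ev hd]]]; exists u, P; split=> //.
  by move=> j /ut/tt.
by move=> j; apply: qmod_sub (hd j); apply: denoms_dv_sub.
Qed.

Lemma derivsB t x psi v x' psi' v' : derivs t x psi v -> derivs t x' psi' v' ->
  derivs t (x - x') (fun j => psi j - psi' j) (v - v').
Proof.
move=> [u [P [ut [hP vP] e ev hd]]] [u' [P' [ut' [hP' vP'] e' ev' hd']]].
exists (u ++ u'), (P * Xw u' - P' * Xw u); split.
- by move=> j; rewrite mem_cat => /orP[/ut|/ut'].
- split; last first.
    rewrite /vanishes substB !substM; apply: dvdmB; exact: dvdmMr.
  apply: whomogB.
    by apply: whomog_eq (whomogM hP (@whomog_Xw u')) _; rewrite /= size_cat; lia.
  by apply: whomog_eq (whomogM hP' (@whomog_Xw u)) _; rewrite /= size_cat; lia.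
- by rewrite Xw_cat rmorphB !rmorphM -e -e'; ring.
- by rewrite Xw_cat substB !substM rmorphB !rmorphM -ev -ev'; ring.
move=> j; set a := subst s (Xw u); set a' := subst s (Xw u').
have a0 : io a != 0 := evXw_neq0 u; have a0' : io a' != 0 := evXw_neq0 u'.
have -> : psi j - psi' j - io (subst s (P * Xw u' - P' * Xw u)^`M(j)) / io (subst s (Xw (u ++ u'))) =
    (psi j - io (subst s P^`M(j)) / io a) - (psi' j - io (subst s P'^`M(j)) / io a') -
    io (subst s P * subst s (Xw u')^`M(j) - subst s P' * subst s (Xw u)^`M(j)) /
    io (subst s (Xw (u ++ u'))).
  rewrite Xw_cat mderivB !mderivM substB !substD !substM -/a -/a'.
  rewrite !rmorphB !rmorphD !rmorphM /=.
  move: (io _) (io (subst s P'^`M(j))) a0 a0' => y y'.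
  move: (io a) (io a') => w w' w0 w0'.
  move: (io (subst s P)) (io (subst s P')) (io (subst s (Xw u')^`M(j))) (io (subst s (Xw u)^`M(j))) => b1 b2 b3 b4.
  by field; rewrite w0 w0'.
apply: qmodB; first exact: qmodB (hd j) (hd' j).
apply: qms_frac; last by apply: dvdmB; apply: dvdmMr.
by move=> i; rewrite mem_cat => /orP[/ut|/ut'].
Qed.

Lemma derivs_euler t x psi v : derivs t x psi v ->
  qms t (\sum_j io (s j) * psi j).
Proof.
move=> [u [P [ut [hP vP] e ev hd]]].
apply: (@qmod_subr _ _ _ _ _ _ _ (\sum_j io (s j) * (io (subst s P^`M(j)) / io (subst s (Xw u))))).
  rewrite -sumrB; apply: qmod_sum => j _; rewrite -mulrBr.
  by apply: qmodMp; apply: hd.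
have -> : \sum_j io (s j) * (io (subst s P^`M(j)) / io (subst s (Xw u))) =
    io (\sum_j s j * subst s P^`M(j)) / io (subst s (Xw u)).
  by rewrite [X in _ = X / _]rmorph_sum mulr_suml; apply: eq_bigr => j _; rewrite rmorphM mulrA.
rewrite (ev_euler _ hP); apply: (qms_frac ut).
by rewrite -mul_mpolyC; apply: dvdmM.
Qed.

(** [v] is a multiple of [q] whose differential is given by the [psi j], by the chain rule; modulo
    [q] this is [v / q] times dq. For q = 0 both [v] and [v / q] are 0. *)
Lemma derivs_chain t x psi v i : derivs t x psi v ->
  qms t (\sum_j psi j * io (s j)^`M(i) - v / io q * io q^`M(i)).
Proof.
move=> [u [P [ut [hP vP] e ev hd]]].
pose y := \sum_j io (subst s P^`M(j)) / io (subst s (Xw u)) * io (s j)^`M(i).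
apply: (@qmod_subr _ _ _ _ _ _ _ (y - v / io q * io q^`M(i))).
  rewrite opprB addrA subrK -sumrB; apply: qmod_sum => j _.
  by rewrite -mulrBl mulrC; apply: qmodMp; apply: hd.
have -> : y = io (subst s P)^`M(i) / io (subst s (Xw u)).
  rewrite chain_rule [X in _ = X / _]rmorph_sum mulr_suml; apply: eq_bigr => j _.
  by rewrite rmorphM mulrAC.
have -> : v = io (subst s P) / io (subst s (Xw u)) by rewrite -ev mulfK // evXw_neq0.
have [r er] := vP.
have [q0|q0] := eqVneq q 0.
  by rewrite er q0 mul0r mderiv0 rmorph0 !mul0r ?mulr0 subr0; apply: qmod0.
have -> : io (subst s P)^`M(i) / io (subst s (Xw u)) -
    io (subst s P) / io (subst s (Xw u)) / io q * io q^`M(i) =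
    io (q * r^`M(i)) / io (subst s (Xw u)).
  rewrite er mderivM rmorphD !rmorphM /=.
  move: (io q) (io_neq0 io_inj q0) (io (subst s (Xw u))) (evXw_neq0 u) => a a0 b b0.
  by field; rewrite a0 b0.
exact: qms_frac ut (dvdmm _ _).
Qed.

(** Two expressions of one section have proportional numerators, so the vanishing of the derivatives
    on Y passes from one to the other; for [v / q] the smoothness of Y is used again. *)
Lemma derivs_square t x psi v : derivs t x psi v -> square_sec t x ->
  (forall j, qms t (psi j)) /\ (q != 0 -> qms t (v / io q)).
Proof.
move=> [u [P [ut [hP vP] e ev hd]]] [u' [P' [ut' hP' [vP' dP'] e']]].
have E : P * Xw u' = P' * Xw u.
  by apply: io'_inj; rewrite !rmorphM -e -e'; ring.
have Es : subst s P * subst s (Xw u') = subst s P' * subst s (Xw u).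
  by rewrite -!substM E.
split.
  move=> j; apply: qmod_subr (hd j) _.
  have h : dvdm q (subst s P^`M(j) * subst s (Xw u')).
    have := congr1 (fun p => subst s p^`M(j)) E.
    rewrite /= !mderivM !substD !substM => /eqP; rewrite eq_sym -subr_eq => /eqP <-.
    apply: dvdmB; last exact: dvdmMr.
    by apply: dvdmD; apply: dvdmMr => //; apply: dP'.
  have -> : io (subst s P^`M(j)) / io (subst s (Xw u)) =
      io (subst s P^`M(j) * subst s (Xw u')) / io (subst s (Xw (u ++ u'))).
    rewrite Xw_cat substM !rmorphM.
    move: (evXw_neq0 u) (evXw_neq0 u') => a0 b0.
    rewrite invfM mulrACA divff // mulr1 //.
  by apply: qms_frac h => i; rewrite mem_cat => /orP[/ut|/ut'].
move=> q0; have [r' er'] := vP'.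
have [|r1 er1] := em_smooth em (r := r').
  move=> i; have : dvdm q ((subst s P')^`M(i)).
    by rewrite chain_rule; apply: dvdm_sum => j _; apply: dvdmMr; apply: dP'.
  rewrite er' mderivM => h; have := dvdmB h (dvdmm q r'^`M(i)).
  by rewrite addrK mulrC.
have er2 : r' = q * r1.
  by apply: (mulfI q0); rewrite er1 mulrA.
have -> : v / io q = io (q * r1) / io (subst s (Xw u')).
  have a0 := evXw_neq0 u; have b0 := evXw_neq0 u'; have iq0 := io_neq0 io_inj q0.
  apply: (mulIf a0); apply: (mulIf b0); apply: (mulIf iq0).
  have -> : v / io q * io (subst s (Xw u)) * io (subst s (Xw u')) * io q =
      (v * io (subst s (Xw u))) * io (subst s (Xw u')) * (io q / io q) by ring.
  rewrite divff // mulr1 ev -rmorphM Es er' er2 !rmorphM.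
  move: (io q) (io r1) (io (subst s (Xw u))) (io (subst s (Xw u'))) b0 => a b c d d0.
  by field.
exact: qms_frac ut' (dvdmm _ _).
Qed.

Lemma qms_lift t u p : {subset u <= t} -> qms t (io p / io (subst s (Xw u))) ->
  exists u', {subset u' <= t} /\ dvdm q (p * subst s (Xw u')).
Proof.
move=> ut [us [r [hus e]]].
have [w [wt ew]] : exists w, {subset w <= t} /\ us = map dv w.
  elim: us hus {e} => [|h us IH] hus; first by exists [::].
  have [|w [wt ew]] := IH; first by move=> h' h'u; apply: hus; rewrite inE h'u orbT.
  have /mapP[j jt ej] := hus h (mem_head _ _).
  exists (j :: w); split; last by rewrite /= -ej ew.
  by move=> i; rewrite inE => /orP[/eqP->|/wt].
exists w; split=> //; exists (r * subst s (Xw u)); apply: io_inj.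
rewrite ev_Xw -ew mulrA !rmorphM -[io q * io r]rmorphM -e.
move: (io _) (io (subst s (Xw u))) (evXw_neq0 u) => a b b0.
by rewrite mulrAC divfK.
Qed.

(** Each derivative becomes divisible by [q] after multiplication by some monomial; the product of
    these monomials is put into both numerator and denominator. *)
Lemma square_derivs t x psi v : derivs t x psi v -> (forall j, qms t (psi j)) ->
  square_sec t x.
Proof.
move=> [u [P [ut [hP vP] e ev hd]]] hpsi.
have H j : exists u', {subset u' <= t} /\ dvdm q (subst s P^`M(j) * subst s (Xw u')).
  apply: (qms_lift ut); have := qmodB (hpsi j) (hd j).
  by rewrite opprB addrCA subrr addr0.
have [w hw] := choice H.
pose w' := flatten [seq w j | j <- enum 'I_N.+1].
have wt : {subset w' <= t}.
  by move=> j /flattenP[v' /mapP[i _ ->]]; apply: (hw i).1.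
have hw' j : dvdm q (subst s P^`M(j) * subst s (Xw w')).
  have : j \in enum 'I_N.+1 by rewrite mem_enum.
  rewrite /w'; elim: (enum _) => [//|i l IH]; rewrite inE /= Xw_cat substM => /orP[/eqP<-|/IH h].
    by rewrite mulrA; apply: dvdmMr; apply: (hw j).2.
  by rewrite mulrCA; apply: dvdmM.
exists (u ++ w'), (P * Xw w'); split.
- by move=> j; rewrite mem_cat => /orP[/ut|/wt].
- by apply: whomog_eq (whomogM hP (@whomog_Xw w')) _; rewrite /= size_cat; lia.
- split=> [|j]; first by rewrite mulrC; apply: vanishesM.
  rewrite /vanishes mderivM substD !substM; apply: dvdmD; first exact: hw'.
  exact: dvdmMr.
- by rewrite Xw_cat !rmorphM -e; ring.
Qed.

(** Surjectivity of the Euler map over the open of [t], by clearing denominators. The case [t =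
    [::]], on global sections, is the one that dimension 2 requires. *)
Lemma loc_euler t (kappa : 'I_(em_r em) -> K) :
  (forall a, locs t D (kappa a)) -> exists kappa' : 'I_n -> K,
    (forall i, locs t (D - cox_wt i) (kappa' i)) /\
    forall a, \sum_i io ((lam a (cox_wt i))%:MP * 'X_i) * kappa' i = kappa a.
Proof.
move=> hk; have dt := denoms_dv em (t := t).
have [l hl] := eventually_ex (eventually_all (fun a => loc_den dt (hk a))).
have /choice[p hp] a : exists p, whomog (D *+ (size t * l).+1) p /\
    kappa a * io (prodh (map dv t)) ^+ l = io p.
  have [p hp e] := hl a; exists p; split=> //.
  by apply: whomog_eq hp _; rewrite degh_dv -mulrnA mulrS.
have [p' [hp' ep']] := em_euler (fun a => (hp a).1).
have P0 : io (prodh (map dv t)) != 0 by apply/(io_neq0 io_inj)/prodh_neq0.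
exists (fun i => io (p' i) / io (prodh (map dv t)) ^+ l); split.
  move=> i; have h : locs t (- degh (map dv t) *+ l) (io (prodh (map dv t)) ^+ l)^-1.
    rewrite -exprVn; apply: locX; exists (map dv t), 1; split=> //.
      by rewrite addNr; apply: whomog1.
    by rewrite mulVf // rmorph1.
  apply: locs_eq (locM (loc_poly io _ (hp' i)) h) _.
  by rewrite degh_dv mulNrn -mulrnA mulrS; zmod.
move=> a; apply: (mulIf (expf_neq0 l P0)); rewrite (hp a).2 -ep'.
rewrite mulr_suml [RHS]rmorph_sum; apply: eq_bigr => i _.
rewrite -mul_mpolyC (mulrA (lam a _)%:MP) [in RHS]rmorphM -[LHS]mulrA.
by rewrite divfK // expf_neq0.
Qed.

(** Local surjectivity of I(1) onto the kernel of Omega_P(1)|Y -> Omega_Y(1): the lifts on the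
    charts, brought to a common exponent [m], are glued by the cover of x_i0 <> 0. *)
Lemma lift_conormal t i0 (w : 'I_N.+1 -> K) (sg : K) : i0 \in t ->
  (forall j, locs t 0 (w j)) -> locs t (D - gq) sg ->
  qms t (\sum_j w j * io (s j)) ->
  (forall i, qms t (\sum_j w j * io (s j)^`M(i) - sg * io q^`M(i))) ->
  exists x psi v, [/\ ideal_sec t x, derivs t x psi v & forall j, qms t (psi j - w j)].
Proof.
move=> it hw hsg e1 e2; have dt := denoms_dv em (t := t).
have [l [hl1 [hl2 [hl3 hl4]]]] := eventually_ex (eventually_and (eventually_all (fun j => loc_den dt (hw j)))
  (eventually_and (loc_den dt hsg) (eventually_and (qmod_den dt e1)
  (eventually_all (fun i => qmod_den dt (e2 i)))))).
pose P := prodh (map dv t); pose e := (size t * l)%N.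
have P0 : io P ^+ l != 0 by apply/expf_neq0/(io_neq0 io_inj)/prodh_neq0.
have /choice[f hf] j : exists f, whomog (D *+ e) f /\ w j * io P ^+ l = io f.
  have [f hf ef] := hl1 j; exists f; split=> //.
  by apply: whomog_eq hf _; rewrite degh_dv -mulrnA add0r.
have [g hg eg] := hl2.
have {}hg : whomog (D *+ e + (D - gq)) g.
  by apply: whomog_eq hg _; rewrite degh_dv -mulrnA addrC.
have d1 : dvdm q (\sum_j f j * s j).
  have [r er] := hl3; exists r; apply: io_inj; rewrite -er mulr_suml [LHS]rmorph_sum.
  by apply: eq_bigr => j _; rewrite rmorphM -(hf j).2 mulrAC.
have d2 i : dvdm q (\sum_j f j * (s j)^`M(i) - g * q^`M(i)).
  have [r er] := hl4 i; exists r; apply: io_inj; rewrite -er rmorphB rmorphM -eg.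
  rewrite mulrBl mulr_suml [X in X - _ = _]rmorph_sum; congr (_ - _); last by rewrite mulrAC.
  by apply: eq_bigr => j _; rewrite rmorphM -(hf j).2 mulrAC.
have H (c : em_C em) := chart_lift_conormal io_inj c (fun j => (hf j).1) hg d1 d2.
have [M hM] := choice H; have [b hb] := choice hM.
pose m := (\max_c M c)%N.
have hb' (c : em_C em) := chart_lift_conormal_raise (leq_bigmax c : (M c <= m)%N)
  (let: And3 x _ _ := hb c in x) (let: And3 _ x _ := hb c in x)
  (let: And3 _ _ x := hb c in x).
have [a [Gc [hG vG]]] := em_cover_l0 em i0 m.
set b' := fun c => ch_l (em_chart em c) ^+ (m - M c) * b c in hb'.
pose Q := \sum_c Gc c * b' c.
(* The denominator: [a] copies of [i0] come from the cover, and [l] copies of [t] from the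
   denominators of [w] and [sg]. *)
pose u := nseq a i0 ++ flatten (nseq l t).
have ut : {subset u <= t}.
  move=> j; rewrite mem_cat => /orP[/nseqP[->//]|/flattenP[r /nseqP[-> _]]//].
have su : size u = (a + e)%N.
  rewrite size_cat size_nseq /e mulnC; congr (_ + _)%N.
  by elim: l {hl1 hl2 hl3 hl4 P0 e hf hg eg H M hM b hb m hb' hG vG b' Q u ut} => //= l' IH; rewrite size_cat IH mulSn.
have sXu : subst s (Xw u) = s i0 ^+ a * P ^+ l.
  rewrite /u Xw_cat substM; congr (_ * _).
    rewrite ev_Xw map_nseq prodh_nseq //.
  elim: (l) => [|l' IH]; first by rewrite /Xw big_nil expr0 -mpolyC1 substC.
  by rewrite /= Xw_cat substM IH exprS ev_Xw.
have hQ : homogR (size u).+1%:Z Q.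
  apply: whomog_sum => c _; have [h _ _] := hb' c.
  by apply: whomog_eq (whomogM (hG c) h) _; rewrite /= su; lia.
have vQ : vanishes Q.
  by apply: vanishes_sum => c _; apply: vanishesM; have [_ h _] := hb' c.
exists (io' Q / io' (Xw u)), (fun j => io (subst s Q^`M(j)) / io (subst s (Xw u))).
exists (io (subst s Q) / io (subst s (Xw u))); split.
- by exists u, Q; split=> //; rewrite divfK // Xw_neq0.
- exists u, Q; split=> //.
  + by rewrite divfK // Xw_neq0.
  + by rewrite divfK // evXw_neq0.
  + by move=> j; rewrite subrr; apply: qmod0.
move=> j.
have -> : w j = io (s i0 ^+ a * f j) / io (subst s (Xw u)).
  rewrite sXu !rmorphM !rmorphXn -(hf j).2.
  have i00 : io (s i0) ^+ a != 0 by apply/expf_neq0/(io_neq0 io_inj)/(em_s0 em).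
  move: (io P ^+ l) (io (s i0) ^+ a) P0 i00 => y y' y0 y0'.
  by field; rewrite y0 y0'.
rewrite -mulrBl -rmorphB; apply: (qms_frac ut).
have -> : Q^`M(j) = \sum_c (Gc c * b' c)^`M(j).
  exact: (big_morph _ (mderivD j) (mderiv0 k j)).
rewrite [X in dvdm _ (X - _)]subst_sum.
apply: (dvdm_trans (p' := (\sum_c subst s (Gc c) * ch_l0 (em_chart em c) ^+ m) * f j)).
  rewrite mulr_suml -sumrB; apply: dvdm_sum => c _; have [_ h1 h2] := hb' c.
  apply: dvdm_trans (ev_deriv_mul _ j h1) _.
  by rewrite -mulrA -mulrBr; apply: dvdmM.
by rewrite -mulrBl; apply: dvdmMr; apply: dvdm_subC.
Qed.

End Cochains.

(** * Vanishing of the top cohomology of the twisted conormal sheaf *)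

Section Vanishing.
Context {k : fieldType} {A : coxSpace k} {K K' : fieldType}.
Context (io : {rmorphism cox_ring A -> K}) (io_inj : injective io).
Local Notation S := (cox_ring A).
Local Notation G := (cox_grp A).
Local Notation n := (cox_var A).
Context (q : S) (gq D : G) (N : nat) (s : 'I_N.+1 -> S).
Local Notation R := (cox_ring (proj k N)).
Context (io' : {rmorphism R -> K'}) (io'_inj : injective io').
Context (em : embedding io q gq D s).
Local Notation locs := (locs io D s).
Local Notation qms := (qms io q D s).
Local Notation ideal_sec := (ideal_sec q s io').
Local Notation square_sec := (square_sec q s io').
Local Notation derivs := (derivs io q D s io').
Local Notation lam := (em_lam em).
Implicit Types (t u : seq 'I_N.+1).

Let locs_sg g : subgroups (fun t => locs t g).
Proof. exact: loc_subgroups (denom_dv em). Qed.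

Let locs_aug g : augments (fun t => locs t g).
Proof. exact: loc_augments. Qed.

Let qms_sg : subgroups (fun t => qms t).
Proof. by split=> [t|t x y]; [apply: qmod0|apply: qmodB]. Qed.

Let qms_aug : augments (fun t => qms t).
Proof.
move=> i t u x; apply: qmod_sub => h; rewrite !map_cat /= !mem_cat inE.
by case/orP=> ->; rewrite ?orbT.
Qed.

Let dl_locs g (f : seq 'I_N.+1 -> K) l :
  (forall t, size t = l -> locs t g (f t)) ->
  forall t, size t = l.+1 -> locs t g (dl f t).
Proof. by move=> h t; apply: (@dl_mem _ _ (fun t => locs t g) _ l). Qed.

Let dl_qms (f : seq 'I_N.+1 -> K) l :
  (forall t, size t = l -> qms t (f t)) ->
  forall t, size t = l.+1 -> qms t (dl f t).
Proof. by move=> h t; apply: (@dl_mem _ _ (fun t => qms t) _ l). Qed.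

Let dlM (a : K) (f : seq 'I_N.+1 -> K) t : dl (fun r => a * f r) t = a * dl f t.
Proof.
by rewrite [RHS](dl_is_additive (h := fun x => a * x)) // => x y; rewrite mulrBr.
Qed.

Let dlMr (a : K) (f : seq 'I_N.+1 -> K) t : dl (fun r => f r * a) t = dl f t * a.
Proof.
by rewrite [RHS](dl_is_additive (h := fun x => x * a)) // => x y; rewrite mulrBl.
Qed.

Let dl_derivs l (x : seq 'I_N.+1 -> K') (psi : seq 'I_N.+1 -> 'I_N.+1 -> K)
    (v : seq 'I_N.+1 -> K) :
  (forall t, size t = l -> derivs t (x t) (psi t) (v t)) ->
  forall t, size t = l.+1 ->
  derivs t (dl x t) (fun j => dl (psi^~ j) t) (dl v t).
Proof.
move=> h t st.
(* The section, its derivatives and its restriction are packed into one group, so that [dl_mem]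
   applies to [derivs] as a whole. *)
pose V : zmodType := (K' * ({ffun 'I_N.+1 -> K} * K))%type.
pose M t (y : V) := derivs t y.1 y.2.1 y.2.2.
pose f t : V := (x t, ([ffun j => psi t j], v t)).
have Mext t' x' (p p' : 'I_N.+1 -> K) v' : p =1 p' -> derivs t' x' p v' -> derivs t' x' p' v'.
  by move=> /funext ->.
have Msg : subgroups M.
  split=> [t'|t' y y'].
    exists [::], 0; split=> //.
    - by split; [apply: whomog0|rewrite /vanishes subst0; apply: dvdm0].
    - by rewrite mul0r rmorph0.
    - by rewrite mul0r subst0 rmorph0.
    - by move=> j; rewrite ffunE mderiv0 subst0 rmorph0 mul0r subrr; apply: qmod0.
  move=> h1 h2; apply: Mext (derivsB io_inj em h1 h2) => j.
  by rewrite /= !ffunE.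
have Maug : augments M.
  move=> i t' u y; apply: derivs_sub => j; rewrite !mem_cat inE.
  by case/orP=> ->; rewrite ?orbT.
have := dl_mem (f := f) (n := l) Msg Maug _ st.
have -> : M t (dl f t) <-> derivs t (dl x t) (fun j => dl (psi^~ j) t) (dl v t).
  rewrite /M.
  have -> : (dl f t).1 = dl x t by rewrite (dl_is_additive (h := fst)).
  have -> : (dl f t).2.2 = dl v t by rewrite (dl_is_additive (h := fun y : V => y.2.2)).
  have E j : (dl f t).2.1 j = dl (psi^~ j) t.
    rewrite (dl_is_additive (h := fun y : V => y.2.1 j)) => [|y y'].
      by apply: eq_dl => r _ /=; rewrite ffunE.
    by rewrite /= !ffunE.
  by split; apply: Mext => j; rewrite E.
apply=> r sr; apply: Mext (h r sr) => j; by rewrite ffunE.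
Qed.

Let acy g := em_acyclic em (g := g).

(** Lists of size [m.+3] carry the cochains of degree m + 2, the dimension of Y in the application.
    Forms are tuples of sections of line bundles: at each stage a primitive is taken coordinatewise,
    it fails a linear relation, and the defect is itself a cocycle, to be removed one degree
    lower. *)
Theorem conormal_acyclic m (z : seq 'I_N.+1 -> K') :
  (forall t, size t = m.+3 -> ideal_sec t (z t)) ->
  (forall t, size t = m.+4 -> square_sec t (dl z t)) ->
  exists y, (forall t, size t = m.+2 -> ideal_sec t (y t)) /\
            forall t, size t = m.+3 -> square_sec t (z t - dl y t).
Proof.
move=> zI zB.
have H0 t : exists p : ('I_N.+1 -> K) * K, size t = m.+3 ->
    [/\ derivs t (z t) p.1 p.2, forall j, locs t 0 (p.1 j), locs t D p.2 & qms t p.2].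
  have [st|st] := eqVneq (size t) m.+3; last first.
    by exists (fun=> 0, 0) => e; rewrite e eqxx in st.
  by have [psi [v h]] := derivs_exist io_inj em (zI t st); exists (psi, v).
have [pv hpv] := choice H0.
pose zeta t j := (pv t).1 j; pose V t := (pv t).2.
have zetaD t : size t = m.+3 -> derivs t (z t) (zeta t) (V t) by case/hpv.
have dzeta t : size t = m.+4 -> (forall j, qms t (dl (zeta^~ j) t)) /\
    (q != 0 -> qms t (dl V t / io q)).
  by move=> st; apply: (derivs_square io_inj io'_inj em (dl_derivs zetaD st) (zB t st)).
(* The derivatives [zeta] are cocycles of O_Y, because [dl z] has all its derivatives in the
   ideal. *)
have H1 j : exists w : seq 'I_N.+1 -> K, (forall t, size t = m.+2 -> locs t 0 (w t)) /\
    forall t, size t = m.+3 -> qms t (zeta t j - dl w t).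
  apply: (acy (Or41 _ _ _ erefl) (l := m.+2)) => t st; first by have [_ h _ _] := hpv t st; apply: h.
  exact: (dzeta t st).1.
have [w hw] := choice H1.
(* the w_j can be corrected so that \sum_j w_j x_j = 0 *)
pose x t := \sum_j io (s j) * w j t.
have lsj t j : locs t D (io (s j)) by apply/loc_poly/(em_s em).
have lsd t j i : locs t (D - cox_wt i) (io (s j)^`M(i)).
  by apply: loc_poly; apply: (@whomog_deriv _ A _ _ i (em_s em j)).
have dt t := @denoms_dv _ _ _ _ _ _ _ _ _ em t.
have [|t st|y [yM hy]] := acy (Or42 _ _ _ erefl) (l := m.+1) (z := x).
- move=> t st; apply: (loc_sum (dt t)) => j _.
  by apply: locs_eq (locM (lsj t j) ((hw j).1 t st)) _; rewrite addr0.
- have -> : dl x t = \sum_j io (s j) * zeta t j - \sum_j io (s j) * (zeta t j - dl (w j) t).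
    rewrite dl_sum -sumrB; apply: eq_bigr => j _.
    by rewrite dlM -mulrBr opprB addrCA subrr addr0.
  apply: qmodB; first exact: (derivs_euler io_inj em (zetaD t st)).
  by apply: qmod_sum => j _; apply: qmodMp; apply: (hw j).2.
(* The defect [y t] is carried by the first index of [t] alone, whose section is invertible on the
   open of [t]. *)
pose v j (t : seq 'I_N.+1) := if t is i :: _ then (if i == j then y t / io (s j) else 0) else 0.
have vs t : size t = m.+1 -> \sum_j io (s j) * v j t = y t.
  case: t => [|i t] // _; rewrite (bigD1 i) //= eqxx big1 ?addr0 => [|j /negPf ne].
    by rewrite mulrC divfK // (io_neq0 io_inj (em_s0 em i)).
  by rewrite eq_sym ne mulr0.
have vM j t : size t = m.+1 -> locs t 0 (v j t).
  case: t => [|i t] // st; rewrite /v; case: eqP => [<-|_]; last exact: loc0.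
  have h := locs_invX io_inj em 1 (mem_head i t).
  by apply: locs_eq (locM (yM _ st) h) _; rewrite mulr1n subrr.
pose w1 j t := w j t - dl (v j) t.
have w1M j t : size t = m.+2 -> locs t 0 (w1 j t).
  by move=> st; apply: (locB (dt t)); [apply: (hw j).1|apply: dl_locs st => // r; apply: vM].
have dw1 j t : dl (w1 j) t = dl (w j) t by rewrite dlB dl_dl subr0.
have w1s t : size t = m.+2 -> qms t (\sum_j w1 j t * io (s j)).
  move=> st; have -> : \sum_j w1 j t * io (s j) = x t - dl y t.
    rewrite /x -(eq_dl (f := fun r => \sum_j io (s j) * v j r)); last first.
      by move=> r; rewrite st => -[sr]; apply: vs.
    rewrite dl_sum -sumrB; apply: eq_bigr => j _.
    by rewrite dlM -mulrBr mulrC.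
  exact: hy.
(* Image of [w1] in the differentials of the ambient space of Y; its coboundary is [V / q] times
   dq. *)
pose eta i t := \sum_j w1 j t * io (s j)^`M(i).
have etaM i t : size t = m.+2 -> locs t (D - cox_wt i) (eta i t).
  move=> st; apply: (loc_sum (dt t)) => j _.
  by apply: locs_eq (locM (w1M j t st) (lsd t j i)) _; rewrite add0r.
have deta i t : size t = m.+3 -> qms t (dl (eta i) t - V t / io q * io q^`M(i)).
  move=> st; have -> : dl (eta i) t - V t / io q * io q^`M(i) =
    (\sum_j zeta t j * io (s j)^`M(i) - V t / io q * io q^`M(i)) -
    \sum_j io (s j)^`M(i) * (zeta t j - dl (w j) t).
    rewrite addrAC -sumrB dl_sum; congr (_ - _); apply: eq_bigr => j _.
    by rewrite dlMr dw1; ring.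
  apply: qmodB; first exact: (derivs_chain io_inj em _ (zetaD t st)).
  by apply: qmod_sum => j _; apply: qmodMp; apply: (hw j).2.
(* the defect of eta is supported by the conormal bundle of Y in its ambient space *)
have [sg [sgM hsg]] : exists sg, (forall t, size t = m.+2 -> locs t (D - gq) (sg t)) /\
    forall i t, size t = m.+3 -> qms t (dl (eta i) t - dl sg t * io q^`M(i)).
  have [q0|q0] := eqVneq q 0.
    exists (fun=> 0); split=> [t _|i t st]; first exact: loc0.
    by have := deta i t st; rewrite q0 mderiv0 rmorph0 !mulr0.
  have [|t st|sg [sgM hsg]] := acy (Or44 _ _ _ (conj q0 erefl)) (l := m.+2) (z := fun t => V t / io q).
  - move=> t st; have [_ _ h1 h2] := hpv t st.
    have [r hr er] := loc_qmod io_inj (em_q em) (dt t) h1 h2.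
    by rewrite /V er mulrAC divff ?mul1r // (io_neq0 io_inj q0).
  - by rewrite dlMr; apply: (dzeta t st).2.
  exists sg; split=> // i t st.
  have -> : dl (eta i) t - dl sg t * io q^`M(i) = (dl (eta i) t - V t / io q * io q^`M(i)) +
      io q^`M(i) * (V t / io q - dl sg t) by ring.
  by apply: qmodD; [apply: deta|apply: qmodMp; apply: hsg].
have lqd t i : locs t (gq - cox_wt i) (io q^`M(i)).
  by apply: loc_poly; apply: (@whomog_deriv _ A _ _ i (em_q em)).
(* Once the part along dq is removed, each coordinate is a cocycle of O_Y(D - w_i). *)
pose eta' i t := eta i t - sg t * io q^`M(i).
have H2 i : exists th : seq 'I_N.+1 -> K,
    (forall t, size t = m.+1 -> locs t (D - cox_wt i) (th t)) /\
    forall t, size t = m.+2 -> qms t (eta' i t - dl th t).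
  apply: (acy (Or43 _ _ _ (ex_intro _ i erefl)) (l := m.+1)) => t st.
    apply: (locB (dt t)); first exact: etaM.
    by apply: locs_eq (locM (sgM t st) (lqd t i)) _; zmod.
  by rewrite dlB dlMr; apply: hsg.
have [th hth] := choice H2.
pose co a i : S := (lam a (cox_wt i))%:MP * 'X_i.
have coM t a i : locs t (cox_wt i) (io (co a i)).
  apply: loc_poly; rewrite -[cox_wt i]add0r; apply: whomogM; first exact: whomogC.
  exact: whomogXi.
have coE a g p : whomog g p -> \sum_i io (co a i) * io p^`M(i) = io ((lam a g)%:MP * p).
  move=> hp; rewrite mul_mpolyC -(euler (@em_lamD _ _ _ _ _ _ _ _ _ em a) hp) [RHS]rmorph_sum.
  by apply: eq_bigr => i _; rewrite -rmorphM /co -mul_mpolyC mulrA.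
(* The primitives [th] need not satisfy the Euler relations; since [eta'] does, the defect [ep] is a
   cocycle of O_Y(D). *)
pose ep a t := \sum_i io (co a i) * th i t.
have H3 a : exists ka : seq 'I_N.+1 -> K, (forall t, size t = m -> locs t D (ka t)) /\
    forall t, size t = m.+1 -> qms t (ep a t - dl ka t).
  apply: (acy (Or42 _ _ _ erefl) (l := m)) => t st.
    apply: (loc_sum (dt t)) => i _.
    by apply: locs_eq (locM (coM t a i) ((hth i).1 t st)) _; zmod.
  have -> : dl (ep a) t = \sum_i io (co a i) * eta' i t -
      \sum_i io (co a i) * (eta' i t - dl (th i) t).
    rewrite -sumrB dl_sum; apply: eq_bigr => i _.
    by rewrite dlM -mulrBr opprB addrCA subrr addr0.
  apply: qmodB; last by apply: qmod_sum => i _; apply: qmodMp; apply: (hth i).2.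
  have -> : \sum_i io (co a i) * eta' i t = io (lam a D)%:MP * (\sum_j w1 j t * io (s j)) -
      sg t * io ((lam a gq)%:MP * q).
    rewrite -(coE a _ _ (em_q em)) !mulr_sumr.
    have -> : \sum_j io (lam a D)%:MP * (w1 j t * io (s j)) =
        \sum_i \sum_j io (co a i) * (w1 j t * io (s j)^`M(i)).
      rewrite exchange_big; apply: eq_bigr => j _ /=.
      rewrite mulrCA -rmorphM -(coE a _ _ (em_s em j)) mulr_sumr.
      by apply: eq_bigr => i _; rewrite mulrCA.
    rewrite -sumrB; apply: eq_bigr => i _; rewrite /eta' mulrBr mulr_sumr.
    by congr (_ - _); rewrite mulrCA.
  apply: qmodB; first by apply: qmodMp; apply: w1s.
  by apply: qmodM (sgM t st) _; apply: qmod_dvdm; apply: dvdmM; exists 1; rewrite mulr1.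
have [ka hka] := choice H3.
(* Surjectivity of the Euler map lifts the primitive of the defect; for [m = 0] this takes place on
   global sections. *)
have H4 t : exists ka' : 'I_n -> K, size t = m ->
    (forall i, locs t (D - cox_wt i) (ka' i)) /\
    forall a, \sum_i io (co a i) * ka' i = ka a t.
  have [st|st] := eqVneq (size t) m; last first.
    by exists (fun=> 0) => e; rewrite e eqxx in st.
  have [ka' h] := loc_euler io_inj (em := em) (fun a => (hka a).1 t st).
  by exists ka'.
have [ka' hka'] := choice H4.
pose th1 i t := th i t - dl (fun r => ka' r i) t.
have th1M i t : size t = m.+1 -> locs t (D - cox_wt i) (th1 i t).
  move=> st; apply: (locB (dt t)); first exact: (hth i).1.
  by apply: dl_locs st => r sr; apply: (hka' r sr).1.
have th1E a t : size t = m.+1 -> qms t (\sum_i io (co a i) * th1 i t).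
  move=> st; have -> : \sum_i io (co a i) * th1 i t = ep a t - dl (ka a) t.
    rewrite -(eq_dl (f := fun r => \sum_i io (co a i) * ka' r i)); last first.
      by move=> r; rewrite st => -[sr]; apply: (hka' r sr).2.
    by rewrite dl_sum -sumrB; apply: eq_bigr => i _; rewrite dlM mulrBr.
  exact: (hka a).2.
(* As [th1] satisfies the Euler relations, it lifts locally to differentials of P^N, up to a
   multiple of dq. *)
have H5 t : exists p : ('I_N.+1 -> K) * K, size t = m.+1 ->
    [/\ forall j, locs t 0 (p.1 j), locs t (D - gq) p.2,
        qms t (\sum_j p.1 j * io (s j)) &
        forall i, qms t (th1 i t - \sum_j p.1 j * io (s j)^`M(i) - p.2 * io q^`M(i))].
  have [st|st] := eqVneq (size t) m.+1; last first.
    by exists (fun=> 0, 0) => e; rewrite e eqxx in st.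
  case: t st => [|i0 t] // st.
  have [v' [sg' h]] := lift_form io_inj (em := em) (mem_head i0 t)
    (fun i => th1M i _ st) (fun a => th1E a _ st).
  by exists (v', sg').
have [vv hvv] := choice H5.
pose v' j t := (vv t).1 j; pose sg' t := (vv t).2.
(* [w2] has the same coboundary as [w1], and its image in the differentials of Y is now zero: it
   comes from the ideal. *)
pose w2 j t := w1 j t - dl (v' j) t; pose sg2 t := sg t + dl sg' t.
have w2M j t : size t = m.+2 -> locs t 0 (w2 j t).
  move=> st; apply: (locB (dt t)); first exact: w1M.
  by apply: dl_locs st => r sr; have [h _ _ _] := hvv r sr; apply: h.
have sg2M t : size t = m.+2 -> locs t (D - gq) (sg2 t).
  move=> st; apply: (locD (dt t)); first exact: sgM.
  by apply: dl_locs st => r sr; have [_ h _ _] := hvv r sr; apply: h.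
have w2s t : size t = m.+2 -> qms t (\sum_j w2 j t * io (s j)).
  move=> st; have -> : \sum_j w2 j t * io (s j) = \sum_j w1 j t * io (s j) -
      dl (fun r => \sum_j v' j r * io (s j)) t.
    by rewrite dl_sum -sumrB; apply: eq_bigr => j _; rewrite dlMr mulrBl.
  apply: qmodB; first exact: w1s.
  by apply: dl_qms st => r sr; have [_ _ h _] := hvv r sr.
have w2d i t : size t = m.+2 ->
    qms t (\sum_j w2 j t * io (s j)^`M(i) - sg2 t * io q^`M(i)).
  move=> st; have -> : \sum_j w2 j t * io (s j)^`M(i) - sg2 t * io q^`M(i) =
      (eta' i t - dl (th i) t) + dl (fun r => th1 i r -
        \sum_j v' j r * io (s j)^`M(i) - sg' r * io q^`M(i)) t.
    have -> : dl (fun r => th1 i r - \sum_j v' j r * io (s j)^`M(i) - sg' r * io q^`M(i)) t =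
        dl (th i) t - \sum_j dl (v' j) t * io (s j)^`M(i) - dl sg' t * io q^`M(i).
      rewrite dlB dlMr (dlB (th1 i)) dl_sum dlB dl_dl subr0.
      by congr (_ - _ - _); apply: eq_bigr => j _; rewrite dlMr.
    have -> : \sum_j w2 j t * io (s j)^`M(i) = eta i t - \sum_j dl (v' j) t * io (s j)^`M(i).
      by rewrite -sumrB; apply: eq_bigr => j _; rewrite mulrBl.
    by rewrite /eta' /sg2; ring.
  apply: qmodD; first exact: (hth i).2.
  by apply: dl_qms st => r sr; have [_ _ _ h] := hvv r sr; apply: h.
have H6 t : exists p : K' * (('I_N.+1 -> K) * K), size t = m.+2 ->
    [/\ ideal_sec t p.1, derivs t p.1 p.2.1 p.2.2 & forall j, qms t (p.2.1 j - w2 j t)].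
  have [st|st] := eqVneq (size t) m.+2; last first.
    by exists (0, (fun=> 0, 0)) => e; rewrite e eqxx in st.
  case: t st => [|i0 t] // st.
  have [y' [psi [v0 h]]] := lift_conormal io_inj io'_inj em (mem_head i0 t)
    (fun j => w2M j _ st) (sg2M _ st) (w2s _ st) (fun i => w2d i _ st).
  by exists (y', (psi, v0)).
have [pp hpp] := choice H6.
exists (fun t => (pp t).1); split=> t st; first by have [] := hpp t st.
have hD := dl_derivs (l := m.+2) (x := fun t => (pp t).1) (psi := fun t => (pp t).2.1)
  (v := fun t => (pp t).2.2) (fun r sr => let: And3 _ h _ := hpp r sr in h) st.
apply: (square_derivs io_inj em (derivsB io_inj em (zetaD t st) hD)) => j.
have -> : zeta t j - dl (fun r => (pp r).2.1 j) t = (zeta t j - dl (w j) t) -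
    dl (fun r => (pp r).2.1 j - w2 j r) t.
  by rewrite dlB [X in _ - (_ - X)]dlB dw1 dl_dl subr0; ring.
apply: qmodB; first exact: (hw j).2.
by apply: dl_qms st => r sr; have [_ _ h] := hpp r sr; apply: h.
Qed.

End Vanishing.

(** * Sheaves given by two ideals *)

Section Sections.
Context {k : fieldType} {N : nat} {K : fieldType}.
Local Notation P := (proj k N).
Local Notation R := (cox_ring P).
Context (io : {rmorphism R -> K}) (io_inj : injective io).
Local Notation homogR d p := (whomog (d : cox_grp P) (p : R)).
Local Notation Xw := (@Xw k N).
Implicit Types (J : R -> Prop) (U V : {set 'I_N.+1}) (w : seq 'I_N.+1) (x y : K).

Definition idealp J : Prop := [/\ J 0, forall p r, J p -> J r -> J (p + r) &
  forall r p, J p -> J (r * p)].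

Definition sec J U (g : int) x : Prop := exists w p,
  [/\ {subset w <= U}, J p, homogR (g + (size w)%:Z) p & x * io (Xw w) = io p].

Definition anyp : R -> Prop := fun=> True.

Lemma idealp_any : idealp anyp. Proof. by []. Qed.

Lemma Xw_neq w : io (Xw w) != 0. Proof. exact: Xw_neq0. Qed.

Lemma sec_sub J U V g x : U \subset V -> sec J U g x -> sec J V g x.
Proof.
move=> /subsetP UV [w [p [wU Jp hp e]]]; exists w, p; split=> //.
by move=> i /wU/UV.
Qed.

Lemma sec_imp J J' U g x : (forall p, J p -> J' p) -> sec J U g x -> sec J' U g x.
Proof. by move=> JJ [w [p [wU /JJ Jp hp e]]]; exists w, p. Qed.

Lemma sec_any J U g x : sec J U g x -> sec anyp U g x.
Proof. exact: sec_imp. Qed.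

Lemma sec_eq J U g h x : sec J U g x -> g = h -> sec J U h x.
Proof. by move=> hx <-. Qed.

Lemma sec_frac J U g w p : {subset w <= U} -> J p ->
  homogR (g + (size w)%:Z) p -> sec J U g (io p / io (Xw w)).
Proof.
by move=> wU Jp hp; exists w, p; split=> //; rewrite divfK // Xw_neq.
Qed.

Lemma sec_poly J U g p : J p -> homogR g p -> sec J U g (io p).
Proof.
move=> Jp hp; exists [::], p; split=> //; first by rewrite addr0.
by rewrite /Xw big_nil rmorph1 mulr1.
Qed.

Section Ideal.
Context (J : R -> Prop) (hJ : idealp J).

Lemma idealN p : J p -> J (- p).
Proof. by case: hJ => _ _ JM Jp; rewrite -mulN1r; apply: JM. Qed.

Lemma idealB p r : J p -> J r -> J (p - r).
Proof. by case: hJ => _ JD _ Jp Jr; apply/JD/idealN. Qed.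

Lemma sec0 U g : sec J U g 0.
Proof.
by rewrite -(rmorph0 io); apply: sec_poly; [case: hJ|apply: whomog0].
Qed.

Lemma secB U g x y : sec J U g x -> sec J U g y -> sec J U g (x - y).
Proof.
move=> [w [p [wU Jp hp e]]] [w' [p' [wU' Jp' hp' e']]]; case: hJ => _ _ JM.
exists (w ++ w'), (p * Xw w' - p' * Xw w); split.
- by move=> i; rewrite mem_cat => /orP[/wU|/wU'].
- by apply: idealB; rewrite mulrC; apply: JM.
- apply: whomogB.
    by apply: whomog_eq (whomogM hp (@whomog_Xw k N w')) _; rewrite /= size_cat; lia.
  by apply: whomog_eq (whomogM hp' (@whomog_Xw k N w)) _; rewrite /= size_cat; lia.
- by rewrite Xw_cat !rmorphB !rmorphM -e -e' /=; ring.
Qed.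

Lemma secN U g x : sec J U g x -> sec J U g (- x).
Proof. by rewrite -sub0r; apply/secB/sec0. Qed.

Lemma secD U g x y : sec J U g x -> sec J U g y -> sec J U g (x + y).
Proof. by rewrite -[y in x + y]opprK => hx hy; apply/secB/secN. Qed.

Lemma secM U g g' x y : sec anyp U g x -> sec J U g' y -> sec J U (g + g') (x * y).
Proof.
move=> [w [p [wU _ hp e]]] [w' [p' [wU' Jp' hp' e']]]; case: hJ => _ _ JM.
exists (w ++ w'), (p * p'); split.
- by move=> i; rewrite mem_cat => /orP[/wU|/wU'].
- exact: JM.
- by apply: whomog_eq (whomogM hp hp') _; rewrite /= size_cat; lia.
- by rewrite Xw_cat !rmorphM -e -e' /=; ring.
Qed.

(** The denominator of a section over V, divided by the power of ['X_c] of the same degree, is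
    regular on U and invertible on V; multiplying by it extends the section to U. *)
Lemma sec_extend U V g x c : c \in U -> U \subset V -> sec J V g x ->
  exists a b, [/\ sec anyp U 0 a, sec anyp V 0 b, a * b = 1 & sec J U g (a * x)].
Proof.
move=> cU /subsetP UV [w [p [wV Jp hp e]]].
pose w' := nseq (size w) c.
have w'U : {subset w' <= U} by move=> i /nseqP[-> _].
have sw' : size w' = size w by rewrite size_nseq.
exists (io (Xw w) / io (Xw w')), (io (Xw w') / io (Xw w)); split.
- by apply: sec_frac => //; rewrite add0r sw'; apply: whomog_Xw.
- by apply: sec_frac => //; rewrite add0r -sw'; apply: whomog_Xw.
- by rewrite mulrA divfK ?Xw_neq // divff // Xw_neq.
- have -> : io (Xw w) / io (Xw w') * x = io p / io (Xw w').
    by rewrite -e mulrC mulrA.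
  by apply: sec_frac; rewrite ?sw'.
Qed.

End Ideal.

End Sections.

Lemma frac_cancel (L : fieldType) (x r a : L) : r != 0 -> a != 0 ->
  x = r * (x * a) / (a * r).
Proof. by move=> r0 a0; field; rewrite r0 a0. Qed.

Lemma frac_square (L : fieldType) (w c a b x y : L) : x != 0 -> y != 0 ->
  w * (c * (a * b)) = c * (x * y) * (a / x * (b / y) * w).
Proof. by move=> x0 y0; field; rewrite x0 y0. Qed.

Lemma frac_small (L : fieldType) (f x a b w : L) : x != 0 -> a != 0 ->
  b != 0 -> w != 0 -> f / x = b * (a * (f * w)) / (w * (x * (a * b))).
Proof. by move=> x0 a0 b0 w0; field; rewrite x0 a0 b0 w0. Qed.

Lemma frac_gen (L : fieldType) (h g y a w : L) : y != 0 -> a != 0 -> w != 0 ->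
  h * (y^-1 / a / w) * (y * g) = h * g / (a * w).
Proof. by move=> y0 a0 w0; field; rewrite y0 a0 w0. Qed.

Lemma frac_diff (L : fieldType) (f b a w : L) : a != 0 -> w != 0 ->
  f - b / (a * w) = (a * (f * w) - b) / (a * w).
Proof. by move=> a0 w0; field; rewrite a0 w0. Qed.

Lemma frac_ratio (L : fieldType) (f x y : L) : x != 0 -> y != 0 ->
  f / x = f / y * (y / x).
Proof. by move=> x0 y0; field; rewrite x0 y0. Qed.

Lemma frac_sum (L : fieldType) (x y a b : L) :
  (x + y) * (a * b) = x * a * b + y * b * a.
Proof. by ring. Qed.

Lemma frac_mulB (L : fieldType) (x x' y y' : L) :
  x * x' - y * y' = x * (x' - y') + y' * (x - y).
Proof. by ring. Qed.

Lemma expfz_sub (L : fieldType) (x : L) (d : int) (a : nat) : x != 0 ->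
  x ^ (d - 1 - a%:Z) = (x ^ (1 - d))^-1 / x ^+ a.
Proof.
move=> x0; rewrite expfzDr // exprnN -invr_expz; congr (_ / _).
by rewrite invr_expz opprB.
Qed.

Definition iofr {k : fieldType} {A : coxSpace k} :
  {rmorphism cox_ring A -> cox_frac A} := @tofrac _.

Lemma iofr_inj (k : fieldType) (A : coxSpace k) : injective (@iofr k A).
Proof. by move=> p r /eqP; rewrite tofrac_eq => /eqP. Qed.

Section Conversion.
Context {k : fieldType} {N : nat}.
Local Notation P := (proj k N).
Local Notation R := (cox_ring P).
Local Notation Xw := (@Xw k N).
Implicit Types (U : {set cox_chart P}) (phi : cox_frac P).

Lemma xprodE U : xprod U = Xw (enum U).
Proof. by rewrite /xprod /Xw big_enum. Qed.

Lemma xdegE U : xdeg U = (size (enum U))%:Z.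
Proof.
rewrite /xdeg -big_enum; elim: (enum _) => [|i s IH]; first by rewrite big_nil.
by rewrite big_cons IH /= wdegU intS.
Qed.

Lemma Xw_flatten l w : Xw (flatten (nseq l w)) = Xw w ^+ l.
Proof.
elim: l => [|l IH]; first by rewrite /= /Xw big_nil.
by rewrite /= Xw_cat IH exprS.
Qed.

Lemma size_flatten_nseq (T : Type) l (w : seq T) :
  size (flatten (nseq l w)) = (size w * l)%N.
Proof. by elim: l => [|l IH] /=; rewrite ?muln0 // size_cat IH mulnS. Qed.

Lemma secP (J : R -> Prop) U (g : int) phi : idealp J ->
  (exists l p, [/\ J p, whomog ((g : cox_grp P) + xdeg U *+ l) p &
    phi = tofrac p / tofrac (xprod U) ^+ l]) <-> sec (@iofr _ P) J U g phi.
Proof.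
move=> hJ; split=> [[l [p [Jp hp ->]]]|[w [p [wU Jp hp e]]]].
  have -> : tofrac (xprod U) ^+ l = iofr (Xw (flatten (nseq l (enum U)))).
    by rewrite Xw_flatten xprodE rmorphXn.
  apply: (sec_frac (@iofr_inj k P)) => //.
    by move=> i /flattenP[w /nseqP[-> _]]; rewrite mem_enum.
  apply: whomog_eq hp _; rewrite /= xdegE size_flatten_nseq PoszM.
  by rewrite -mulr_natr natz.
pose h j : R * cox_grp P := ('X_j, 1 : int).
have dh : denoms (map h (enum U)).
  by move=> x /mapP[j _ ->]; apply: (@denom_var _ P j).
have pm v : prodh (map h v) = Xw v by rewrite /prodh big_map.
have dm v : degh (map h v) = (size v)%:Z.
  elim: v => [|j v IH]; first by rewrite /degh big_nil.
  by rewrite /= degh_cons IH intS.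
have wu : {subset map h w <= map h (enum U)}.
  by move=> x /mapP[j /wU jU ->]; apply: map_f; rewrite mem_enum.
have [r er hr] := prodh_dvd dh wu (leqnn _).
exists (size (map h w)), (r * p); case: (hJ) => _ _ JM; split; first exact: JM.
  apply: whomog_eq (whomogM hr hp) _; by rewrite dm xdegE dm; zmod.
have X0 := Xw_neq (@iofr_inj k P) w.
rewrite xprodE -pm -tofracXn -er -[tofrac (r * p)]/(iofr _) pm rmorphM -e.
rewrite -[tofrac _]/(iofr (Xw w * r)) rmorphM.
have r0 : iofr r != 0.
  apply: contraTneq isT => r0; have := prodh_neq0 dh.
  have /eqP : prodh (map h (enum U)) ^+ size (map h w) = 0.
    by rewrite -er; apply: (@iofr_inj k P); rewrite rmorphM r0 mulr0 rmorph0.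
  by rewrite expf_eq0 => /andP[_ /eqP->]; rewrite eqxx.
exact (frac_cancel phi r0 X0).
Qed.

Lemma idealp_subscheme (Y : subscheme P) : idealp Y.
Proof.
by split; [apply: equations0|apply: equationsD|apply: equationsM].
Qed.

Lemma itwistP (Y : subscheme P) U (g : int) phi :
  itwist Y U (g : cox_grp P) phi <-> sec (@iofr _ P) Y U g phi.
Proof. exact: secP (idealp_subscheme Y). Qed.

Lemma twistP U (g : int) phi :
  twist U (g : cox_grp P) phi <-> sec (@iofr _ P) (@anyp k N) U g phi.
Proof.
rewrite -secP; last exact: idealp_any.
by split=> [[l [p [hp e]]]|[l [p [_ hp e]]]]; exists l, p.
Qed.

End Conversion.

Record ideal_pair (k : fieldType) (N : nat) := IdealPair {
  big_ideal : subscheme (proj k N);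
  small_ideal : subscheme (proj k N);
  small_big : forall p, small_ideal p -> big_ideal p }.

Section QuotientSections.
Context {k : fieldType} {N : nat}.
Local Notation P := (proj k N).
Context (JJ : ideal_pair k N) (g : int).
Implicit Types (U V T : opens P) (phi psi : cox_frac P).

Definition bigs U phi := sec (@iofr _ P) (big_ideal JJ) (val U) g phi.
Definition smalls U phi := sec (@iofr _ P) (small_ideal JJ) (val U) g phi.

Lemma bigsB U phi psi : bigs U phi -> bigs U psi -> bigs U (phi - psi).
Proof. exact (fun hx hy => secB (idealp_subscheme _) hx hy). Qed.
Lemma smallsB U phi psi : smalls U phi -> smalls U psi -> smalls U (phi - psi).
Proof. exact (fun hx hy => secB (idealp_subscheme _) hx hy). Qed.
Lemma bigs0 U : bigs U 0.
Proof. exact (sec0 (@iofr _ P) (idealp_subscheme _) _ _). Qed.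
Lemma smalls0 U : smalls U 0.
Proof. exact (sec0 (@iofr _ P) (idealp_subscheme _) _ _). Qed.
Lemma bigsD U phi psi : bigs U phi -> bigs U psi -> bigs U (phi + psi).
Proof. exact (fun hx hy => secD (idealp_subscheme _) hx hy). Qed.
Lemma smallsD U phi psi : smalls U phi -> smalls U psi -> smalls U (phi + psi).
Proof. exact (fun hx hy => secD (idealp_subscheme _) hx hy). Qed.
Lemma bigsN U phi : bigs U phi -> bigs U (- phi).
Proof. exact (fun hx => secN (idealp_subscheme _) hx). Qed.
Lemma smallsN U phi : smalls U phi -> smalls U (- phi).
Proof. exact (fun hx => secN (idealp_subscheme _) hx). Qed.
Lemma smalls_bigs U phi : smalls U phi -> bigs U phi.
Proof. by apply: sec_imp; apply: small_big. Qed.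

Lemma regularE U (a : regular_ring U) : sec (@iofr _ P) (@anyp k N) (val U) 0 (val a).
Proof. by apply/twistP; apply/asboolP; apply: regularP. Qed.

Lemma bigsM U (a : regular_ring U) phi : bigs U phi -> bigs U (val a * phi).
Proof.
move=> h; have := secM (idealp_subscheme _) (regularE a) h.
by rewrite add0r.
Qed.
Lemma smallsM U (a : regular_ring U) phi : smalls U phi -> smalls U (val a * phi).
Proof.
move=> h; have := secM (idealp_subscheme _) (regularE a) h.
by rewrite add0r.
Qed.

(** The quotient of the big ideal sheaf by the small one is realized by chosen representatives, so
    that equality in [qsec] is equality of classes. *)
Definition qcan U phi : cox_frac P :=
  choose (fun psi => `[< smalls U (phi - psi) >]) phi.

Lemma qcanP U phi : smalls U (phi - qcan U phi).
Proof.
apply/asboolP; apply: (@chooseP _ (fun psi => `[< smalls U (phi - psi) >])).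
by apply/asboolP; rewrite subrr; apply: smalls0.
Qed.

Lemma qcan_eq U phi psi : smalls U (phi - psi) -> qcan U phi = qcan U psi.
Proof.
move=> h; rewrite /qcan.
rewrite (@eq_choose _ _ (fun x => `[< smalls U (psi - x) >])); last first.
  move=> x; apply: asbool_equiv_eq; split=> hx.
    by have := smallsB hx h; rewrite opprB addrAC addrCA subrr addr0 addrC.
  by have := smallsD h hx; rewrite addrA subrK.
apply: choose_id; apply/asboolP; last by rewrite subrr; apply: smalls0.
by rewrite -opprB; apply: smallsN.
Qed.

Lemma qcan_bigs U phi : bigs U phi -> bigs U (qcan U phi).
Proof.
move=> h; have := bigsB h (smalls_bigs (qcanP U phi)).
by rewrite opprB addrCA subrr addr0.
Qed.

Lemma qcan_id U phi : qcan U (qcan U phi) = qcan U phi.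
Proof. by apply/esym/qcan_eq/qcanP. Qed.

Record qsec U := QSec {
  qv : cox_frac P;
  qvP : `[< bigs U qv >] && (qcan U qv == qv) }.

HB.instance Definition _ U := [isSub of qsec U for @qv U].
HB.instance Definition _ U := [Choice of qsec U by <:].

Lemma qzero_subproof U :
  `[< bigs U (qcan U 0) >] && (qcan U (qcan U 0) == qcan U 0).
Proof. by rewrite qcan_id eqxx andbT; apply/asboolP/qcan_bigs/bigs0. Qed.

Definition qproj U phi : qsec U := insubd (QSec (qzero_subproof U)) (qcan U phi).

Lemma qv_bigs U (x : qsec U) : bigs U (qv x).
Proof. by case: x => x /= /andP[/asboolP]. Qed.

Lemma qprojP U phi : bigs U phi -> smalls U (qv (qproj U phi) - phi).
Proof.
move=> h; rewrite /qproj; have -> : qv (insubd (QSec (qzero_subproof U)) (qcan U phi)) = qcan U phi.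
  rewrite -[qv _]/(val _) insubdK // -topredE /= qcan_id eqxx andbT.
  exact/asboolP/qcan_bigs.
by rewrite -opprB; apply/smallsN/qcanP.
Qed.

Lemma qsec_eq U (x y : qsec U) : smalls U (qv x - qv y) -> x = y.
Proof.
move=> h; apply: val_inj => /=; case/andP: (qvP x) => _ /eqP <-.
by case/andP: (qvP y) => _ /eqP <-; apply: qcan_eq.
Qed.

(** Identities are checked on arbitrary representatives, and [repr_by_eq] brings them back to the
    quotient. *)
Definition repr_by U (x : qsec U) phi : Prop := smalls U (qv x - phi).

Lemma repr_by_qv U (x : qsec U) : repr_by x (qv x).
Proof. by rewrite /repr_by subrr; apply: smalls0. Qed.

Lemma repr_by_proj U phi : bigs U phi -> repr_by (qproj U phi) phi.
Proof. exact: qprojP. Qed.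

Lemma repr_by_trans U (x : qsec U) phi psi :
  repr_by x phi -> smalls U (phi - psi) -> repr_by x psi.
Proof. by move=> h h'; have := smallsD h h'; rewrite addrA subrK. Qed.

Lemma repr_by_eq U (x y : qsec U) phi : repr_by x phi -> repr_by y phi -> x = y.
Proof.
move=> hx hy; apply: qsec_eq; have := smallsB hx hy.
by rewrite opprB addrA subrK.
Qed.

Lemma repr_by_bigs U (x : qsec U) phi : repr_by x phi -> bigs U phi.
Proof.
move=> h; have := bigsB (qv_bigs x) (smalls_bigs h).
by rewrite opprB addrCA subrr addr0.
Qed.

Definition qadd U (x y : qsec U) : qsec U := qproj U (qv x + qv y).
Definition qopp U (x : qsec U) : qsec U := qproj U (- qv x).
Definition qzero U : qsec U := qproj U 0.
Definition qscale U (a : regular_ring U) (x : qsec U) : qsec U :=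
  qproj U (val a * qv x).

Lemma repr_add U (x y : qsec U) phi psi : repr_by x phi -> repr_by y psi ->
  repr_by (qadd x y) (phi + psi).
Proof.
move=> hx hy; apply: (repr_by_trans (qprojP (bigsD (qv_bigs x) (qv_bigs y)))).
by have := smallsD hx hy; rewrite addrACA -opprD.
Qed.

Lemma repr_opp U (x : qsec U) phi : repr_by x phi -> repr_by (qopp x) (- phi).
Proof.
move=> hx; apply: (repr_by_trans (qprojP (bigsN (qv_bigs x)))).
by have := smallsN hx; rewrite opprD.
Qed.

Lemma repr_zero U : repr_by (qzero U) 0.
Proof. exact: qprojP (bigs0 U). Qed.

Lemma repr_scale U a (x : qsec U) phi : repr_by x phi ->
  repr_by (qscale a x) (val a * phi).
Proof.
move=> hx; apply: (repr_by_trans (qprojP (bigsM a (qv_bigs x)))).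
by have := smallsM a hx; rewrite mulrBr.
Qed.

Lemma qaddA U : associative (@qadd U).
Proof.
move=> x y z; have h := repr_by_qv.
apply: (repr_by_eq (repr_add (h _ x) (repr_add (h _ y) (h _ z)))).
by rewrite addrA; apply: repr_add (repr_add _ _) _; apply: h.
Qed.

Lemma qaddC U : commutative (@qadd U).
Proof.
move=> x y; have h := repr_by_qv; apply: (repr_by_eq (repr_add (h _ x) (h _ y))).
by rewrite addrC; apply: repr_add.
Qed.

Lemma qadd0 U : left_id (qzero U) (@qadd U).
Proof.
move=> x; have h := repr_by_qv; apply: (repr_by_eq (repr_add (repr_zero U) (h _ x))).
by rewrite add0r.
Qed.

Lemma qaddN U : left_inverse (qzero U) (@qopp U) (@qadd U).
Proof.
move=> x; have h := repr_by_qv.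
apply: (repr_by_eq (repr_add (repr_opp (h _ x)) (h _ x))).
by rewrite addNr; apply: repr_zero.
Qed.

HB.instance Definition _ U :=
  GRing.isZmodule.Build (qsec U) (@qaddA U) (@qaddC U) (@qadd0 U) (@qaddN U).

Lemma qscaleA U (a b : regular_ring U) (x : qsec U) :
  qscale a (qscale b x) = qscale (a * b) x.
Proof.
have h := repr_by_qv; apply: (repr_by_eq (repr_scale a (repr_scale b (h _ x)))).
by rewrite mulrA -rmorphM; apply: repr_scale.
Qed.

Lemma qscale1 U : left_id 1 (@qscale U).
Proof.
move=> x; have h := repr_by_qv; apply: (repr_by_eq (repr_scale 1 (h _ x))).
by rewrite rmorph1 mul1r.
Qed.

Lemma qscaleDr U : right_distributive (@qscale U) +%R.
Proof.
move=> a x y; have h := repr_by_qv.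
apply: (repr_by_eq (repr_scale a (repr_add (h _ x) (h _ y)))).
by rewrite mulrDr; apply: repr_add; apply: repr_scale.
Qed.

Lemma qscaleDl U (x : qsec U) : {morph (@qscale U)^~ x : a b / a + b}.
Proof.
move=> a b; have h := repr_by_qv; apply: (repr_by_eq (repr_scale (a + b) (h _ x))).
by rewrite rmorphD mulrDl; apply: repr_add; apply: repr_scale.
Qed.

HB.instance Definition _ U :=
  GRing.Zmodule_isLmodule.Build (regular_ring U) (qsec U)
    (@qscaleA U) (@qscale1 U) (@qscaleDr U) (@qscaleDl U).

Lemma repr_sum U (I : Type) (r : seq I) (Q : pred I) (F : I -> qsec U) f :
  (forall i, Q i -> repr_by (F i) (f i)) ->
  repr_by (\sum_(i <- r | Q i) F i) (\sum_(i <- r | Q i) f i).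
Proof.
move=> h; apply: (big_ind2 (fun (x : qsec U) y => repr_by x y)) => //.
  exact: repr_zero.
by move=> x y x' y'; apply: repr_add.
Qed.

Definition qres U V (x : qsec U) : qsec V := qproj V (qv x).

Lemma bigs_sub U V phi : val U \subset val V -> bigs U phi -> bigs V phi.
Proof. exact: sec_sub. Qed.
Lemma smalls_sub U V phi : val U \subset val V -> smalls U phi -> smalls V phi.
Proof. exact: sec_sub. Qed.

Lemma repr_res U V (x : qsec U) phi : val U \subset val V -> repr_by x phi ->
  repr_by (qres V x) phi.
Proof.
move=> UV hx; apply: (repr_by_trans (qprojP (bigs_sub UV (qv_bigs x)))).
exact: smalls_sub hx.
Qed.

Lemma repr_0 U (x : qsec U) phi : repr_by x phi -> smalls U phi -> x = 0.
Proof.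
move=> hx h; apply: (repr_by_eq hx); apply: repr_by_trans (repr_zero U) _.
by rewrite sub0r; apply: smallsN.
Qed.

Lemma repr_0_smalls U phi : repr_by (0 : qsec U) phi -> smalls U phi.
Proof.
move=> h; have := smallsB (repr_zero U) h; rewrite subr0 opprB addrCA subrr addr0.
by [].
Qed.

Context (X : subscheme P).
Hypothesis killed : forall U (a : regular_ring U) phi,
  ideal_on X a -> bigs U phi -> smalls U (val a * phi).
Hypothesis finite : forall U, exists (n : nat) (f : 'I_n -> cox_frac P),
  (forall i, bigs U (f i)) /\ forall phi, bigs U phi ->
  exists a : 'I_n -> regular_ring U, smalls U (phi - \sum_i val (a i) * f i).

Lemma qresD U V (u v : qsec U) : val U \subset val V ->
  qres V (u + v) = qres V u + qres V v.
Proof.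
move=> UV; have h := repr_by_qv.
apply: (repr_by_eq (repr_res UV (repr_add (h _ u) (h _ v)))).
by apply: repr_add; apply: repr_res.
Qed.

Lemma qresZ U V (a : regular_ring U) (b : regular_ring V) (u : qsec U) :
  val U \subset val V -> val a = val b -> qres V (a *: u) = b *: qres V u.
Proof.
move=> UV ab; have h := repr_by_qv.
apply: (repr_by_eq (repr_res UV (repr_scale a (h _ u)))).
by rewrite ab; apply: repr_scale; apply: repr_res.
Qed.

Lemma qres_id U (u : qsec U) : qres U u = u.
Proof. exact: repr_by_eq (repr_res (subxx _) (repr_by_qv u)) (repr_by_qv u). Qed.

Lemma qres_comp U V T (u : qsec U) : val U \subset val V -> val V \subset val T ->
  qres T (qres V u) = qres T u.
Proof.
move=> UV VT; have h := repr_by_qv u.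
exact: (repr_by_eq (repr_res VT (repr_res UV h)) (repr_res (subset_trans UV VT) h)).
Qed.

Lemma mk_regular U phi : sec (@iofr _ P) (@anyp k N) (val U) 0 phi ->
  exists a : regular_ring U, val a = phi.
Proof.
move=> h; have hr : phi \in regular U by apply/asboolP/twistP.
by exists (Regular hr).
Qed.

Lemma qres_surj U V (v : qsec V) : val U \subset val V ->
  exists (a : regular_ring U) (b : regular_ring V) (u : qsec U),
    val a * val b = 1 /\ v = b *: qres V u.
Proof.
move=> UV; have /set0Pn[c cU] := valP U.
have [x [y [hx hy xy hxv]]] := sec_extend (@iofr_inj k P) cU UV (qv_bigs v).
have [a ea] := mk_regular hx; have [b eb] := mk_regular hy.
exists a, b, (qproj U (x * qv v)); rewrite ea eb; split; first exact: xy.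
apply: (repr_by_eq (repr_by_qv v)).
have := repr_scale b (repr_res UV (repr_by_proj hxv)).
by rewrite eb mulrA [y * x]mulrC xy mul1r.
Qed.

Lemma qres_ker U V (u : qsec U) : val U \subset val V -> qres V u = 0 ->
  exists (a : regular_ring U) (b : regular_ring V),
    val a * val b = 1 /\ a *: u = 0.
Proof.
move=> UV e; have /set0Pn[c cU] := valP U.
have hs : smalls V (qv u).
  by apply: repr_0_smalls; rewrite -e; apply: repr_res (repr_by_qv u).
have [x [y [hx hy xy hxv]]] := sec_extend (@iofr_inj k P) cU UV hs.
have [a ea] := mk_regular hx; have [b eb] := mk_regular hy.
exists a, b; rewrite ea eb; split; first exact: xy.
by apply: repr_0 (repr_scale a (repr_by_qv u)) _; rewrite ea.
Qed.

Lemma qsec_supp U (a : regular_ring U) (u : qsec U) : ideal_on X a -> a *: u = 0.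
Proof.
move=> ha; apply: repr_0 (repr_scale a (repr_by_qv u)) _.
exact: killed ha (qv_bigs u).
Qed.

Lemma qsec_fg U : exists (n : nat) (u : 'I_n -> qsec U),
  forall v, exists a : 'I_n -> regular_ring U, v = \sum_i a i *: u i.
Proof.
have [n [f [hf gf]]] := finite U; exists n, (fun i => qproj U (f i)) => v.
have [a ha] := gf _ (qv_bigs v); exists a.
apply: (repr_by_eq (repr_by_trans (repr_by_qv v) ha)).
by apply: repr_sum => i _; apply: repr_scale; apply: repr_by_proj.
Qed.

Definition quotient_sheaf : coherent X :=
  @Coherent _ _ X (fun U => qsec U : lmodType (regular_ring U)) qres
    qresD qresZ qres_id qres_comp qres_surj qres_ker qsec_supp qsec_fg.

End QuotientSections.

(** * Carpets *)

Lemma mderiv_wcomp (k : fieldType) (A : coxSpace k) g (p : cox_ring A) i :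
  (wcomp g p)^`M(i) = wcomp (g - cox_wt i) p^`M(i).
Proof.
apply/mpolyP => m; rewrite mcoeff_mderiv !wcompE !mcoeff_mfilter mcoeff_mderiv.
rewrite wdegD wdegU eq_sym -subr_eq eq_sym; case: ifP => // _.
by rewrite mul0rn.
Qed.

Section Carpets.
Context {k : fieldType} {A : coxSpace k}.
Context (q : cox_ring A) (gq D : cox_grp A) (N : nat) (s : 'I_N.+1 -> cox_ring A).
Local Notation P := (proj k N).
Local Notation R := (cox_ring P).
Context (em : embedding (@iofr k A) q gq D s).
Context (W Z : subscheme P).
Local Notation homogR d p := (whomog (d : cox_grp P) (p : R)).
Local Notation io := (@iofr k P).
Local Notation io_inj := (@iofr_inj k P).
Local Notation vanishes := (vanishes q s).
Hypothesis W_vanishes : forall (d : nat) F, homogR d%:Z F -> (W F <-> vanishes F).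
Hypothesis ZW : carpet W Z.
Implicit Types (U V : opens P).

Lemma W_vanishesz (d : int) F : homogR d F -> (W F <-> vanishes F).
Proof.
case: d => d hF; first exact: W_vanishes hF.
rewrite (whomog_neg hF) //; split=> _; last exact: equations0.
by rewrite /vanishes subst0; apply: dvdm0.
Qed.

Definition derived_eqs (p : R) : Prop := W p /\ forall j, W p^`M(j).

Lemma derived_eqs0 : derived_eqs 0.
Proof. by split=> [|j]; rewrite ?mderiv0; apply: equations0. Qed.

Lemma derived_eqsD p r : derived_eqs p -> derived_eqs r -> derived_eqs (p + r).
Proof.
move=> [hp dp] [hr dr]; split=> [|j]; first exact: equationsD.
by rewrite mderivD; apply: equationsD.
Qed.

Lemma derived_eqsM r p : derived_eqs p -> derived_eqs (r * p).
Proof.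
move=> [hp dp]; split=> [|j]; first exact: equationsM.
by rewrite mderivM; apply: equationsD; apply: equationsM.
Qed.

Lemma derived_eqs_wcomp g p : derived_eqs p -> derived_eqs (wcomp g p).
Proof.
move=> [hp dp]; split=> [|j]; first exact: equations_wcomp.
by rewrite mderiv_wcomp; apply: equations_wcomp.
Qed.

Definition derived : subscheme P :=
  Subscheme derived_eqs0 derived_eqsD derived_eqsM derived_eqs_wcomp.

Definition conormal_pair : ideal_pair k N :=
  @IdealPair k N W derived (fun p (h : derived p) => h.1).

Lemma derived_mul p r : W p -> W r -> derived (p * r).
Proof.
move=> hp hr; split=> [|j]; first exact: equationsM.
rewrite mderivM; apply: equationsD; first exact: equationsM.
by rewrite mulrC; apply: equationsM.
Qed.

Lemma sec_derived_mul (U : {set 'I_N.+1}) g g' x y :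
  sec io W U g x -> sec io W U g' y -> sec io derived U (g + g') (x * y).
Proof.
move=> [w [p [wU Jp hp e]]] [w' [p' [wU' Jp' hp' e']]].
exists (w ++ w'), (p * p'); split.
- by move=> i; rewrite mem_cat => /orP[/wU|/wU'].
- exact: derived_mul.
- by apply: whomog_eq (whomogM hp hp') _; rewrite /= size_cat; lia.
- by rewrite Xw_cat !rmorphM -e -e' mulrACA.
Qed.

Lemma derived_vanishes (d : nat) p : homogR d.+1%:Z p ->
  (derived p <-> vanishes p /\ forall j, vanishes p^`M(j)).
Proof.
move=> hp; have hd j : homogR d%:Z p^`M(j).
  by apply: whomog_eq (@whomog_deriv _ P _ _ j hp) _; rewrite /=; lia.
split=> -[h1 h2]; split; try exact/(W_vanishes hp); move=> j; exact/(W_vanishes (hd j)).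
Qed.

Lemma ideal_onP (Y : subscheme P) U (a : regular_ring U) :
  ideal_on Y a <-> sec io Y (val U) 0 (val a).
Proof. exact: itwistP. Qed.

Lemma carpet_sub U (a : regular_ring U) : ideal_on Z a -> ideal_on W a.
Proof. by move=> h; have [h1 _ _] := ZW U; apply/h1; exists 1%N; rewrite expr1. Qed.

Lemma Xj_frac i (d : nat) (p : R) (Y : subscheme P) : homogR d%:Z p -> Y p ->
  sec io Y [set i] 0 (io p / io ('X_i ^+ d)).
Proof.
move=> hp Yp; rewrite -(Xw_nseq d i); apply: (sec_frac io_inj) => //.
  by move=> j /nseqP[-> _]; rewrite inE.
by rewrite size_nseq add0r.
Qed.

(** The condition that the ideal of a carpet has square zero, read on forms: the power of ['X_i]
    clears the denominators of the chart. *)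
Lemma square_carpet i (p : R) : square q s p -> exists b, Z ('X_i ^+ b * p).
Proof.
elim=> [c a b d d' ha hb va vb|a b _ [x hx] _ [y hy]]; last first.
  exists (x + y)%N; rewrite mulrDr; apply: equationsD.
    by rewrite exprD mulrAC mulrC; apply: equationsM.
  by rewrite exprD -mulrA; apply: equationsM.
have Z0 : exists e, Z ('X_i ^+ e * 0) by exists 0%N; rewrite mulr0; apply: equations0.
case: d ha => d ha; last by rewrite (whomog_neg ha) // mul0r mulr0.
case: d' hb => d' hb; last by rewrite (whomog_neg hb) // !mulr0.
have [_ hmul _] := ZW (@open1 k P i).
have Wa := (W_vanishes ha).2 va; have Wb := (W_vanishes hb).2 vb.
have sa := Xj_frac i ha Wa; have sb := Xj_frac i hb Wb.
have [ra ea] := mk_regular (U := @open1 k P i) (sec_any sa).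
have [rb eb] := mk_regular (U := @open1 k P i) (sec_any sb).
have /ideal_onP : ideal_on Z (ra * rb).
  by apply: hmul; apply/ideal_onP; rewrite ?ea ?eb.
rewrite rmorphM /= [regular_val ra]ea [regular_val rb]eb => -[w [r [wi Zr _ e]]].
exists (size w); have -> : 'X_i ^+ size w * (c * (a * b)) = c * 'X_i ^+ (d + d') * r; last exact: equationsM.
have eX : 'X_i ^+ size w = Xw w :> R.
  elim: w wi {e} => [|j w IH] wi; first by rewrite /Xw big_nil.
  have := wi j (mem_head _ _); rewrite inE => /eqP->.
  rewrite /Xw big_cons /= exprS IH // => j' jw; apply: wi.
  by rewrite inE jw orbT.
have X0 (l : nat) : io ('X_i ^+ l) != 0.
  by apply/(io_neq0 io_inj)/expf_neq0/(@mpolyX_neq0 _ P).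
apply: io_inj; rewrite eX !rmorphM -e exprD rmorphM.
exact (frac_square _ _ _ _ (X0 d) (X0 d')).
Qed.

(** This makes a |-> (a / x_i) e_i well defined modulo [derived]: by smoothness a form of [derived]
    is locally in the square of the ideal of W, hence in the ideal of Z. *)
Lemma small_carpet U i phi : i \in val U -> smalls conormal_pair 1 U phi ->
  sec io Z (val U) 0 (phi / io 'X_i).
Proof.
move=> iU [w [p [wU hdp hp e]]].
have {}hp : homogR (size w).+1%:Z p by apply: whomog_eq hp _; rewrite intS.
have [vp dvp] := (derived_vanishes hp).1 hdp.
have [a /(square_carpet i)[b hb]] := vanishes_square (@iofr_inj k A) em hp vp dvp i.
have X0 := io_neq0 io_inj (@mpolyX_neq0 _ P U_(i)%MM).
have -> : phi / io 'X_i = io ('X_i ^+ b * ('X_i ^+ a * p)) / io (Xw (w ++ nseq (a + b).+1 i)).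
  rewrite Xw_cat Xw_nseq exprS exprD !rmorphM -e.
  have Xn d : io ('X_i ^+ d) != 0 by rewrite rmorphXn; exact (expf_neq0 d X0).
  exact (frac_small phi X0 (Xn a) (Xn b) (Xw_neq io_inj w)).
apply: (sec_frac io_inj) => //.
  by move=> j; rewrite mem_cat => /orP[/wU|/nseqP[->]].
have h := whomogM (whomogXj i b) (whomogM (whomogXj i a) hp).
by apply: whomog_eq h _; rewrite size_cat size_nseq /=; lia.
Qed.

Lemma conormal_killed U (a : regular_ring U) phi : ideal_on Z a ->
  bigs conormal_pair 1 U phi -> smalls conormal_pair 1 U (val a * phi).
Proof.
move=> /carpet_sub/ideal_onP ha hphi.
have := sec_derived_mul ha hphi; by rewrite add0r.
Qed.

Lemma sec_Xpow U i (d : int) : i \in val U -> sec io (@anyp k N) (val U) d (io 'X_i ^ d).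
Proof.
move=> iU; case: d => d.
  rewrite -exprnP -rmorphXn; apply: sec_poly => //; exact: whomogXj.
exists (nseq d.+1 i), 1; split=> //.
- by move=> j /nseqP[->].
- rewrite size_nseq NegzE addNr; apply: whomog1.
- rewrite Xw_nseq.
  have X0 := io_neq0 io_inj (@mpolyX_neq0 _ P U_(i)%MM).
  by rewrite rmorphXn rmorph1; exact (mulVf (expf_neq0 d.+1 X0)).
Qed.

Lemma square_wcomp (d : int) p : square q s p ->
  square q s (wcomp (d : cox_grp P) p).
Proof.
elim=> [c a b e e' ha hb va vb|a b _ ha _ hb]; last first.
  by rewrite wcompD; apply: square_add.
rewrite (wcompM _ _ (whomogM ha hb)); exact: square_gen ha hb va vb.
Qed.

(** The [conormal_gen] are brought to degree 1 by powers of ['X_i0], where [i0] is any index of the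
    open set. *)
Lemma conormal_finite U : exists (n : nat) (f : 'I_n -> cox_frac P),
  (forall i, bigs conormal_pair 1 U (f i)) /\
  forall phi, bigs conormal_pair 1 U phi -> exists a : 'I_n -> regular_ring U,
    smalls conormal_pair 1 U (phi - \sum_i val (a i) * f i).
Proof.
have /set0Pn[i0 iU] := valP U.
pose T : finType := (em_C em * option 'I_N.+1)%type.
pose f (x : T) := io 'X_i0 ^ (1 - conormal_deg x) * io (conormal_gen x).
have hf (x : T) : bigs conormal_pair 1 U (f x).
  have [hd vd] := conormal_genP (@iofr_inj k A) x.
  have hW : W (conormal_gen x) := (W_vanishesz hd).2 vd.
  have h1 := sec_Xpow (1 - conormal_deg x) iU.
  have h2 := sec_poly io (val U) hW hd.
  by have := secM (idealp_subscheme W) h1 h2; rewrite subrK.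
exists #|T|, (fun i => f (enum_val i)); split=> [i|phi]; first exact: hf.
move=> [w [p [wU Wp hp e]]].
have {}hp : homogR (size w).+1%:Z p by apply: whomog_eq hp _; rewrite intS.
have vp := (W_vanishes hp).1 Wp.
have [a [h hs]] := vanishes_gen (@iofr_inj k A) em hp vp i0.
pose d : int := (a + (size w).+1)%N%:Z.
have hXp : homogR d ('X_i0 ^+ a * p) by exact: whomogM (whomogXj i0 a) hp.
pose h' x := wcomp ((d - conormal_deg x) : cox_grp P) (h x).
have {}hs : square q s ('X_i0 ^+ a * p - \sum_x h' x * conormal_gen x).
  have := square_wcomp d hs; rewrite wcompB wcomp_homog // wcomp_sum.
  rewrite (eq_bigr (fun x => h' x * conormal_gen x)) // => x _.
  by rewrite (wcompM _ _ (conormal_genP (@iofr_inj k A) x).1).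
have X0 := io_neq0 io_inj (@mpolyX_neq0 _ P U_(i0)%MM).
(* The exponent undoes the power of ['X_i0] in [f x] and the factor ['X_i0 ^+ a]; the coefficient
   then has degree 0. *)
pose c x := io (h' x) * (io 'X_i0 ^ (conormal_deg x - 1 - a%:Z) / io (Xw w)).
have hc x : sec io (@anyp k N) (val U) 0 (c x).
  have h1 : sec io (@anyp k N) (val U) (d - conormal_deg x) (io (h' x)).
    by apply: sec_poly => //; apply: whomog_wcomp.
  have h2 := sec_Xpow (conormal_deg x - 1 - a%:Z) iU.
  have h3 : sec io (@anyp k N) (val U) (- (size w)%:Z) (io (Xw w))^-1.
    exists w, 1; split=> //; first by rewrite addNr; apply: whomog1.
    by rewrite rmorph1; exact (mulVf (Xw_neq io_inj w)).
  have := secM idealp_any h1 (secM idealp_any h2 h3).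
  by move=> hh; apply: sec_eq hh _; rewrite /d; lia.
have /choice[r hr] x : exists r : regular_ring U, val r = c x := mk_regular (hc x).
exists (fun i => r (enum_val i)).
have -> : \sum_(i < #|T|) val (r (enum_val i)) * f (enum_val i) = \sum_x c x * f x.
  rewrite (eq_bigr (fun i => c (enum_val i) * f (enum_val i))); last by move=> i _; rewrite hr.
  rewrite [RHS](reindex (@enum_val T T)) //.
  exact/onW_bij/enum_val_bij.
have ecf x : c x * f x = io (h' x * conormal_gen x) / (io 'X_i0 ^+ a * io (Xw w)).
  rewrite /c /f rmorphM /=.
  have -> : io 'X_i0 ^ (conormal_deg x - 1 - a%:Z) = (io 'X_i0 ^ (1 - conormal_deg x))^-1 / io 'X_i0 ^+ a.
    exact (expfz_sub _ _ X0).
  have Y0 : io 'X_i0 ^ (1 - conormal_deg x) != 0 by rewrite expfz_neq0.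
  exact (frac_gen _ _ Y0 (expf_neq0 a X0) (Xw_neq io_inj w)).
have -> : phi - \sum_x c x * f x = io ('X_i0 ^+ a * p - \sum_x h' x * conormal_gen x) / io (Xw (nseq a i0 ++ w)).
  rewrite (eq_bigr _ (fun x _ => ecf x)) -mulr_suml -rmorph_sum rmorphB.
  have eX : io (Xw (nseq a i0 ++ w)) = io 'X_i0 ^+ a * io (Xw w).
    by rewrite Xw_cat rmorphM Xw_nseq rmorphXn.
  rewrite eX [io ('X_i0 ^+ a * p)]rmorphM -e [io ('X_i0 ^+ a)]rmorphXn.
  exact (frac_diff _ _ (expf_neq0 a X0) (Xw_neq io_inj w)).
have hS : homogR d ('X_i0 ^+ a * p - \sum_x h' x * conormal_gen x).
  apply: whomogB => //; apply: whomog_sum => x _.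
  have hh := whomogM (@whomog_wcomp _ P (d - conormal_deg x) (h x)) (conormal_genP (@iofr_inj k A) x).1.
  by apply: whomog_eq hh _; rewrite subrK.
apply: (sec_frac io_inj).
- by move=> j; rewrite mem_cat => /orP[/nseqP[-> _]|/wU].
- apply/(@derived_vanishes (a + size w)); last exact: square_vanishes.
  by apply: whomog_eq hS _; rewrite /d addnS.
- by apply: whomog_eq hS _; rewrite /d size_cat size_nseq; lia.
Qed.

Definition conormal_sheaf : coherent Z :=
  quotient_sheaf (@conormal_killed) conormal_finite.

End Carpets.

(** * Cech cochains on lists and on tuples of charts *)

Lemma dlE (I : Type) (V : pzRingType) (f : seq I -> V) t :
  dl f t = \sum_(i < size t) (-1) ^+ i * f (take i t ++ drop i.+1 t).
Proof.
elim: t f => [|i t IH] f /=; first by rewrite big_ord0.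
rewrite big_ord_recl /= drop0 expr0 mul1r IH -sumrN; congr (_ + _).
by apply: eq_bigr => j _; rewrite exprS mulN1r mulNr.
Qed.

Section Codom.
Context {I : finType} (i0 : I).

Definition ffun_of_seq p (r : seq I) : {ffun 'I_p -> I} := [ffun j : 'I_p => nth i0 r j].

Lemma codom_ffun_of_seq p (r : seq I) : size r = p -> codom (@ffun_of_seq p r) = r.
Proof.
move=> sr; apply: (@eq_from_nth _ i0) => [|i]; rewrite size_codom card_ord //.
move=> ip; rewrite (nth_codom i0 _ (cast_ord (esym (card_ord p)) (Ordinal ip))).
by rewrite ffunE /= enum_val_ord.
Qed.

Lemma ffun_of_codom p (t : {ffun 'I_p -> I}) : ffun_of_seq p (codom t) = t.
Proof.
apply/ffunP => j; rewrite ffunE.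
have e := nth_codom i0 t (cast_ord (esym (card_ord p)) j).
by rewrite /= in e; rewrite e enum_val_ord cast_ordKV.
Qed.

Lemma codom_face p (t : {ffun 'I_p.+1 -> I}) (i : 'I_p.+1) :
  codom [ffun j : 'I_p => t (lift i j)] = take i (codom t) ++ drop i.+1 (codom t).
Proof.
have st : size (codom t) = p.+1 by rewrite size_codom card_ord.
have nt (j : 'I_p.+1) : nth i0 (codom t) j = t j.
  by rewrite -[in RHS](ffun_of_codom t) ffunE.
have ip := ltn_ord i; have sz : size (take i (codom t) ++ drop i.+1 (codom t)) = p.
  by rewrite size_cat size_take size_drop st ip; lia.
rewrite -(codom_ffun_of_seq sz); congr (codom (_ : {ffun _ -> _})).
apply/ffunP => j; rewrite !ffunE nth_cat size_take st ip -nt /= /bump.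
have [ji|ij] := ltnP j i; first by rewrite nth_take // leqNgt ji.
by rewrite nth_drop add1n addSn subnKC.
Qed.

End Codom.

Section Dualizing.
Context {k : fieldType} {A : coxSpace k}.
Context (q : cox_ring A) (gq D : cox_grp A) (N : nat) (s : 'I_N.+1 -> cox_ring A).
Local Notation P := (proj k N).
Local Notation R := (cox_ring P).
Context (em : embedding (@iofr k A) q gq D s).
Context (W Z : subscheme P).
Local Notation homogR d p := (whomog (d : cox_grp P) (p : R)).
Local Notation io := (@iofr k P).
Local Notation io_inj := (@iofr_inj k P).
Local Notation vanishes := (vanishes q s).
Hypothesis W_vanishes : forall (d : nat) F, homogR d%:Z F -> (W F <-> vanishes F).
Hypothesis ZW : carpet W Z.
Implicit Types (U V : opens P).
Local Notation FZ := (conormal_sheaf em W_vanishes ZW).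
Local Notation pair := (conormal_pair W).

Lemma bigs_openT p (t : {ffun 'I_p.+1 -> cox_chart P}) phi :
  bigs pair 1 (openT t) phi <-> ideal_sec q s io (codom t) phi.
Proof.
split=> -[w [r [wt]]].
  move=> Wr hr e; exists w, r.
  have {}hr : homogR (size w).+1%:Z r by apply: whomog_eq hr _; rewrite intS.
  split=> //; last exact/(W_vanishes hr).
  by move=> i /wt /imsetP[j _ ->]; apply: codom_f.
move=> hr vr e; exists w, r; split; last exact: e.
- by move=> i /wt /codomP[j ->]; apply: imset_f.
- exact/(W_vanishes hr).
- by apply: whomog_eq hr _; rewrite intS.
Qed.

Lemma smalls_openT p (t : {ffun 'I_p.+1 -> cox_chart P}) phi :
  smalls pair 1 (openT t) phi <-> square_sec q s io (codom t) phi.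
Proof.
split=> -[w [r [wt]]].
  move=> Wr hr e; exists w, r.
  have {}hr : homogR (size w).+1%:Z r by apply: whomog_eq hr _; rewrite intS.
  split=> //; last exact/(derived_vanishes W_vanishes hr).
  by move=> i /wt /imsetP[j _ ->]; apply: codom_f.
move=> hr vr e; exists w, r; split; last exact: e.
- by move=> i /wt /codomP[j ->]; apply: imset_f.
- exact/(derived_vanishes W_vanishes hr).
- by apply: whomog_eq hr _; rewrite intS.
Qed.

Definition list_cochain p (z : cochain FZ p) (r : seq 'I_N.+1) : cox_frac P :=
  qv (z (ffun_of_seq ord0 p.+1 r) : qsec pair 1 _).

Lemma repr_cech p (z : cochain FZ p) f t :
  (forall t', repr_by (z t' : qsec pair 1 _) (f (codom t'))) ->
  repr_by (cech_d z t : qsec pair 1 _) (dl f (codom t)).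
Proof.
move=> hz; rewrite dlE size_codom card_ord.
have -> : \sum_(i < p.+2) (-1) ^+ i * f (take i (codom t) ++ drop i.+1 (codom t)) =
    \sum_(i < p.+2) val ((-1) ^+ i : regular_ring (openT t)) * f (codom [ffun j => t (lift i j)]).
  apply: eq_bigr => i _; rewrite (codom_face ord0) rmorphXn rmorphN1 //.
apply: repr_sum => i _; apply: repr_scale; apply: repr_res => //.
by apply/subsetP => x /imsetP[j _ ->]; rewrite ffunE; apply: imset_f.
Qed.

(** A tuple of charts is read as the list of its values, and [conormal_acyclic] is applied to
    representatives of the values of the cochain. *)
Lemma conormal_coboundary m (z : cochain FZ m.+2) : cocycle z ->
  exists y : cochain FZ m.+1, forall t, z t = cech_d y t.
Proof.
move=> cz.
have zE t : qv (z t : qsec pair 1 _) = list_cochain z (codom t).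
  by rewrite /list_cochain ffun_of_codom.
have zr t : repr_by (z t : qsec pair 1 _) (list_cochain z (codom t)).
  by rewrite -zE; apply: repr_by_qv.
have [r sr|r sr|y [hy hz]] := conormal_acyclic (@iofr_inj k A) io_inj em (m := m) (z := list_cochain z).
- by rewrite -(codom_ffun_of_seq ord0 sr) -zE; apply/bigs_openT/qv_bigs.
- rewrite -(codom_ffun_of_seq ord0 sr); apply/smalls_openT.
  apply: (@repr_0_smalls _ _ pair 1); have := repr_cech (ffun_of_seq ord0 _ r) zr.
  by rewrite cz.
have yr (t : {ffun 'I_m.+2 -> cox_chart P}) : repr_by (qproj pair 1 (openT t) (y (codom t))) (y (codom t)).
  by apply: repr_by_proj; apply/bigs_openT/hy; rewrite size_codom card_ord.
exists (fun t => qproj pair 1 (openT t) (y (codom t))) => t.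
apply: repr_by_eq (repr_cech t yr); apply: repr_by_trans (zr t) _.
by apply/smalls_openT/hz; rewrite size_codom card_ord.
Qed.

End Dualizing.

(** * The morphism from the conormal sheaf to the dualizing sheaf *)

Section Canonical.
Context {k : fieldType} {A : coxSpace k}.
Context (q : cox_ring A) (gq D : cox_grp A) (N : nat) (s : 'I_N.+1 -> cox_ring A).
Local Notation P := (proj k N).
Local Notation R := (cox_ring P).
Context (em : embedding (@iofr k A) q gq D s).
Context (W Z : subscheme P).
Local Notation homogR d p := (whomog (d : cox_grp P) (p : R)).
Local Notation io := (@iofr k P).
Local Notation io_inj := (@iofr_inj k P).
Local Notation vanishes := (vanishes q s).
Hypothesis W_vanishes : forall (d : nat) F, homogR d%:Z F -> (W F <-> vanishes F).
Hypothesis not_nilpotent : ~ forall j, exists l, dvdm q (s j ^+ l).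
Hypothesis ZW : carpet W Z.
Implicit Types (U V : opens P).
Local Notation FZ := (conormal_sheaf em W_vanishes ZW).
Local Notation pair := (conormal_pair W).

Context (L : coherent Z) (e : forall i : cox_chart P, L (open1 i)).
Hypothesis e_gen : forall (i j : cox_chart P) (a : regular_ring (open2 i j)),
  val a = @xratio k N i j -> res (open2 i j) (e j) = a *: res (open2 i j) (e i).

Let Xi_neq0 i : io 'X_i != 0.
Proof. exact (io_neq0 io_inj (@mpolyX_neq0 _ P U_(i)%MM)). Qed.

Lemma valM U (a b : regular_ring U) : val (a * b) = val a * val b.
Proof. exact (rmorphM val a b). Qed.

Lemma valB U (a b : regular_ring U) : val (a - b) = val a - val b.
Proof. exact (rmorphB val a b). Qed.

Lemma valD U (a b : regular_ring U) : val (a + b) = val a + val b.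
Proof. exact (rmorphD val a b). Qed.

Lemma open1_sub i U : i \in val U -> val (@open1 k P i) \subset val U.
Proof. by rewrite sub1set. Qed.

(** Independence of (phi / x_i) e_i from the index, since e_j = (x_j / x_i) e_i. *)
Lemma frame_change U i j (a b : regular_ring U) phi : i \in val U -> j \in val U ->
  val a = phi / io 'X_i -> val b = phi / io 'X_j ->
  a *: res U (e i) = b *: res U (e j).
Proof.
move=> iU jU ea eb.
have U12 : val (@open2 k P i j) \subset val U by rewrite subUset !sub1set iU.
have jO : val (@open1 k P j) \subset val (@open2 k P i j) by rewrite sub1set set22.
have iO : val (@open1 k P i) \subset val (@open2 k P i j) by rewrite sub1set set21.
have hc (T : opens P) : i \in val T -> sec io (@anyp k N) (val T) 0 (@xratio k N i j).
  move=> iT; exists [:: i], 'X_j; split=> //.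
  - by move=> i'; rewrite inE => /eqP->.
  - by have := @whomogXi _ P j.
  - by rewrite /Xw big_seq1; exact (divfK (Xi_neq0 i) _).
have [c ec] := mk_regular (hc (open2 i j) (set21 i j)).
have [d ed] := mk_regular (hc U iU).
have -> : res U (e j) = d *: res U (e i).
  rewrite -(res_comp _ jO U12) (e_gen ec) (resZ (b := d)) ?res_comp //.
  by rewrite ec ed.
rewrite scalerA; congr (_ *: _); apply: val_inj.
rewrite valM ea eb ed; exact (frac_ratio _ (Xi_neq0 i) (Xi_neq0 j)).
Qed.

Lemma div_regular U i phi : i \in val U -> bigs pair 1 U phi ->
  exists a : regular_ring U, val a = phi / io 'X_i.
Proof.
move=> iU hphi; apply: mk_regular.
have h := sec_Xpow (-1) iU; rewrite exprN1 in h.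
have := secM idealp_any (sec_any hphi) h.
by rewrite subrr.
Qed.

Lemma hom_exists U (u : FZ U) : exists w : L U, forall i phi (a : regular_ring U),
  i \in val U -> repr_by (u : qsec pair 1 U) phi -> val a = phi / io 'X_i ->
  w = a *: res U (e i).
Proof.
have /set0Pn[i0 iU] := valP U.
have [a0 ea0] := div_regular iU (qv_bigs (u : qsec pair 1 U)).
exists (a0 *: res U (e i0)) => i phi a iU' hphi ea.
have [b eb] := div_regular iU' (qv_bigs (u : qsec pair 1 U)).
rewrite (frame_change iU iU' ea0 eb); apply/eqP; rewrite -subr_eq0 -scalerBl.
apply/eqP/sect_supp/ideal_onP; rewrite valB eb ea -mulrBl.
exact: (small_carpet em W_vanishes ZW iU' hphi).
Qed.

Lemma conormal_hom : exists f : forall U, FZ U -> L U, is_hom f /\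
  forall U (u : FZ U) i phi (a : regular_ring U), i \in val U ->
    repr_by (u : qsec pair 1 U) phi -> val a = phi / io 'X_i ->
    f U u = a *: res U (e i).
Proof.
have [f hf] : exists f : forall U, FZ U -> L U,
    forall U (u : FZ U) i phi (a : regular_ring U), i \in val U ->
    repr_by (u : qsec pair 1 U) phi -> val a = phi / io 'X_i ->
    f U u = a *: res U (e i).
  exists (fun U u => projT1 (cid (@hom_exists U u))) => U u.
  exact (projT2 (cid (@hom_exists U u))).
exists f; split; last exact: hf.
split=> [U c u v|U V u UV].
  have /set0Pn[i iU] := valP U.
  have hu := repr_by_qv (u : qsec pair 1 U); have hv := repr_by_qv (v : qsec pair 1 U).
  have [a ea] := div_regular iU (repr_by_bigs hu).
  have [b eb] := div_regular iU (repr_by_bigs hv).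
  rewrite (hf U u i _ a iU hu ea) (hf U v i _ b iU hv eb) scalerA -scalerDl.
  apply: (hf U _ i _ (c * a + b) iU (repr_add (repr_scale c hu) hv)).
  by rewrite valD valM ea eb mulrDl mulrA.
have /set0Pn[i iU] := valP U; have iV := subsetP UV i iU.
have hu := repr_by_qv (u : qsec pair 1 U).
have hr := repr_res UV hu.
have [a ea] := div_regular iU (repr_by_bigs hu).
have [b eb] := div_regular iV (repr_by_bigs hr).
rewrite (hf U u i _ a iU hu ea) (hf V (res V u) i _ b iV hr eb).
by rewrite (resZ (b := b)) ?res_comp // ?open1_sub // ea eb.
Qed.

Lemma res0 (F : coherent Z) U V : val U \subset val V -> res V (0 : F U) = 0.
Proof.
by move=> UV; apply: (addrI (res V (0 : F U))); rewrite -resD // !addr0.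
Qed.

Lemma hom_cech_d (f : forall U, FZ U -> L U) p (z : cochain FZ p) t :
  is_hom f -> f _ (cech_d z t) = cech_d (fun t' => f _ (z t')) t.
Proof.
move=> [fl fr]; have fD U : {morph f U : x y / x + y}.
  by move=> x y; have := fl U 1 x y; rewrite !scale1r.
have f0 U : f U 0 = 0 by apply: (addrI (f U 0)); rewrite -fD !addr0.
have fZ U a x : f U (a *: x) = a *: f U x by rewrite -[a *: x]addr0 fl f0 addr0.
rewrite /cech_d (big_morph _ (fD _) (f0 _)); apply: eq_bigr => i _.
rewrite fZ fr //; apply/subsetP => x /imsetP[j _ ->].
by rewrite ffunE; apply: imset_f.
Qed.

Lemma hom_eq0 m (f : forall U, FZ U -> L U) : dualizing m.+2 L -> is_hom f ->
  forall U u, f U u = 0.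
Proof.
move=> [tr [_ _ tr0] dual] hf.
have hl : cohomology_form (fun _ : cochain FZ m.+2 => 0).
  by split=> *; rewrite ?addr0 ?mulr0.
have [g [_ _ guniq]] := dual FZ _ hl.
have z0 : 0 = tr (fun t => 0).
  rewrite tr0 //; exists (fun=> 0) => t; rewrite /cech_d big1 // => i _.
  rewrite res0 ?scaler0 //; apply/subsetP => x /imsetP[j _ ->].
  by rewrite ffunE; apply: imset_f.
have fu z : cocycle z -> 0 = tr (fun t => f _ (z t)).
  move=> /conormal_coboundary[y hy]; rewrite tr0 //.
  exists (fun t => f _ (y t)) => t; rewrite -hom_cech_d //.
  by rewrite hy.
move=> U u; rewrite (guniq f hf fu) -(guniq (fun V _ => 0)) //.
split=> [V a x y|V T x VT]; first by rewrite scaler0 addr0.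
by rewrite res0.
Qed.

Hypothesis e_free : forall i a, a *: e i = 0 <-> ideal_on Z a.

(** [a *: e i] is the image of the section x_i a of I(1), hence zero; as [e i] is free over the ring
    of Z, [a] is in the ideal of Z. *)
Lemma carpet_eq m i (a : regular_ring (@open1 k P i)) : dualizing m.+2 L ->
  ideal_on W a -> ideal_on Z a.
Proof.
move=> hL /ideal_onP ha; apply/e_free; have [f [hf fE]] := conormal_hom.
have iU : i \in val (@open1 k P i) := set11 i.
have hX : sec io (@anyp k N) (val (@open1 k P i)) 1 (io 'X_i).
  by apply: sec_poly => //; have := @whomogXi _ P i.
have hphi : bigs pair 1 (open1 i) (io 'X_i * val a).
  by have := secM (idealp_subscheme W) hX ha; rewrite addr0.
rewrite -[e i](res_id) -(fE _ _ i _ _ iU (repr_by_proj hphi)); last first.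
  by rewrite mulrC mulKf.
exact: hom_eq0 hL hf _ _.
Qed.

(** As the two ideals agree, the local generators of the conormal module are zero, so each [h j] is
    nilpotent modulo the ideal of W. They generate the unit ideal; hence 1 is in the ideal of W on
    every chart, and a power of every coordinate vanishes on Y. *)
Theorem not_canonically_embedded m : dualizing m.+2 L -> False.
Proof.
move=> hL; apply: not_nilpotent => i.
have [_ _ [n [h [[b hb] hh]]]] := ZW (@open1 k P i).
set U := @open1 k P i in b h hb hh *.
have J0 : ideal_on W (0 : regular_ring U).
  by apply/ideal_onP; rewrite rmorph0; apply: sec0 (idealp_subscheme W) _ _.
have JD (x y : regular_ring U) : ideal_on W x -> ideal_on W y -> ideal_on W (x + y).
  by move=> /ideal_onP hx /ideal_onP hy; apply/ideal_onP; rewrite valD; apply: secD (idealp_subscheme W) _ _ _ _ hx hy.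
have JM (x y : regular_ring U) : ideal_on W y -> ideal_on W (x * y).
  move=> /ideal_onP hy; apply/ideal_onP; rewrite valM.
  by have := secM (idealp_subscheme W) (regularE x) hy; rewrite add0r.
have [l hl] : radical (@ideal_on k P W U) 1.
  rewrite -[1](subrK (\sum_j b j * h j)); apply: radicalD => //.
    by exists 1%N.
  apply: radical_sum => // j _; apply: radicalM => //.
  have [g [/(carpet_eq hL)/ideal_onP hg _ hg1]] := hh j.
  have [|l] := (hg1 1).1; first by exists 0%N; rewrite mul1r mul1r; apply/ideal_onP.
  by rewrite mulr1 => hl; exists l.
move: hl; rewrite expr1n => /ideal_onP[w [p [wi Wp hp]]].
rewrite rmorph1 mul1r => /io_inj ep; exists (size w).
have {}hp : homogR (size w)%:Z p by apply: whomog_eq hp _; rewrite add0r.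
have := (W_vanishes hp).1 Wp; rewrite /vanishes -ep.
have -> : Xw w = 'X_i ^+ size w :> R; last by rewrite substXn substX.
elim: w wi {hp ep} => [|j w IH] wi; first by rewrite /Xw big_nil.
rewrite /Xw big_cons -/(Xw w) IH => [|j' hj']; last by apply: wi; rewrite inE hj' orbT.
by have := wi j (mem_head _ _); rewrite inE => /eqP->; rewrite exprS.
Qed.

End Canonical.

(** * Sections as polynomials *)

Section PolynomialSections.
Context {k : fieldType} {A : coxSpace k}.
Local Notation S := (cox_ring A).
Local Notation G := (cox_grp A).
Local Notation io := (@iofr k A).
Local Notation io_inj := (@iofr_inj k A).
Context (q : S) (gq D : G) (hq : whomog gq q).
Context (Y : subscheme A) (hY : forall p, Y p <-> dvdm q p).
Implicit Types (U : {set cox_chart A}) (c d : cox_chart A) (g : G).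

Definition chart_mon c : S * G := ('X_[cox_mon c], wdeg (cox_mon c)).

Lemma denom_mon c : denom (chart_mon c).
Proof. by split; [apply: whomogXm|apply: mpolyX_neq0]. Qed.

Let mons U := map chart_mon (enum U).

Lemma denoms_mons U : denoms (mons U).
Proof. exact/denoms_mapf/denom_mon. Qed.

Lemma prodh_mons U : prodh (mons U) = xprod U.
Proof. by rewrite /prodh big_map big_enum. Qed.

Lemma degh_mons U : degh (mons U) = xdeg U.
Proof. by rewrite /degh big_map big_enum. Qed.

Let Uneq0 U l : io (xprod U) ^+ l != 0.
Proof. exact (expf_neq0 l (xprod_neq0 U)). Qed.

Lemma twist_loc U g phi : twist U g phi <-> loc io (mons U) g phi.
Proof.
split=> [[l [p [hp ->]]]|/(loc_den (@denoms_mons U))[l /(_ l (leqnn l))[p hp e]]].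
  exists (flatten (nseq l (mons U))), p.
  split.
  - by move=> h /flattenP[w /nseqP[-> _]].
  - by apply: whomog_eq hp _; rewrite degh_flatten degh_mons.
  - rewrite prodh_flatten prodh_mons rmorphXn; exact (divfK (Uneq0 U l) _).
exists l, p; rewrite -degh_mons; split; first exact: hp.
rewrite prodh_mons in e; rewrite -[tofrac p]e; exact (esym (mulfK (Uneq0 U l) _)).
Qed.

Lemma itwist_loc U g phi :
  itwist Y U g phi <-> loc io (mons U) g phi /\ qmod io q (mons U) phi.
Proof.
split=> [[l [p [/hY[r er] hp e]]]|[hl hm]].
  split; first by apply/twist_loc; exists l, p.
  exists (flatten (nseq l (mons U))), r; split.
    by move=> h /flattenP[w /nseqP[-> _]].
  rewrite prodh_flatten prodh_mons e rmorphXn er; exact (divfK (Uneq0 U l) _).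
have [r /twist_loc[l [p [hp er]]] e] := loc_qmod io_inj hq (@denoms_mons U) hl hm.
exists l, (q * p); split; first by apply/hY; exists p.
  by apply: whomog_eq (whomogM hq hp) _; zmod.
by rewrite e er mulrA -tofracM.
Qed.

Lemma itwistB U g x y : itwist Y U g x -> itwist Y U g y -> itwist Y U g (x - y).
Proof.
move=> /itwist_loc[h1 h2] /itwist_loc[h3 h4]; apply/itwist_loc; split.
  exact (locB (@denoms_mons U) h1 h3).
exact (qmodB h2 h4).
Qed.

Lemma itwist_poly U g p : whomog g p -> dvdm q p -> itwist Y U g (io p).
Proof.
move=> hp /hY Yp; exists 0%N, p; split=> //; first by rewrite addr0.
by rewrite expr0 divr1.
Qed.

Hypothesis saturated : forall p,
  (forall c, exists l, dvdm q ('X_[cox_mon c] ^+ l * p)) -> dvdm q p.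

Lemma itwist_saturated g p :
  (forall c, itwist Y [set c] g (io p)) -> dvdm q p.
Proof.
move=> h; apply: saturated => c; have [l [r [/hY Yr hr e]]] := h c.
exists l; suff -> : 'X_[cox_mon c] ^+ l * p = r by [].
have -> : 'X_[cox_mon c] = xprod [set c] by rewrite /xprod big_set1.
apply: io_inj; rewrite rmorphM rmorphXn e mulrC; exact (divfK (Uneq0 _ l) _).
Qed.

(** The lowest degree of acyclicity: a global section is a cocycle on lists of size 1, and its
    primitive at [[::]] is a polynomial. *)
Lemma global_section_poly : acyclic_mod io q chart_mon D ->
  forall u, global_section Y D u ->
  exists p, whomog D p /\ forall c, itwist Y [set c] D (u c - io p).
Proof.
move=> ac u [tu gu].
have e1 c : mons [set c] =i [:: chart_mon c] by rewrite /mons enum_set1.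
have e2 c d : {subset mons [set c; d] <= [:: chart_mon c; chart_mon d]}.
  by move=> h /mapP[x]; rewrite mem_enum !inE => /orP[]/eqP-> ->; rewrite eqxx ?orbT.
pose z (t : seq (cox_chart A)) := if t is c :: _ then u c else 0.
have [t st|t st|y [yM hy]] := ac 0%N z.
- case: t st => [|c [|? ?]] // _; have /twist_loc := tu c.
  by apply: loc_sub => h; rewrite e1.
- case: t st => [|c [|d [|? ?]]] //= _; rewrite subr0.
  have /itwist_loc[_] := gu c d; move/(qmod_sub (@e2 c d)) => h.
  rewrite -opprB; exact (qmodN h).
have [us [p [us0 hp e]]] := yM [::] erefl.
have {}us0 : us = [::] by case: us us0 {hp e} => // h us /(_ h (mem_head _ _)).
rewrite us0 /prodh big_nil rmorph1 mulr1 in e.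
rewrite us0 /degh big_nil addr0 in hp.
exists p; split=> // c; apply/itwist_loc.
have := hy [:: c] erefl; rewrite /= subr0 e => hm; split.
  apply: (locB (@denoms_mons _)); first exact/twist_loc.
  exact: loc_poly.
by apply: qmod_sub hm => h; rewrite e1.
Qed.

(** For q = 0 the local sections are equal; written with denominators in two charts whose monomials
    share no variable, their common value has no denominator at all. *)
Lemma global_section_coprime c d : q = 0 ->
  (forall i, cox_mon c i = 0%N \/ cox_mon d i = 0%N) ->
  forall u, global_section Y D u ->
  exists p, whomog D p /\ forall c, itwist Y [set c] D (u c - io p).
Proof.
move=> q0 cd u [tu gu].
have ue c1 c2 : u c1 = u c2.
  have [l [p [/hY[r]]]] := gu c1 c2; rewrite q0 mul0r => -> _ /eqP.
  by rewrite tofrac0 mul0r subr_eq0 => /eqP.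
have xd (c1 : cox_chart A) : xprod [set c1] = 'X_[cox_mon c1] by rewrite /xprod big_set1.
have [l1 [p1 [h1 e1]]] := tu c; have [l2 [p2 [h2 e2]]] := tu d.
have E1 : u c * io (xprod [set c] ^+ l1) = io p1.
  by rewrite e1 rmorphXn; exact (divfK (Uneq0 _ l1) _).
have E2 : u c * io (xprod [set d] ^+ l2) = io p2.
  by rewrite (ue c d) e2 rmorphXn; exact (divfK (Uneq0 _ l2) _).
rewrite !xd !mpolyXn in E1 E2.
have [||r er] := @mpolyX_coprime _ _ (cox_mon d *+ l2)%MM (cox_mon c *+ l1)%MM p1 p2.
- by move=> i; rewrite !mulmnE; case: (cd i) => ->; [right|left]; rewrite mul0n.
- apply: io_inj; rewrite !rmorphM -E1 -E2; exact (etrans (mulrCA _ _ _) (etrans (congr1 _ (mulrC _ _)) (mulrCA _ _ _))).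
have X0 : io 'X_[cox_mon c *+ l1] != 0 := io_neq0 io_inj (mpolyX_neq0 _).
have eu : u c = io r.
  by apply: (mulIf X0); rewrite E1 er rmorphM; exact (mulrC _ _).
exists r; split=> [|c'].
  have hX : whomog (wdeg (cox_mon c) *+ l1) ('X_[cox_mon c *+ l1] : S).
    rewrite -mpolyXn; apply: whomogX; exact: whomogXm.
  have dr := h1; rewrite er /xdeg big_set1 in dr.
  have er' := wcompM (D + wdeg (cox_mon c) *+ l1) r hX.
  rewrite mulrC (wcomp_homog dr) addrK in er'.
  have -> : r = wcomp D r by apply: (mulIf (mpolyX_neq0 (cox_mon c *+ l1))); rewrite -er' mulrC.
  exact: whomog_wcomp.
by rewrite (ue c' c) eu subrr -[0](rmorph0 io); apply: itwist_poly; [apply: whomog0|apply: dvdm0].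
Qed.

Section Pull.
Context (N : nat) (s : 'I_N.+1 -> cox_chart A -> cox_frac A) (s' : 'I_N.+1 -> S).
Local Notation R := (cox_ring (proj k N)).
Hypothesis s'D : forall j, whomog D (s' j).
Hypothesis sE : forall j c, itwist Y [set c] D (s j c - io (s' j)).
Implicit Types (F : R).

Definition iok : {rmorphism k -> cox_frac A} := io \o @mpolyC (cox_var A) k.

Lemma pullE c F : pull s c F = mmap iok (fun j => s j c) F.
Proof. by []. Qed.

Lemma io_substE F : io (subst s' F) = mmap iok (io \o s') F.
Proof. exact: mmap_comp. Qed.

Lemma loc_section c j : loc io (mons [set c]) D (s j c).
Proof.
have /itwist_loc[h _] := sE j c; rewrite -[s j c](subrK (io (s' j))).
by apply: (locD (@denoms_mons _)) => //; apply: loc_poly.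
Qed.

Lemma pull_subst_mod c F : qmod io q (mons [set c]) (pull s c F - io (subst s' F)).
Proof.
pose regular x := exists us p, {subset us <= mons [set c]} /\ x * io (prodh us) = io p.
have rloc g x : loc io (mons [set c]) g x -> regular x.
  by move=> [us [p [uh _ e]]]; exists us, p.
suff [] : regular (pull s c F) /\
   qmod io q (mons [set c]) (pull s c F - io (subst s' F)) by [].
rewrite pullE io_substE.
elim/mpoly_ring_ind: F => [a|j|F F' [rF qF] [rF' qF']|F F' [rF qF] [rF' qF']].
- rewrite !mmapC subrr; split; last exact: qmod0.
  by exists [::], a%:MP; split=> //; rewrite /prodh big_nil rmorph1 mulr1.
- rewrite !mmap_Xi; split; first exact: rloc (loc_section c j).
  by have /itwist_loc[] := sE j c.
- rewrite !mmapD; split; last by rewrite opprD addrACA; apply: qmodD.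
  move: rF rF' => [us [p [uh e]]] [us' [p' [uh' e']]].
  exists (us ++ us'), (p * prodh us' + p' * prodh us); split.
    by move=> h; rewrite mem_cat => /orP[/uh|/uh'].
  rewrite prodh_cat rmorphD !rmorphM -e -e'; exact (frac_sum _ _ _ _).
- rewrite !rmorphM; move: rF rF' => [us [p [uh e]]] [us' [p' [uh' e']]]; split.
    exists (us ++ us'), (p * p'); split.
      by move=> h; rewrite mem_cat => /orP[/uh|/uh'].
    rewrite prodh_cat !rmorphM -e -e'; exact (mulrACA _ _ _ _).
  set x := mmap _ _ F in uh e qF *; set x' := mmap _ _ F' in uh' e' qF' *.
  set y := mmap _ _ F in qF *; set y' := mmap _ _ F' in qF' *.
  have -> : x * x' - y * y' = x * (x' - y') + y' * (x - y) by exact (frac_mulB _ _ _ _).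
  have hy' : y' * io (prodh [::]) = io (subst s' F').
    by rewrite /prodh big_nil rmorph1 mulr1 io_substE.
  by apply: qmodD; [apply: qmodMl uh e qF'|apply: (@qmodMl _ _ _ _ _ _ [::] _ _ _ _ hy' qF)].
Qed.

Lemma loc_pull (d : nat) c F : whomog (d%:Z : cox_grp (proj k N)) F ->
  loc io (mons [set c]) (D *+ d) (pull s c F).
Proof.
move=> hF; rewrite pullE /mmap big_seq; apply: (loc_sum (@denoms_mons _)) => m hm.
rewrite -[D *+ d]add0r; apply: locM.
  by apply: loc_poly; apply: whomogC.
have -> : d = (\sum_(j < N.+1) m j)%N.
  apply/eqP; rewrite -eqz_nat -(hF m hm) /wdeg /= -natr_sum natz //.
rewrite -sumrMnr; apply: (big_rec2 (fun x g => loc io (mons [set c]) (g : G) (x : cox_frac A))).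
  by have := @loc_poly _ _ _ io (mons [set c]) 0 1 (@whomog1 _ _); rewrite rmorph1.
move=> j g x _ hx; apply: locM => //.
by apply: locX; apply: loc_section.
Qed.

Lemma whomog_pull (d : nat) F : whomog (d%:Z : cox_grp (proj k N)) F ->
  whomog (D *+ d) (subst s' F).
Proof.
move=> hF; have nuD (g h : int) : D *~ (g + h) = D *~ g + D *~ h by rewrite mulrzDr.
apply: (whomog_subst (A := proj k N) (nu := fun z : int => D *~ z) nuD _ hF) => j /=.
by rewrite mulr1z.
Qed.

Lemma pull_subst (d : nat) c F : whomog (d%:Z : cox_grp (proj k N)) F ->
  itwist Y [set c] (D *+ d) (pull s c F - io (subst s' F)).
Proof.
move=> hF; apply/itwist_loc; split; last exact: pull_subst_mod.
apply: (locB (@denoms_mons _)); first exact: loc_pull.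
by apply: loc_poly; apply: whomog_pull.
Qed.

End Pull.

Context (N : nat) (s : 'I_N.+1 -> cox_chart A -> cox_frac A).
Context (W : subscheme (proj k N)).
Hypothesis basis : basis_of_sections Y D s.
Hypothesis image : forall (d : nat) (F : cox_ring (proj k N)),
    whomog (d%:Z : cox_grp (proj k N)) F ->
    (W F <-> forall c, itwist Y [set c] (D *+ d) (pull s c F)).
Hypothesis poly : forall u, global_section Y D u ->
  exists p, whomog D p /\ forall c, itwist Y [set c] D (u c - io p).

(** Existence in the basis property gives the spanning. Uniqueness excludes an [s' j] divisible by
    [q]: the zero section would have both zero and the j-th unit vector as coefficients. *)
Lemma poly_sections : exists s' : 'I_N.+1 -> S,
  [/\ forall j, whomog D (s' j),
      forall p, whomog D p -> exists a, dvdm q (p - \sum_j a j *: s' j),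
      forall j, ~ dvdm q (s' j),
      forall j c, itwist Y [set c] D (s j c - io (s' j)) &
      forall (d : nat) F, whomog (d%:Z : cox_grp (proj k N)) F ->
        (W F <-> vanishes q s' F)].
Proof.
have [hs uniq_s] := basis.
have [s' hs'] := choice (fun j => poly (hs j)).
have s'D j : whomog D (s' j) by case: (hs' j).
have s'E j c : itwist Y [set c] D (s j c - io (s' j)) by case: (hs' j).
have it0 U g : itwist Y U g 0.
  by rewrite -[0](rmorph0 io); apply: itwist_poly; [apply: whomog0|apply: dvdm0].
have itZ U g (a : k) x : itwist Y U g x -> itwist Y U g (scal A a * x).
  move=> [l [p [Yp hp ->]]]; exists l, (a *: p); split.
  - by rewrite -mul_mpolyC; apply: equationsM.
  - exact: whomogZ.
  - by rewrite -mul_mpolyC tofracM mulrA.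
have itS U g (F : 'I_N.+1 -> cox_frac A) : (forall j, itwist Y U g (F j)) ->
    itwist Y U g (\sum_j F j).
  move=> h; apply: (big_ind (itwist Y U g)) => // x y hx hy.
  by rewrite -[y]opprK; apply: itwistB => //; rewrite -sub0r; apply: itwistB.
have sumE c (a : 'I_N.+1 -> k) : itwist Y [set c] D
    (\sum_j scal A (a j) * s j c - io (\sum_j a j *: s' j)).
  rewrite [io _]rmorph_sum -sumrB; apply: itS => j.
  by rewrite -mul_mpolyC rmorphM -mulrBr; apply: itZ.
exists s'; split=> //.
- move=> p hp; have [|a [ha _]] := uniq_s (fun=> io p).
    split=> [c|c d]; last by rewrite subrr.
    by exists 0%N, p; rewrite addr0 expr0 divr1.
  exists (fun j => a 0 j); apply: (itwist_saturated (g := D)) => c.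
  have := itwistB (ha c) (itwistB (it0 _ D) (sumE c (fun j => a 0 j))).
  by rewrite sub0r opprK addrA subrK rmorphB.
- move=> j hj; have [|a [_ ha]] := uniq_s (fun=> 0).
    by split=> [c|c d]; [exists 0%N, 0; rewrite tofrac0 mul0r; split=> //; apply: whomog0|rewrite subrr].
  have a0 : a = 0.
    apply: ha => c; rewrite big1 ?subr0 // => j' _.
    by rewrite mxE /scal mpolyC0 tofrac0 mul0r.
  have : a = delta_mx 0 j.
    apply: ha => c; rewrite (bigD1 j) //= big1 ?addr0 => [|j' ne]; last first.
      by rewrite mxE eqxx (negPf ne) /scal mpolyC0 tofrac0 mul0r.
    rewrite mxE !eqxx /scal mpolyC1 tofrac1 mul1r.
    apply: itwistB => //; have := itwistB (s'E j c) (itwistB (it0 _ D) (itwist_poly [set c] (s'D j) hj)).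
    by rewrite sub0r opprK subrK.
  rewrite a0 => /matrixP/(_ 0 j); rewrite !mxE !eqxx => /eqP.
  by rewrite eq_sym oner_eq0.
- move=> d F hF; rewrite (image hF); split=> [hW|hv c].
    apply: (itwist_saturated (g := D *+ d)) => c.
    by have := itwistB (hW c) (pull_subst s'D s'E c hF); rewrite opprB addrCA subrr addr0.
  have hp := itwist_poly [set c] (whomog_pull s'D hF) hv.
  have := itwistB (pull_subst s'D s'E c hF) (itwistB (it0 _ _) hp).
  by rewrite sub0r opprK subrK.
Qed.

End PolynomialSections.

(** * Projective spaces and quadrics *)

Lemma mpolyX_ideal (k : fieldType) n (J : finType) (v : J -> 'I_n) (p : {mpoly k[n]}) :
  (forall m, m \in msupp p -> exists j, (0 < m (v j))%N) ->
  exists c, p = \sum_j c j * 'X_(v j).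
Proof.
move=> hp; rewrite [p]mpolyE big_seq.
pose Q (x : {mpoly k[n]}) := exists c, x = \sum_j c j * 'X_(v j).
apply: (big_ind Q) => [|_ _ [c ->] [c' ->]|m /hp[j mj]].
- by exists (fun=> 0); rewrite big1 // => j _; rewrite mul0r.
- exists (fun j => c j + c' j); rewrite -big_split; apply: eq_bigr => j _.
  by rewrite mulrDl.
- exists (fun j' => if j' == j then p@_m *: 'X_[m - U_(v j)] else 0).
  rewrite (bigD1 j) //= eqxx big1 ?addr0 => [|j' /negPf->]; last by rewrite mul0r.
  rewrite -scalerAl -mpolyXD submK //; apply/mnm_lepP => i; rewrite mnm1E.
  by case: eqP => // <-.
Qed.

Section ProjAcyclic.
Context {k : fieldType} (n : nat).
Local Notation A := (proj k n).
Local Notation S := (cox_ring A).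
Local Notation io := (@iofr k A).

Lemma wdeg_proj (m : 'X_{1..cox_var A}) : wdeg m = (\sum_(i < n.+1) m i)%N%:Z.
Proof. by rewrite /wdeg /= -natr_sum natz. Qed.

(** A Laurent monomial with only negative exponents has degree at most -(n + 1), which the bound on
    [g] forbids. Over a coordinate locus, a power of the variable is in the ideal of the [e i]. *)
Lemma proj_acyclic (I : finType) (i0 : I) (e : I -> S * int) (g : int) :
  (forall i, denom (e i : S * cox_grp A)) ->
  (forall i, exists c, (e i).1 = \sum_j c j * 'X_j) ->
  (forall j, exists b c, 'X_j ^+ b = \sum_i c i * (e i).1 :> S) ->
  (- n.+1%:Z < g)%R -> acyclic (fun t => loc io (map e t) (g : cox_grp A)).
Proof.
move=> de he cov hg.
apply: (@acyclic_loc_sub _ _ _ io _ (fun t => map e t ++ map (@var _ A) [::])).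
  by move=> t h; rewrite cats0.
apply: (acyclic_divisors (@iofr_inj k A) (v := id) i0 (ord0 : 'I_n.+1)) => //.
  move=> m L em _; apply: contrapT => h.
  have hm j : (m j < L)%N.
    by rewrite ltnNge; apply/negP => hj; apply: h; exists j.
  have L0 : (0 < L)%N by apply: leq_ltn_trans (hm ord0).
  have : (\sum_(i < n.+1) m i <= n.+1 * L.-1)%N.
    rewrite -[X in (_ <= X * _)%N]card_ord -sum_nat_const; apply: leq_sum => j _.
    by have := hm j; lia.
  move: em; rewrite !wdeg_proj.
  have -> : (\sum_(i < n.+1) (@mcst _ A L) i = n.+1 * L)%N.
    rewrite -[X in (_ = X * _)%N]card_ord -sum_nat_const; apply: eq_bigr => j _.
    by rewrite mnmE.
  rewrite -{1}(prednK L0) mulnS /= => e1 e2; set x := \sum_(i < n.+1) m i in e1 e2.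
  have {}e1 : x%:Z = g + (n.+1 + n.+1 * L.-1)%N%:Z by [].
  move: (n.+1 * L.-1)%N e1 e2 => y e1 e2; move: hg; lia.
move=> j u; have [b [c hc]] := cov j.
apply: (acyclic_cover (@iofr_inj k A)) => //; first exact: denoms_var.
apply: (covers_radical de _ (us := nseq b (@var _ A j)) (c := c)).
- exact: denoms_var.
- by move=> h /nseqP[-> _]; rewrite cats0 map_id inE eqxx.
- by rewrite prodh_nseq.
Qed.

End ProjAcyclic.

Lemma Posz_mulrn (a b : nat) : a%:Z *+ b = (b * a)%N%:Z.
Proof. by rewrite -mulr_natl natz PoszM. Qed.

Section ProjEmbedding.
Context {k : fieldType} (char0 : forall j, j.+1%:R != 0 :> k) (n d : nat).
Local Notation A := (proj k n.+1).
Local Notation S := (cox_ring A).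
Local Notation io := (@iofr k A).
Local Notation io_inj := (@iofr_inj k A).
Local Notation D := (d.+1%:Z : cox_grp A).
Context (q : S) (gq : int) (hq : whomog (gq : cox_grp A) q).
Context (N : nat) (s : 'I_N.+1 -> S).
Local Notation R := (cox_ring (proj k N)).
Hypotheses (hs : forall j, whomog D (s j)) (s_nz : forall j, s j != 0).
Hypothesis span : forall p : S, whomog D p -> exists a, dvdm q (p - \sum_j a j *: s j).
Hypothesis q_cases : q = 0 \/ [/\ q != 0, gq = 2 & (2 <= n)%N].
Hypothesis q_smooth : forall r, (forall i, dvdm q (r * q^`M(i))) -> dvdm (q * q) (q * r).

Lemma proj_vars (g : nat) (p : S) : whomog (g.+1%:Z : cox_grp A) p ->
  exists c, p = \sum_j c j * 'X_j.
Proof.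
move=> hp; apply: (mpolyX_ideal (v := id)) => m /hp; rewrite wdeg_proj => -[em].
apply: contrapT => h; move: em; rewrite big1 // => j _; apply/eqP.
by rewrite -leqn0 leqNgt; apply/negP => hj; apply: h; exists j.
Qed.

(** For a quadric the [s j] cover only Y, and [q] is added to cover the ambient space; the
    restriction sequence then needs g - 2 > -(n + 2), which [n >= 2] provides. The bound -1 is the
    value of D - 2 for D = 1. *)
Lemma proj_acyclic_mod (g : int) : (-1 <= g)%R -> acyclic_mod io q (divisor D s) (g : cox_grp A).
Proof.
move=> hg.
have de j : denom (divisor D s j) by split; [apply: hs|apply: s_nz].
case: q_cases => [q0|[q0 gq2 n2]].
  apply: (acyclic_mod0 io_inj) => //; apply: (proj_acyclic ord0) => //; last by move: hg; lia.
    by move=> j; apply: proj_vars (@hs j).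
  move=> j; have [a [r ea]] := span (@whomogXj k n.+1 j d.+1).
  exists d.+1, (fun i => mpolyC _ (a i)); move: ea; rewrite q0 mul0r => /eqP.
  by rewrite subr_eq0 => /eqP->; apply: eq_bigr => i _; rewrite mul_mpolyC.
apply: (acyclic_mod_complement hq) => //.
have de' i : denom (with_complement q (gq : cox_grp A) (divisor D s) i) by case: i => [i|]; [apply: de|split].
have ac (g' : int) : (- n.+2%:Z < g')%R ->
  acyclic (fun t => loc io (map (with_complement q (gq : cox_grp A) (divisor D s)) t) (g' : cox_grp A)).
  apply: (proj_acyclic None) => // [[i|]|j].
  - by apply: proj_vars (@hs i).
  - by apply: (@proj_vars 1); apply: whomog_eq hq _; rewrite gq2.
  - have [a [r ea]] := span (@whomogXj k n.+1 j d.+1); exists d.+1, (fun i => if i is Some i then mpolyC _ (a i) else r).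
    rewrite (bigD1 None) //= (reindex_onto Some (odflt ord0)) /= => [|[i|]] //.
    rewrite -[LHS](subrK (\sum_j a j *: s j)) ea mulrC; congr (_ + _).
    by apply: eq_big => [i|i _]; rewrite ?eqxx // mul_mpolyC.
apply: (@acyclic_mod_lift _ _ _ _ io_inj _ _ hq _ _ _ q0 de'); apply: ac; move: hg gq2; lia.
Qed.

Lemma proj_euler (j : nat) (p : S) : whomog (D *+ j.+1) p ->
  \sum_i 'X_i * ((j.+1 * d.+1)%:R^-1 *: p^`M(i)) = p.
Proof.
move=> hp.
have lamD (g h : int) : ((g + h)%:~R : k) = g%:~R + h%:~R by rewrite intrD.
have := euler (A := A) lamD hp.
under eq_bigr do rewrite scale1r.
move=> e; under eq_bigr do rewrite -scalerAr.
rewrite -scaler_sumr e scalerA.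
have -> : (D *+ j.+1)%:~R = (j.+1 * d.+1)%:R :> k.
  exact (congr1 (fun z : int => z%:~R) (Posz_mulrn d.+1 j.+1)).
by rewrite mulVf ?scale1r // mulnS; apply: char0.
Qed.

Section Chart.
Context (lin : S -> R) (hlin : forall p, whomog D p ->
  whomog (1 : cox_grp (proj k N)) (lin p) /\ dvdm q (subst s (lin p) - p)).
Context (c : 'I_n.+2).

Let Xd : S := 'X_c ^+ d.

Let Xc0 : io 'X_c != 0.
Proof. exact (io_neq0 io_inj (@mpolyX_neq0 _ A U_(c)%MM)). Qed.

Let hXn j : whomog (j%:Z : cox_grp A) ('X_c ^+ j : S) := whomogXj c j.

Let hXi i : whomog D ('X_i * Xd).
Proof.
by apply: whomog_eq (whomogM (@whomogXi _ A i) (@hXn d)) _; rewrite /= -add1n PoszD.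
Qed.

(** On x_c <> 0 the linear form extending x_i x_c^d represents x_i, with the factor x_c^d for all i.
    The character is g |-> x_c^(g d), and its value at D = d + 1 is the d-th power of l0 =
    x_c^(d+1). *)
Definition proj_chart : chart io q D s (fun g : cox_grp A => g : int) (fun=> 1%N)
  (fun (_ : 'I_1) (g : cox_grp A) => (g : int)%:~R) 1.
Proof.
refine (@Chart k A _ io q D N s (fun g : cox_grp A => g : int) (fun=> 1%N) 1
  (fun _ (g : cox_grp A) => (g : int)%:~R) 1
  (lin ('X_c ^+ d.+1)) ('X_c ^+ d.+1) (fun i => lin ('X_i * Xd)) (fun=> Xd)
  (fun g : cox_grp A => io 'X_c ^ ((g : int) * d%:Z)) d (fun=> 'X_c)
  (fun _ i' => 'X_c * Xd^`M(i')) _ _ _ _ _ _ _ _ _ _ _ _ _ _ _).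
- exact: (hlin (@hXn _)).1.
- exact (expf_neq0 d.+1 (@mpolyX_neq0 _ A U_(c)%MM)).
- exact: hXn.
- exact: (hlin (@hXn _)).2.
- by move=> i; exact: (hlin (@hXi i)).1.
- by move=> i; apply: whomog_eq (@hXn d) _; rewrite /=; lia.
- by move=> i; apply: whomog_eq (@whomogXi _ A c) _; rewrite /=; lia.
- by move=> i; exact: (hlin (@hXi i)).2.
- by move=> g h; rewrite mulrDl; exact (expfzDr _ _ Xc0).
- by move=> g; exact (expfz_neq0 _ Xc0).
- by move=> i; rewrite mul1r rmorphXn.
- by rewrite -PoszM -exprnP rmorphXn exprM.
- by [].
- by move=> i; rewrite expr1 exprS.
- by move=> i i'; rewrite big_ord1 scale1r.
Defined.

End Chart.

Lemma proj_embedding : inhabited (embedding io q (gq : cox_grp A) D s).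
Proof.
have [lin hlin] := lin_exists span.
constructor.
refine (@Embedding k A _ io q (gq : cox_grp A) D N s hq hs s_nz _ _ 1
  (fun _ (g : cox_grp A) => (g : int)%:~R) _ _ q_smooth (fun g : cox_grp A => g : int) _
  (fun=> 1%N) _ _ 1 'I_n.+2 (proj_chart hlin) _).
- move=> z; rewrite -mulrzl -[d.+1%:Z]/(d.+1%:Z) => /eqP; rewrite mulf_eq0 => /orP[/eqP|//].
  by rewrite intz.
- move=> g hg; apply: proj_acyclic_mod.
  case: hg => [->|->|[i ->]|[q0 ->]] //=.
  by case: q_cases => [e|[_ -> _]]; [rewrite e eqxx in q0|lia].
- by move=> a g h; rewrite intrD.
- move=> j kappa hk; exists (fun i => (j.+1 * d.+1)%:R^-1 *: (kappa ord0)^`M(i)); split=> [i|a].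
    by apply: whomogZ; apply: (@whomog_deriv _ A _ _ i (@hk ord0)).
  rewrite (ord1 a) -[RHS](proj_euler (@hk ord0)); apply: eq_bigr => i _.
  by rewrite scale1r.
- by [].
- by [].
- by exists (fun=> 1) => g; rewrite big_ord1 mul1r.
- apply: (cover_monomials (lin := lin)) => //; first by move=> p /hlin[].
  (* The power d + 1 of a monomial is the product of the (x_i^(d+1))^(m_i), and the x_i^(d+1) extend
     to the linear forms of the charts. *)
  move=> m em; exists d.+1.
  have [i mi] : exists i, (0 < m i)%N.
    apply: contrapT => h; move: em; rewrite wdeg_proj big1 // => i _.
    by apply/eqP; rewrite -leqn0 leqNgt; apply/negP => hi; apply: h; exists i.
  apply: (@cover_ideal_mod _ _ _ _ _ _ _ _ (\prod_i lin ('X_i ^+ d.+1) ^+ m i)).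
    rewrite (bigD1 i) //= -(prednK mi) [lin _ ^+ _.+1]exprS -mulrA mulrC.
    apply: cover_idealM.
    exact: (@cover_ideal_l _ _ q N s _ (fun i => ch_l (proj_chart hlin i)) i).
  have hm : dvdm q (subst s (lin 'X_[m]) - 'X_[m]).
    by apply: (hlin _ _).2; rewrite -em; apply: whomogXm.
  rewrite substB substXn; apply: dvdm_trans (dvdmXX d.+1 hm) _.
  rewrite (mpolyXE_id _ m) -prodrXl subst_prod.
  apply: (big_rec2 (fun x y => dvdm q (x - y))); first by rewrite subrr; apply: dvdm0.
  move=> i' x y _ hxy; apply: dvdmMM => //; rewrite substXn exprAC; apply: dvdmXX.
  by apply: dvdm_subC; apply: (hlin _ _).2; apply: whomogXj.
Qed.

End ProjEmbedding.

(** From c^l p = q r and d^l' p = q r', for the two coprime monomials, follows d^l' r = c^l r';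
    hence c^l divides r, and q divides p. *)
Lemma saturated_coprime (k : fieldType) (A : coxSpace k) (q p : cox_ring A)
    (c d : cox_chart A) :
  (forall i, cox_mon c i = 0%N \/ cox_mon d i = 0%N) ->
  (forall c, exists l, dvdm q ('X_[cox_mon c] ^+ l * p)) -> dvdm q p.
Proof.
move=> cd h; have [l [r e]] := h c; have [l' [r' e']] := h d.
have Xn (m : 'X_{1..cox_var A}) j : ('X_[m] ^+ j : cox_ring A) != 0.
  exact (expf_neq0 j (@mpolyX_neq0 _ A m)).
have [q0|q0] := eqVneq q 0.
  move: e; rewrite q0 mul0r => /eqP; rewrite mulf_eq0 (negPf (Xn _ _)) => /eqP->.
  exact: dvdm0.
have [||r1 er] := @mpolyX_coprime _ _ (cox_mon d *+ l')%MM (cox_mon c *+ l)%MM r r'.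
- by move=> i; rewrite !mulmnE; case: (cd i) => ->; [right|left]; rewrite mul0n.
- apply: (mulfI q0); rewrite -!mpolyXn mulrCA -e [RHS]mulrCA -e'; exact: mulrCA.
exists r1; apply: (mulfI (Xn (cox_mon c) l)); rewrite e er -mpolyXn.
exact: mulrCA.
Qed.

(** * The gradient of a smooth quadric *)

Section SmoothQuadric.
Context {k : fieldType} (char0 : forall j, j.+1%:R != 0 :> k) (n : nat).
Local Notation A := (proj k n.+1).
Local Notation S := (cox_ring A).
Context (q : S) (hq : smooth_quadric q).

Lemma proj_constant (p : S) : whomog (0 : cox_grp A) p -> p = mpolyC _ (p@_0%MM).
Proof.
move=> hp; apply/mpolyP => m; rewrite mcoeffC.
have [->|m0] := eqVneq m 0%MM; first by rewrite mulr1.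
rewrite mulr0; apply: memN_msupp_eq0; apply/negP => /hp.
rewrite wdeg_proj => -[/eqP]; rewrite sum_nat_eq0 => /forallP h.
by case/eqP: m0; apply/mnmP => i; rewrite mnm0E; apply/eqP/(implyP (h i)).
Qed.

Let H i j : k := ((q^`M(i))^`M(j))@_0%MM.

Let Euler (g : int) (p : S) : whomog (g : cox_grp A) p ->
  \sum_i 'X_i * p^`M(i) = g%:~R *: p.
Proof.
move=> hp; have lamD (a b : int) : ((a + b)%:~R : k) = a%:~R + b%:~R by rewrite intrD.
by rewrite -(euler (A := A) lamD hp); apply: eq_bigr => i _; rewrite scale1r.
Qed.

Let gradient i : q^`M(i) = \sum_j H i j *: 'X_j.
Proof.
have h1 : whomog (1 : cox_grp A) (q^`M(i)).
  by apply: whomog_eq (@whomog_deriv _ A _ _ i hq.1) _.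
have := Euler h1; rewrite scale1r => <-; apply: eq_bigr => j _.
have h0 : whomog (0 : cox_grp A) ((q^`M(i))^`M(j)).
  by apply: whomog_eq (@whomog_deriv _ A _ _ j h1) _.
by rewrite (proj_constant h0) mulrC mul_mpolyC.
Qed.

(** A kernel vector is a point where the gradient vanishes; by Euler's formula and the invertibility
    of 2, [q] vanishes there too, so the quadric would be singular. *)
Let hessian_unit : (\matrix_(i < n.+2, j < n.+2) H j i) \in unitmx.
Proof.
rewrite unitmxE unitfE; apply/negP => /det0P[v v0 ev].
have gv i : (q^`M(i)).@[fun j => v 0 j] = 0.
  have /rowP/(_ i) := ev; rewrite !mxE => e0.
  rewrite gradient raddf_sum /= -[RHS]e0; apply: eq_bigr => j _.
  by rewrite mevalZ mevalXU mxE mulrC.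
have pv : @is_point k A (fun j => v 0 j).
  apply: contrapT => h; case/eqP: v0; apply/rowP => j; rewrite mxE; apply/eqP.
  by apply/negPn/negP => vj; apply: h; exists j; rewrite /in_chart mevalXU.
have [|i] := hq.2 _ pv; last by rewrite gv eqxx.
have := congr1 (meval (fun j => v 0 j)) (Euler hq.1).
rewrite raddf_sum big1 /= => [|i _]; last by rewrite mevalM gv mulr0.
move/esym/eqP; rewrite mevalZ mulf_eq0 => /orP[/eqP e|/eqP//].
by have := char0 1; rewrite -[2%:R]/(2%:~R) e eqxx.
Qed.

Lemma quadric_neq0 : q != 0.
Proof.
apply/eqP => q0; have pt : @is_point k A (fun=> 1).
  by exists (ord0 : 'I_n.+2); rewrite /in_chart mevalXU oner_eq0.
have [|i] := hq.2 _ pt; first by rewrite q0 meval0.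
by rewrite q0 mderiv0 meval0 eqxx.
Qed.

(** The partial derivatives of [q] span all linear forms, so [q] divides every [r * 'X_j]; two
    coordinates being coprime, [q] divides [r]. *)
Lemma quadric_smooth r : (forall i, dvdm q (r * q^`M(i))) -> dvdm (q * q) (q * r).
Proof.
move=> h; suff [r' ->] : dvdm q r by exists r'; rewrite mulrA.
pose M := \matrix_(i < n.+2, j < n.+2) H j i.
have Xj (j : 'I_n.+2) : ('X_j : S) = \sum_i (invmx M) i j *: q^`M(i).
  under eq_bigr do rewrite gradient scaler_sumr.
  rewrite exchange_big /=.
  have e l : \sum_i invmx M i j *: (H i l *: 'X_l) = ((l == j)%:R : k) *: ('X_l : S).
    under eq_bigr do rewrite scalerA.
    rewrite -scaler_suml; congr (_ *: _).
    have /matrixP/(_ l j) := mulmxV hessian_unit; rewrite !mxE => <-.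
    by apply: eq_bigr => i _; rewrite !mxE mulrC.
  under eq_bigr do rewrite e.
  rewrite (bigD1 j) //= eqxx scale1r big1 ?addr0 // => l /negPf->.
  by rewrite scale0r.
apply: (@saturated_coprime _ A _ _ (ord0 : 'I_n.+2) (lift ord0 ord0 : 'I_n.+2)).
  by move=> i /=; rewrite !mnm1E; case: eqP => [<-|]; [right|left].
move=> c; exists 1%N; rewrite expr1 /= Xj mulr_suml; apply: dvdm_sum => i _.
by rewrite -scalerAl mulrC -mul_mpolyC; apply: dvdmM.
Qed.

End SmoothQuadric.

(** * No canonical carpets on projective spaces and quadrics *)

Section Cases.
Context {k : fieldType} (char0 : forall j, j.+1%:R != 0 :> k).

Lemma no_carpet (A : coxSpace k) (q : cox_ring A) (gq D : cox_grp A) (N : nat)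
    (s : 'I_N.+1 -> cox_ring A) (W Z : subscheme (proj k N)) m :
  inhabited (embedding (@iofr k A) q gq D s) ->
  (forall (d : nat) F, whomog (d%:Z : cox_grp (proj k N)) F -> (W F <-> vanishes q s F)) ->
  ~ (forall j, exists l, dvdm q (s j ^+ l)) ->
  carpet W Z -> ~ canonically_embedded Z m.+2.
Proof.
move=> [em] hW nil ZW [L hL [e [_ e_free e_gen _]]].
exact: (not_canonically_embedded em hW nil ZW e_gen e_free hL).
Qed.

Lemma not_nilpotent0 (A : coxSpace k) (N : nat) (s : 'I_N.+1 -> cox_ring A) :
  (forall j, ~ dvdm 0 (s j)) -> ~ (forall j, exists l, dvdm 0 (s j ^+ l)).
Proof.
move=> h /(_ ord0)[l [r]]; rewrite mul0r => /eqP.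
by rewrite expf_eq0 => /andP[_ /eqP e]; case: (h ord0); rewrite e; apply: dvdm0.
Qed.

Lemma wholeP (A : coxSpace k) (p : cox_ring A) : whole A p <-> dvdm 0 p.
Proof.
by split=> [->|[r ->]]; [apply: dvdm0|rewrite mul0r].
Qed.

Lemma proj_charts_coprime n (i : 'I_n.+2) :
  @cox_mon _ (proj k n.+1) (ord0 : 'I_n.+2) i = 0%N \/
  @cox_mon _ (proj k n.+1) (lift ord0 ord0 : 'I_n.+2) i = 0%N.
Proof. by rewrite /= !mnm1E; case: eqP => [<-|]; [right|left]. Qed.

Lemma proj_no_carpet m d N (s : 'I_N.+1 -> cox_chart (proj k m.+2) -> cox_frac (proj k m.+2))
    (W Z : subscheme (proj k N)) : (0 < d)%N ->
  basis_of_sections (whole (proj k m.+2)) (d%:Z : cox_grp (proj k m.+2)) s ->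
  closed_immersion (whole (proj k m.+2)) (d%:Z : cox_grp (proj k m.+2)) s W ->
  carpet W Z -> ~ canonically_embedded Z m.+2.
Proof.
case: d => // d _ hs [_ _ _ _ him].
have h0 : whomog (0 : cox_grp (proj k m.+2)) (0 : cox_ring (proj k m.+2)) by apply: whomog0.
have [s' [s'D span nz _ hW]] := poly_sections h0 (@wholeP _)
  (fun p => @saturated_coprime k (proj k m.+2) 0 p (ord0 : 'I_m.+3) (lift ord0 ord0 : 'I_m.+3) (@proj_charts_coprime m.+1)) hs him
  (@global_section_coprime k (proj k m.+2) 0 _ _ (@wholeP _)
    (ord0 : 'I_m.+3) (lift ord0 ord0 : 'I_m.+3) erefl (@proj_charts_coprime m.+1)).
have s'0 j : s' j != 0 by apply/eqP => e; case: (nz j); rewrite e; apply: dvdm0.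
apply: (no_carpet (q := 0) (s := s') _ hW (not_nilpotent0 nz)).
apply: (proj_embedding char0 (gq := 0) h0 s'D s'0 span (or_introl erefl)) => r _.
by rewrite !mul0r; apply: dvdm0.
Qed.

Lemma quadric_no_carpet m q (Q : subscheme (proj k m.+3)) d N
    (s : 'I_N.+1 -> cox_chart (proj k m.+3) -> cox_frac (proj k m.+3))
    (W Z : subscheme (proj k N)) : (0 < d)%N -> smooth_quadric q ->
  (forall p, Q p <-> exists r, p = r * q) ->
  basis_of_sections Q (d%:Z : cox_grp (proj k m.+3)) s ->
  closed_immersion Q (d%:Z : cox_grp (proj k m.+3)) s W ->
  carpet W Z -> ~ canonically_embedded Z m.+2.
Proof.
case: d => // d _ smq hQ hs [_ _ _ _ him].
pose A := proj k m.+3.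
have hY p : Q p <-> dvdm q p.
  by split=> [/hQ[r ->]|[r ->]]; [exists r|apply/hQ; exists r]; rewrite mulrC.
have q0 := quadric_neq0 smq; have hq := smq.1.
have sat (p : cox_ring A) := @saturated_coprime k A q p (ord0 : 'I_m.+4) (lift ord0 ord0 : 'I_m.+4) (@proj_charts_coprime m.+2).
have ac (g : int) : (- m.+4%:Z < g)%R ->
    acyclic (fun t => loc (@iofr k A) (map (@chart_mon k A) t) (g : cox_grp A)).
  apply: (proj_acyclic (ord0 : 'I_m.+4) (e := @chart_mon k A)) => [c|c|c].
  - exact: denom_mon.
  - exists (fun j => (j == c)%:R); rewrite (bigD1 c) //= eqxx mul1r big1 ?addr0 //.
    by move=> j /negPf->; rewrite mul0r.
  - exists 1%N, (fun j => (j == c)%:R); rewrite (bigD1 c) //= eqxx mul1r big1 ?addr0 //.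
    by move=> j /negPf->; rewrite mul0r.
have acm : acyclic_mod (@iofr k A) q (@chart_mon k A) (d.+1%:Z : cox_grp A).
  apply: (@acyclic_mod_lift _ _ _ _ (@iofr_inj k A) _ _ hq _ _ _ q0 (@denom_mon k A)).
    by apply: ac; lia.
  by apply: ac; rewrite /=; lia.
have [s' [s'D span nz _ hW]] := poly_sections hq hY sat hs him (global_section_poly hq hY acm).
have s'0 j : s' j != 0 by apply/eqP => e; case: (nz j); rewrite e; apply: dvdm0.
apply: (no_carpet (q := q) (s := s') _ hW) => [|nil].
  apply: (proj_embedding char0 (gq := 2) hq s'D s'0 span _ (quadric_smooth char0 smq)).
  by right; split.
(* Were all the [s' j] nilpotent modulo [q], so would be the coordinates, whose powers of degree D
   are in the span; then 1 would be a multiple of [q], which has no constant term. *)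
have [|r] := sat 1.
  move=> c; suff [l hl] : exists l, dvdm q ('X_[cox_mon c] ^+ l) by exists l; rewrite mulr1.
  have [a [r er]] := span _ (@whomogXj k m.+3 c d.+1).
  have [l hl] : radical (dvdm q) (\sum_j a j *: s' j).
    apply: radical_sum => [x y|x y||j _]; [exact: dvdmD|exact: dvdmM|exact: dvdm0|].
    by rewrite -mul_mpolyC; apply: radicalM; [exact: dvdmM|apply: nil].
  exists (d.+1 * l)%N; rewrite exprM; apply: dvdm_sub hl.
  by apply: dvdmXX; exists r.
move/(congr1 (mcoeff 0%MM)); rewrite mcoeff1 eqxx => /eqP.
have q00 : q@_0%MM = 0.
  apply: memN_msupp_eq0; apply/negP => /hq; rewrite wdeg_proj big1 // => i _.
  by rewrite mnm0E.
by rewrite rmorphM /= q00 mul0r oner_eq0.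
Qed.

End Cases.

(** * Scrolls *)

Section ScrollBasics.
Context {k : fieldType} {m : nat} (e : 'I_m -> nat).
Local Notation A := (scroll k e).

Definition ui (i : 'I_2) : 'I_(cox_var A) := lshift m i.
Definition zi (j : 'I_m) : 'I_(cox_var A) := rshift 2 j.

Definition wz (i : 'I_(cox_var A)) : nat := match split i with inl _ => 0 | inr _ => 1 end.
Definition wh (i : 'I_(cox_var A)) : nat := match split i with inl _ => 1 | inr j => e j end.

Lemma scroll_wt i : @cox_wt k A i = ((wz i)%:Z, (wh i)%:Z) :> (int * int)%type.
Proof. by rewrite /= /wz /wh; case: (split i). Qed.

Lemma split_ui i : split (ui i) = inl i. Proof. exact: (unsplitK (inl i)). Qed.
Lemma split_zi j : split (zi j) = inr j. Proof. exact: (unsplitK (inr j)). Qed.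

Lemma wz_ui i : wz (ui i) = 0%N. Proof. by rewrite /wz split_ui. Qed.
Lemma wz_zi j : wz (zi j) = 1%N. Proof. by rewrite /wz split_zi. Qed.
Lemma wh_ui i : wh (ui i) = 1%N. Proof. by rewrite /wh split_ui. Qed.
Lemma wh_zi j : wh (zi j) = e j. Proof. by rewrite /wh split_zi. Qed.

Lemma scroll_varP (i : 'I_(cox_var A)) : (exists i', i = ui i') \/ (exists j, i = zi j).
Proof.
by rewrite -(splitK i); case: (split i) => [i'|j]; [left; exists i'|right; exists j].
Qed.

Lemma zi_ui i j : zi j != ui i.
Proof. by apply/eqP => /(congr1 (@split 2 m)); rewrite split_ui split_zi. Qed.

Lemma zi_inj : injective zi.
Proof. exact: rshift_inj. Qed.

Lemma ui_inj : injective ui.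
Proof. exact: lshift_inj. Qed.

Lemma sum_vars (V : nmodType) (F : 'I_(cox_var A) -> V) :
  \sum_i F i = \sum_i F (ui i) + \sum_j F (zi j).
Proof. exact: (@big_split_ord _ _ _ 2 m xpredT F). Qed.

Lemma pair_mulrn (x y : int) (n : nat) : (x, y) *+ n = (x *+ n, y *+ n) :> (int * int)%type.
Proof. by elim: n => // n IH; rewrite !mulrS IH. Qed.

Lemma wdeg_scroll (t : 'X_{1..cox_var A}) : @wdeg k A t =
  ((\sum_j t (zi j))%N%:Z, (\sum_i t (ui i) + \sum_j t (zi j) * e j)%N%:Z) :> (int * int)%type.
Proof.
have E i : @cox_wt k A i *+ t i = ((t i * wz i)%N%:Z, (t i * wh i)%N%:Z) :> (int * int)%type.
  by rewrite scroll_wt pair_mulrn !Posz_mulrn.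
have S1 (I : finType) (f g : I -> nat) : \sum_i ((f i)%:Z, (g i)%:Z) =
    ((\sum_i f i)%N%:Z, (\sum_i g i)%N%:Z) :> (int * int)%type.
  apply: (big_rec3 (fun (x y : nat) (z : (int * int)%type) => z = (x%:Z, y%:Z))) => // i x y z _ ->.
  by rewrite !PoszD.
rewrite [LHS](eq_bigr (fun i => ((t i * wz i)%N%:Z, (t i * wh i)%N%:Z) : (int * int)%type)); last first.
  by move=> i _; apply: E.
rewrite S1; congr (_%:Z, _%:Z); rewrite sum_vars.
  rewrite big1 ?add0r; last by move=> i _; rewrite wz_ui muln0.
  by apply: eq_bigr => j _; rewrite wz_zi muln1.
by congr addn; apply: eq_bigr => j _; rewrite ?wh_ui ?wh_zi ?muln1.
Qed.

Lemma big_ord2 (V : nmodType) (F : 'I_2 -> V) :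
  \sum_i F i = F ord0 + F (lift ord0 ord0).
Proof. by rewrite big_ord_recl big_ord1. Qed.

End ScrollBasics.

(** * Positivity of a very ample divisor on a scroll *)

Section ScrollPositive.
Context {k : fieldType} {m : nat} (e : 'I_m.+2 -> nat) (a b : int).
Local Notation A := (scroll k e).
Local Notation S := (cox_ring A).
Local Notation D := ((a, b) : cox_grp A).
Context (N : nat) (s : 'I_N.+1 -> cox_chart A -> cox_frac A) (s' : 'I_N.+1 -> S).
Context (W : subscheme (proj k N)).
Hypothesis im : closed_immersion (whole A) D s W.
Hypothesis s'D : forall j, whomog D (s' j).
Hypothesis sE : forall j c, s j c = iofr (s' j).

(** The fixed point of the torus where only u_i and z_j are nonzero; the only monomial of degree D
    that can be nonzero there is z_j^a u_i^(b - a e_j). *)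
Definition curve_point (j : 'I_m.+2) (i : 'I_2) : Defs.coord A := fun x =>
  match split x with inl i' => (i' == i)%:R | inr j' => (j' == j)%:R end.

Lemma curve_in_chart j i : @in_chart k A (i, j) (curve_point j i).
Proof.
have ec : @cox_mon k A (i, j) = (U_(ui e i) + U_(zi e j))%MM by [].
rewrite /in_chart ec mpolyXD mevalM.
rewrite [X in X * _ != _]mevalXU mevalXU /curve_point split_ui split_zi !eqxx.
by rewrite mulr1 oner_eq0.
Qed.

Lemma point_of_curve j i : point_of (whole A) (curve_point j i).
Proof.
split; first by exists (i, j); apply: curve_in_chart.
by move=> p ->; rewrite meval0.
Qed.

Lemma value_at_poly (p : S) P v : value_at (iofr p) P v <-> v = p.@[P].
Proof.
split=> [[p' [q [q0 e' ->]]]|->]; last first.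
  by exists p, 1; rewrite meval1 oner_eq0 tofrac1 !divr1.
suff -> : p' = p * q by rewrite mevalM mulfK.
apply: (@iofr_inj k A); rewrite rmorphM [iofr p]e'.
have q0' : iofr q != 0 by apply: (io_neq0 (@iofr_inj k A)); apply: contraNneq q0 => ->; rewrite meval0.
exact (esym (divfK q0' _)).
Qed.

Lemma sections_defined P : point_of (whole A) P -> exists j, (s' j).@[P] != 0.
Proof.
move=> /(ci_defined im)[y [c yc] [c' [l [_ l0 h]]]]; exists c.
have := h c; rewrite sE => /value_at_poly <-; rewrite mulf_neq0 //.
by move: yc; rewrite /in_chart mevalXU.
Qed.

Lemma sections_inj P Q : point_of (whole A) P -> point_of (whole A) Q ->
  (forall j, (s' j).@[P] = (s' j).@[Q]) -> same_point P Q.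
Proof.
move=> hP hQ e'; have [j0 j0P] := sections_defined hP.
pose y : Defs.coord (proj k N) := fun j => (s' j).@[P].
have [[cP cPP] _] := hP; have [[cQ cQQ] _] := hQ.
apply: (ci_inj im hP hQ (y := y)).
- by exists j0; rewrite /in_chart mevalXU.
- exists cP, 1; rewrite oner_eq0; split=> // j; rewrite sE mul1r.
  exact/value_at_poly.
- exists cQ, 1; rewrite oner_eq0; split=> // j; rewrite sE mul1r.
  by apply/value_at_poly; rewrite -e'.
Qed.

Lemma curve_value j i (p : S) : p.@[curve_point j i] =
  \sum_(t <- msupp p) p@_t * \prod_x curve_point j i x ^+ t x.
Proof. by rewrite {1}[p]mpolyE raddf_sum; apply: eq_bigr => t _ /=; rewrite mevalZ mevalX. Qed.

Lemma curve_term j i (t : 'X_{1..cox_var A}) : \prod_x curve_point j i x ^+ t x =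
  [forall x, (x == ui e i) || (x == zi e j) || (t x == 0%N)]%:R.
Proof.
have vx x : curve_point j i x = ((x == ui e i) || (x == zi e j))%:R.
  case: (scroll_varP x) => -[y ->]; rewrite /curve_point ?split_ui ?split_zi.
    rewrite (inj_eq (@ui_inj _ m.+2 e)) [ui e y == zi e j]eq_sym.
    by rewrite (negPf (zi_ui e _ _)) orbF.
  by rewrite (inj_eq (@zi_inj _ m.+2 e)) (negPf (zi_ui e _ _)).
case: forallP => [h|h].
  rewrite big1 // => x _; have := h x; rewrite vx.
  by case: ((x == ui e i) || _) => /= [_|/eqP->]; rewrite ?expr1n ?expr0.
have [x hx] : exists x, ~~ ((x == ui e i) || (x == zi e j) || (t x == 0%N)).
  by apply/existsP; rewrite -negb_forall; apply/negP => /forallP.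
rewrite (bigD1 x) //= vx; move: hx; rewrite negb_or => /andP[/negPf-> hx].
by rewrite expr0n (negPf hx) mul0r.
Qed.

Lemma curve_deg j i t : wdeg (t : 'X_{1..cox_var A}) = D ->
  [forall x, (x == ui e i) || (x == zi e j) || (t x == 0%N)] ->
  a = (t (zi e j))%:Z /\ b = (t (ui e i) + t (zi e j) * e j)%N%:Z.
Proof.
rewrite wdeg_scroll => -[<- <-] /forallP h.
have hz j' : j' != j -> t (zi e j') = 0%N.
  move=> ne; apply/eqP; have := h (zi e j').
  by rewrite (negPf (zi_ui e _ _)) (inj_eq (@zi_inj _ _ e)) (negPf ne).
have hu i' : i' != i -> t (ui e i') = 0%N.
  move=> ne; apply/eqP; have := h (ui e i').
  by rewrite eq_sym (inj_eq (@ui_inj _ _ e)) eq_sym (negPf ne) eq_sym (negPf (zi_ui e _ _)).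
have -> : (\sum_j' t (zi e j') = t (zi e j))%N.
  by rewrite (bigD1 j) //= big1 ?addn0 // => j' /hz.
have -> : (\sum_i' t (ui e i') = t (ui e i))%N.
  by rewrite (bigD1 i) //= big1 ?addn0 // => i' /hu.
have -> : (\sum_j' t (zi e j') * e j' = t (zi e j) * e j)%N.
  by rewrite (bigD1 j) //= big1 ?addn0 // => j' /hz->.
by [].
Qed.

Lemma curve_positive j (i : 'I_2) : (0 <= a)%R /\ (a * (e j)%:Z <= b)%R.
Proof.
have [l] := sections_defined (point_of_curve j i); rewrite curve_value => h.
have [t tl ht] : exists2 t, t \in msupp (s' l) &
    [forall x, (x == ui e i) || (x == zi e j) || (t x == 0%N)].
  apply: contrapT => no; case/eqP: h; rewrite big_seq big1 // => t tl.
  rewrite curve_term; case: (boolP [forall x, _]) => [ht|_]; last by rewrite mulr0.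
  by case: no; exists t.
have [-> ->] := curve_deg (@s'D l t tl) ht; split=> //.
by rewrite -PoszM lez_nat leq_addl.
Qed.

(** The weak inequalities hold because some section is nonzero at each fixed point, the strict ones
    because fixed points are separated: for a = 0 two of them in the same fiber would have the same
    image, and for a e_j = b so would the two on the curve where only z_j is nonzero among the
    z's. *)
Lemma scroll_positive : (0 < a)%R /\ forall j, (a * (e j)%:Z < b)%R.
Proof.
pose i0 : 'I_2 := ord0; pose i1 : 'I_2 := lift ord0 ord0.
have iff_eq (P Q : bool) : (P -> Q) -> (Q -> P) -> P%:R = Q%:R :> k.
  by case: P Q => [] [] // pq qp; [have := pq isT|have := qp isT].
split=> [|j].
  pose j0 : 'I_m.+2 := ord0; pose j1 : 'I_m.+2 := lift ord0 ord0.
  have [a0 _] := curve_positive j0 i0; rewrite Order.POrderTheory.lt_neqAle a0 andbT eq_sym.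
  apply/eqP => a00.
  have same l : (s' l).@[curve_point j0 i0] = (s' l).@[curve_point j1 i0].
    rewrite !curve_value big_seq [RHS]big_seq; apply: eq_bigr => t tl; congr (_ * _).
    have dt := @s'D l t tl; rewrite !curve_term; apply: iff_eq => ht; apply/forallP => x.
      have [e1 _] := curve_deg dt ht; move/forallP/(_ x): ht.
      by case/orP=> [/orP[->//|/eqP->]|->]; rewrite ?orbT // -eqz_nat -e1 a00 orbT.
    have [e1 _] := curve_deg dt ht; move/forallP/(_ x): ht.
    by case/orP=> [/orP[->//|/eqP->]|->]; rewrite ?orbT // -eqz_nat -e1 a00 orbT.
  have [t [_ _ /(_ (zi e j1))]] := sections_inj (point_of_curve j0 i0) (point_of_curve j1 i0) same.
  by rewrite /curve_point split_zi /= mulr0 => /eqP; rewrite oner_eq0.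
have [_ bj] := curve_positive j i0; rewrite Order.POrderTheory.lt_neqAle bj andbT; apply/eqP => ab.
have same l : (s' l).@[curve_point j i0] = (s' l).@[curve_point j i1].
  rewrite !curve_value big_seq [RHS]big_seq; apply: eq_bigr => t tl; congr (_ * _).
  have dt := @s'D l t tl; rewrite !curve_term; apply: iff_eq => ht; apply/forallP => x.
    have [e1 e2] := curve_deg dt ht; move/forallP/(_ x): ht.
    have t0 : t (ui e i0) = 0%N.
      by apply/eqP; move/eqP: e2; rewrite -ab e1 -PoszM eqz_nat -{1}[(_ * _)%N]add0n eqn_add2r eq_sym.
    by case/orP=> [/orP[/eqP->|->]|->]; rewrite ?t0 ?orbT.
  have [e1 e2] := curve_deg dt ht; move/forallP/(_ x): ht.
  have t0 : t (ui e i1) = 0%N.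
      by apply/eqP; move/eqP: e2; rewrite -ab e1 -PoszM eqz_nat -{1}[(_ * _)%N]add0n eqn_add2r eq_sym.
  by case/orP=> [/orP[/eqP->|->]|->]; rewrite ?t0 ?orbT.
have [t [_ _ /(_ (ui e i1))]] := sections_inj (point_of_curve j i0) (point_of_curve j i1) same.
by rewrite /curve_point split_ui /= mulr0 => /eqP; rewrite oner_eq0.
Qed.

End ScrollPositive.

(** * Cohomology of line bundles on a scroll *)

Section ScrollAcyclic.
Context {k : fieldType} {m : nat} (e : 'I_m.+2 -> nat) (a b : nat).
Local Notation A := (scroll k e).
Local Notation S := (cox_ring A).
Local Notation D := ((a%:Z, b%:Z) : cox_grp A).
Local Notation io := (@iofr k A).
Local Notation io_inj := (@iofr_inj k A).
Local Notation ui := (ui e).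
Local Notation zi := (zi e).
Hypotheses (a_gt0 : (0 < a)%N) (ab : forall j, (a * e j < b)%N).
Implicit Types (t : 'X_{1..cox_var A}).

Lemma weighted_lt (al : 'I_m.+2 -> nat) : (\sum_j al j = a)%N -> (\sum_j al j * e j < b)%N.
Proof.
move=> sa; have h : (\sum_j al j * (a * e j) <= \sum_j al j * b.-1)%N.
  by apply: leq_sum => j _; apply: leq_mul => //; have := ab j; lia.
rewrite -big_distrl /= sa in h.
have e1 : (\sum_j al j * (a * e j) = a * \sum_j al j * e j)%N.
  by rewrite big_distrr; apply: eq_bigr => j _; rewrite /= mulnCA.
by rewrite e1 leq_pmul2l // in h; have := ab ord0; lia.
Qed.

Lemma scroll_zE n t : wdeg t = D *+ n -> (\sum_j t (zi j) = n * a)%N.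
Proof. by rewrite wdeg_scroll pair_mulrn !Posz_mulrn => -[]. Qed.

Lemma scroll_uE n t : wdeg t = D *+ n ->
  (\sum_i t (ui i) + \sum_j t (zi j) * e j = n * b)%N.
Proof. by rewrite wdeg_scroll pair_mulrn !Posz_mulrn => -[]. Qed.

Lemma scroll_zP n t : wdeg t = D *+ n.+1 -> exists j, (0 < t (zi j))%N.
Proof.
move=> /scroll_zE et; apply: contrapT => h.
have : (\sum_j t (zi j) = 0)%N.
  rewrite big1 // => j _; apply/eqP; rewrite -leqn0 leqNgt; apply/negP => hj.
  by apply: h; exists j.
by move=> e0; move/eqP: et; rewrite e0 eq_sym muln_eq0 /= -leqn0 leqNgt a_gt0.
Qed.

Lemma scroll_uP n t : wdeg t = D *+ n.+1 -> exists i, (0 < t (ui i))%N.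
Proof.
move=> dt; have ez := scroll_zE dt; have eu := scroll_uE dt; apply: contrapT => h.
have e0 : (\sum_i t (ui i) = 0)%N.
  rewrite big1 // => i _; apply/eqP; rewrite -leqn0 leqNgt; apply/negP => hi.
  by apply: h; exists i.
have : (\sum_j t (zi j) * (a * e j) <= \sum_j t (zi j) * b.-1)%N.
  by apply: leq_sum => j _; apply: leq_mul => //; have := ab j; lia.
rewrite -big_distrl /= ez.
have -> : (\sum_j t (zi j) * (a * e j) = a * \sum_j t (zi j) * e j)%N.
  by rewrite big_distrr; apply: eq_bigr => j _; rewrite /= mulnCA.
have -> : (\sum_j t (zi j) * e j = n.+1 * b)%N by rewrite -eu e0.
rewrite mulnCA -mulnA leq_pmul2l // leq_pmul2l //; have := ab ord0; lia.
Qed.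

Context (N : nat) (s : 'I_N.+1 -> S).
Hypotheses (hs : forall j, whomog D (s j)) (s_nz : forall j, s j != 0).
Hypothesis span : forall p : S, whomog D p -> exists c, dvdm 0 (p - \sum_j c j *: s j).

Lemma span0 p : whomog D p -> exists c, p = \sum_j c j * s j.
Proof.
move=> /span[c [r]]; rewrite mul0r => /eqP; rewrite subr_eq0 => /eqP->.
by exists (fun j => mpolyC _ (c j)); apply: eq_bigr => j _; rewrite mul_mpolyC.
Qed.

Definition zu j i (x y : nat) : S := 'X_(zi j) ^+ x * 'X_(ui i) ^+ y.

Lemma whomog_zu j i x y : whomog ((x%:Z, (x * e j + y)%N%:Z) : cox_grp A) (zu j i x y).
Proof.
have hz := whomogX (l := x) (@whomogXi _ A (zi j)).
have hu := whomogX (l := y) (@whomogXi _ A (ui i)).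
apply: whomog_eq (whomogM hz hu) _; rewrite !scroll_wt wz_zi wh_zi wz_ui wh_ui.
rewrite !pair_mulrn !Posz_mulrn !muln1 muln0.
have e1 : (x%:Z, (x * e j)%N%:Z) + (0%N%:Z, y%:Z) = (x%:Z + 0%N%:Z, (x * e j)%N%:Z + y%:Z) by [].
by rewrite e1 addr0 PoszD.
Qed.

Lemma whomog_zuD j i : whomog D (zu j i a (b - a * e j)).
Proof.
apply: whomog_eq (@whomog_zu j i _ _) _; congr (_, _%:Z).
by have := ab j; lia.
Qed.

(** O(g) is pushed forward to P^1 as the sum of the O(g2 - \sum_j al_j e_j), one for each monomial
    of degree g1 in the z_j; the hypothesis says that these have no H^1. Accordingly, the cover is
    compared with the one by the u_i and then, over each u_i <> 0, with the one by the z_j. *)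
Lemma scroll_acyclic (g1 g2 : int) : (0 <= g1)%R ->
  (forall al : 'I_m.+2 -> nat, (\sum_j al j)%N%:Z = g1 ->
     (- 1 <= g2 - (\sum_j al j * e j)%N%:Z)%R) ->
  acyclic (fun r => loc io (map (divisor D s) r) ((g1, g2) : cox_grp A)).
Proof.
move=> g10 hg.
have de j : denom (divisor D s j) by split; [apply: hs|apply: s_nz].
have sums (L : nat) : (\sum_(j < m.+2) L = m.+2 * L)%N by rewrite sum_nat_const card_ord.
have mc t L : wdeg t = ((g1, g2) : cox_grp A) + wdeg (@mcst _ A L) ->
    (\sum_j t (zi j))%N%:Z = g1 + (m.+2 * L)%N%:Z /\
    (\sum_i t (ui i) + \sum_j t (zi j) * e j)%N%:Z = g2 + (2 * L + \sum_j L * e j)%N%:Z.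
  rewrite !wdeg_scroll => -[-> ->]; split; congr (_ + _%:Z).
    by rewrite -sums; apply: eq_bigr => j _; rewrite mnmE.
  congr addn; last by apply: eq_bigr => j _; rewrite mnmE.
  by rewrite big_ord_recl big_ord1 !mnmE mul2n addnn.
apply: (@acyclic_loc_sub _ _ _ io _ (fun r => map (divisor D s) r ++ map (@var _ A) [::])).
  by move=> t h; rewrite cats0.
apply: (acyclic_divisors io_inj (v := ui) (ord0 : 'I_N.+1) (ord0 : 'I_2)) => //.
- move=> j; apply: mpolyX_ideal => t /(@hs j) dt; exact: (@scroll_uP 0 t dt).
- move=> t L /mc[ez eu] hz; apply: contrapT => no.
  have hu i : (t (ui i) < L)%N.
    by rewrite ltnNge; apply/negP => hi; apply: no; exists i.
  have hz' j : (L <= t (zi j))%N.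
    by apply: hz => // i; rewrite eq_sym zi_ui.
  (* The true exponents of the z_j are the [t (zi j) - L]. Those of the two u_i being negative, at
     most -2 is left to them in the second degree, against the hypothesis. *)
  have := hg (fun j => t (zi j) - L)%N.
  have -> : (\sum_j (t (zi j) - L) = \sum_j t (zi j) - m.+2 * L)%N.
    by rewrite sumnB // sums.
  have -> : (\sum_j (t (zi j) - L) * e j = \sum_j t (zi j) * e j - \sum_j L * e j)%N.
    rewrite -sumnB => [|j _]; last by rewrite leq_mul2r hz' orbT.
    by apply: eq_bigr => j _; rewrite mulnBl.
  have : (\sum_j L * e j <= \sum_j t (zi j) * e j)%N.
    by apply: leq_sum => j _; rewrite leq_mul2r hz' orbT.
  move: eu ez (hu ord0) (hu (lift ord0 ord0)); rewrite big_ord_recl big_ord1.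
  move: (\sum_j t (zi j))%N (\sum_j t (zi j) * e j)%N (\sum_j L * e j)%N => x y w.
  move: (t (ui ord0)) (t (ui (lift ord0 ord0))) (m.+2 * L)%N => p q r; lia.
move=> i u; apply: (acyclic_divisors io_inj (v := zi) (ord0 : 'I_N.+1) (ord0 : 'I_m.+2)) => //.
- move=> j; apply: mpolyX_ideal => t /(@hs j) dt; exact: (@scroll_zP 0 t dt).
- move=> t L /mc[ez _] _; apply: contrapT => no.
  have hz j : (t (zi j) < L)%N.
    by rewrite ltnNge; apply/negP => hj; apply: no; exists j.
  have L0 : (0 < L)%N by apply: leq_ltn_trans (hz ord0).
  have : (\sum_j t (zi j) <= m.+2 * L.-1)%N.
    by rewrite -sums; apply: leq_sum => j _; have := hz j; lia.
  move: ez; rewrite -{1}(prednK L0) mulnS.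
  move: (\sum_j t (zi j))%N (m.+2 * L.-1)%N => x y; lia.
move=> j v; have [c hc] := span0 (@whomog_zuD j i).
apply: (acyclic_cover io_inj) => //; first exact: denoms_var.
apply: (covers_radical de _ (us := nseq a (@var _ A (zi j)) ++ nseq (b - a * e j) (@var _ A (ui i))) (c := c)).
- exact: denoms_var.
- move=> h; rewrite mem_cat => /orP[] /nseqP[-> _]; apply: map_f => /=; first by rewrite mem_head.
  by rewrite inE !mem_cat mem_head !orbT.
- by rewrite prodh_cat !prodh_nseq.
Qed.

Lemma scroll_acyclic_mod g : [\/ g = 0, g = D | exists i, g = D - cox_wt i] ->
  acyclic_mod io 0 (divisor D s) g.
Proof.
have de j : denom (divisor D s j) by split; [apply: hs|apply: s_nz].
move=> h; apply: (acyclic_mod0 io_inj) => //.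
case: h => [->|->|[i ->]].
- apply: scroll_acyclic => // al -[] sa; rewrite big1 // => j _; apply/eqP; rewrite muln_eq0.
  by move/eqP: sa; rewrite sum_nat_eq0 => /forallP/(_ j)/= ->.
- apply: scroll_acyclic => // al -[] /weighted_lt; lia.
rewrite scroll_wt; case: (scroll_varP i) => -[j ->].
  rewrite wz_ui wh_ui; apply: (@scroll_acyclic (a%:Z - 0) (b%:Z - 1)); first by lia.
  by rewrite subr0 => al -[] /weighted_lt; lia.
rewrite wz_zi wh_zi; apply: (@scroll_acyclic (a%:Z - 1) (b%:Z - (e j)%:Z)); first by lia.
(* A monomial of degree a - 1 in the z's becomes one of degree a after multiplication by z_j, and
   [weighted_lt] applies. *)
move=> al sa; have := @weighted_lt (fun j' => al j' + (j' == j))%N.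
have -> : (\sum_j' (al j' + (j' == j)) = \sum_j' al j' + 1)%N.
  by rewrite big_split; congr addn; rewrite (bigD1 j) //= eqxx big1 // => j' /negPf->.
have -> : (\sum_j' (al j' + (j' == j)) * e j' = \sum_j' al j' * e j' + e j)%N.
  under eq_bigr do rewrite mulnDl.
  rewrite big_split; congr addn; rewrite (bigD1 j) //= eqxx big1 ?mul1n ?addn0 // => j' /negPf->.
  by rewrite mul0n.
by move: sa; move: (\sum_j' al j')%N (\sum_j' al j' * e j')%N => x y; lia.
Qed.

End ScrollAcyclic.

Lemma mderivXin (k : fieldType) (n d : nat) (i j : 'I_n) :
  ('X_j ^+ d : {mpoly k[n]})^`M(i) = if i == j then d%:R *: 'X_j ^+ d.-1 else 0.
Proof.
elim: d => [|d IH]; first by rewrite expr0 -mpolyC1 mderivC scale0r if_same.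
rewrite exprS mderivM IH mderivXi eq_sym; case: eqP => _; last by rewrite mul0r mulr0 addr0.
rewrite mul1r -scalerAr; case: d {IH} => [|d]; first by rewrite scale0r addr0 scale1r.
rewrite /= -exprS. by rewrite -[X in X + _]scale1r -scalerDl nat1r.
Qed.

(** * Charts of a scroll *)

Section ScrollChart.
Context {k : fieldType} {m : nat} (e : 'I_m.+2 -> nat) (a b : nat).
Local Notation A := (scroll k e).
Local Notation S := (cox_ring A).
Local Notation D := ((a%:Z, b%:Z) : cox_grp A).
Local Notation io := (@iofr k A).
Local Notation io_inj := (@iofr_inj k A).
Local Notation ui := (@ui k m.+2 e).
Local Notation zi := (@zi k m.+2 e).
Local Notation wz := (@wz k m.+2 e).
Local Notation wh := (@wh k m.+2 e).
Local Notation zu := (@zu k m e).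
Hypotheses (a_gt0 : (0 < a)%N) (ab : forall j, (a * e j < b)%N).
Context (N : nat) (s : 'I_N.+1 -> S).
Local Notation R := (cox_ring (proj k N)).
Context (lin : S -> R) (hlin : forall p, whomog D p ->
  whomog (1 : cox_grp (proj k N)) (lin p) /\ dvdm 0 (subst s (lin p) - p)).

(** A monomial multiple of x_i already has degree D, but the degrees of the forms on a chart must
    come from an additive function of the weight. The sum of the two degrees is such a function,
    positive on every weight; the missing powers are filled with [l0]. *)
Definition scroll_ni i : nat := (wz i + wh i)%N.
Definition scroll_nu (g : cox_grp A) : int := (g : (int * int)%type).1 + (g : (int * int)%type).2.
Definition scroll_lam (c : 'I_2) (g : cox_grp A) : k :=
  if c == ord0 then (g : (int * int)%type).1%:~R else (g : (int * int)%type).2%:~R.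
(** Large enough for the power of [l0] with this exponent to be a multiple of every [T i]. *)
Definition scroll_e : nat := (1 + 2 * \sum_j e j)%N.

Section At.
Context (j0 : 'I_m.+2) (i0 : 'I_2).

(** The chart is the locus of the monomial z_j0^a u_i0^c, which has degree D because b = a f + c. *)
Let c := (b - a * e j0)%N.
Let f := e j0.
Let E := scroll_e.

Let c_gt0 : (0 < c)%N. Proof. by rewrite subn_gt0. Qed.
Let bE : b = (a * f + c)%N. Proof. by rewrite /c /f subnKC // ltnW. Qed.

Let facts i : [/\ (wz i <= a)%N, (wh i <= c + wz i * f)%N, (0 < wz i + wh i)%N &
  (wz i + wh i + wz i * f <= E)%N].
Proof.
case: (scroll_varP i) => -[j ->].
  rewrite wz_ui wh_ui mul0n !addn0 add0n; split=> //; rewrite /E /scroll_e; lia.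
rewrite wz_zi wh_zi mul1n; split=> //.
  have [ef|fe] := leqP (e j) f; first by rewrite (leq_trans ef) // leq_addl.
  have h1 : (a * e j = a * f + a * (e j - f))%N by rewrite -mulnDr subnKC // ltnW.
  have h2 : (e j - f <= a * (e j - f))%N by rewrite leq_pmull.
  have := ab j; rewrite bE h1; move: (a * (e j - f))%N h2 => x; lia.
have h j' : (e j' <= \sum_j e j)%N by rewrite (bigD1 j') //= leq_addr.
by rewrite /E /scroll_e; have := h j; have := h j0; rewrite -/f; lia.
Qed.

Lemma zuM x y x' y' : zu j0 i0 x y * zu j0 i0 x' y' = zu j0 i0 (x + x') (y + y').
Proof. by rewrite /zu mulrACA -!exprD. Qed.

Lemma zuX x y n : zu j0 i0 x y ^+ n = zu j0 i0 (n * x) (n * y).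
Proof. by rewrite /zu exprMn -!exprM ![(n * _)%N]mulnC. Qed.

(** Exponents of z_j0 and u_i0 in the monomial of degree [D *+ scroll_ni i - cox_wt i], determined
    by the bidegree; [xz] and [xu] are those for [D - cox_wt i]. *)
Let tz i := (scroll_ni i * a - wz i)%N.
Let tu i := (scroll_ni i * c + wz i * f - wh i)%N.
Let T i := zu j0 i0 (tz i) (tu i).
Let xz i := (a - wz i)%N.
Let xu i := (c + wz i * f - wh i)%N.
Let l0 := zu j0 i0 a c.
Let EE i := zu j0 i0 (E * a - tz i) (E * c - tu i).

Let tzE i : tz i = ((scroll_ni i).-1 * a + xz i)%N.
Proof.
have [h1 h2 h3 h4] := facts i; rewrite /tz /xz -/(scroll_ni i) in h3 *.
by rewrite -{1}(prednK h3) mulSn; move: (_.-1 * a)%N => x; lia.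
Qed.

Let tuE i : tu i = ((scroll_ni i).-1 * c + xu i)%N.
Proof.
have [h1 h2 h3 h4] := facts i; rewrite /tu /xu -/(scroll_ni i) in h3 *.
by rewrite -{1}(prednK h3) mulSn; move: (_.-1 * c)%N (wz i * f)%N h2 => x y; lia.
Qed.

Let l0P : whomog D l0.
Proof. by apply: whomog_eq (@whomog_zu _ _ _ _ _ _ _) _; rewrite -bE. Qed.

Let XxP i : whomog D ('X_i * zu j0 i0 (xz i) (xu i)).
Proof.
apply: whomog_eq (whomogM (@whomogXi _ A i) (@whomog_zu _ _ _ _ _ _ _)) _.
have [h1 h2 h3 h4] := facts i; rewrite scroll_wt -[_ + _]/(_ + _, _ + _) /=.
congr (_, _); rewrite -PoszD; congr Posz; first by rewrite subnKC.
rewrite bE /xz /xu mulnBl -/f; have h5 : (wz i * f <= a * f)%N by rewrite leq_mul2r h1 orbT.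
by move: (a * f)%N (wz i * f)%N h5 h2 => x y; lia.
Qed.

Let tz_deg i : (tz i)%:Z = (scroll_ni i * a)%N%:Z - (wz i)%:Z.
Proof.
have [h1 h2 h3 h4] := facts i; rewrite tzE -/(scroll_ni i) in h3 *.
rewrite -{2}(prednK h3) mulSn /xz; move: (_.-1 * a)%N => x; lia.
Qed.

Let tu_deg i : (tz i * f + tu i)%N%:Z = (scroll_ni i * b)%N%:Z - (wh i)%:Z.
Proof.
have [h1 h2 h3 h4] := facts i; rewrite tzE tuE bE -/(scroll_ni i) in h3 *.
rewrite -{3}(prednK h3) mulSn mulnDr mulnDl /xz /xu mulnBl.
have h5 : (wz i * f <= a * f)%N by rewrite leq_mul2r h1 orbT.
rewrite mulnA; move: (_.-1 * a)%N (_.-1 * c)%N => x y.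
move: (a * f)%N (wz i * f)%N h5 h2 (x * f)%N => p q h5 h2 r; lia.
Qed.

Let TP i : whomog (D *+ scroll_ni i - cox_wt i) (T i).
Proof.
apply: whomog_eq (@whomog_zu _ _ _ _ _ _ _) _.
rewrite scroll_wt pair_mulrn !Posz_mulrn.
by rewrite -[_ - _]/(_ - _, _ - _) /= -tz_deg -tu_deg.
Qed.

Let tz_le i : (tz i <= E * a)%N.
Proof.
have [h1 h2 h3 h4] := facts i; apply: leq_trans (leq_subr _ _) _.
rewrite leq_mul2r; apply/orP; right; rewrite /scroll_ni; lia.
Qed.

Let tu_le i : (tu i <= E * c)%N.
Proof.
have [h1 h2 h3 h4] := facts i; apply: leq_trans (leq_subr _ _) _.
apply: (@leq_trans ((wz i + wh i + wz i * f) * c)); last by rewrite leq_mul2r h4 orbT.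
by rewrite [X in (_ <= X)%N]mulnDl leq_add2l leq_pmulr.
Qed.

Let EET i : EE i * T i = l0 ^+ E.
Proof. by rewrite zuM zuX !subnK ?tz_le ?tu_le. Qed.

Let EP i : whomog (D *+ E + cox_wt i - D *+ scroll_ni i) (EE i).
Proof.
apply: whomog_eq (@whomog_zu _ _ _ _ _ _ _) _.
rewrite scroll_wt !pair_mulrn !Posz_mulrn.
rewrite -[_ - _]/(_ + _ - _, _ + _ - _) /=.
have h1 := tz_le i; have h2 := tu_le i; have h3 := tz_deg i; have h4 := tu_deg i.
have h5 : (tz i * f <= E * a * f)%N by rewrite leq_mul2r h1 orbT.
rewrite mulnBl -/f; congr (_, _).
  move: (E * a)%N (scroll_ni i * a)%N h1 h3 => x y; lia.
have -> : (E * b = E * a * f + E * c)%N by rewrite bE mulnDr mulnA.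
move: (E * a * f)%N (tz i * f)%N (E * c)%N (scroll_ni i * b)%N h2 h4 h5 => x y z w; lia.
Qed.

Let Zd := zu j0 i0 (E * a).-1 (E * c).
Let Ud := zu j0 i0 (E * a) (E * c).-1.

Let deriv_zu x y i : (zu j0 i0 x y)^`M(i) =
  (if i == zi j0 then x%:R *: zu j0 i0 x.-1 y else 0) +
  (if i == ui i0 then y%:R *: zu j0 i0 x y.-1 else 0).
Proof.
rewrite mderivM !mderivXin; congr (_ + _); case: ifP => _; rewrite ?mul0r ?mulr0 //.
  by rewrite -scalerAl.
by rewrite -scalerAr.
Qed.

(** Logarithmic derivatives: dT_i / T_i is tz_i dz/z + tu_i du/u, where tz_i and tu_i are linear in
    the two degrees of x_i, with the coefficients used here. [Zd] and [Ud] are [l0 ^+ E] divided by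
    z_j0 and by u_i0. *)
Let dT (al : 'I_2) (i : 'I_(cox_var A)) : S :=
  (if i == zi j0 then (if al == ord0 then a.-1 else a)%:R *: Zd else 0) +
  (if i == ui i0 then (if al == ord0 then c + f else c.-1)%:R *: Ud else 0).

Let tz_lam i : (tz i)%:R = \sum_al scroll_lam al (cox_wt i) * (if al == ord0 then a.-1 else a)%:R.
Proof.
have [h1 h2 h3 h4] := facts i.
have -> : tz i = (wz i * a.-1 + wh i * a)%N.
  rewrite /tz /scroll_ni mulnDl -{1 3}(prednK a_gt0) !mulnS.
  by move: (wz i * _)%N (wh i * _)%N => x y; lia.
rewrite big_ord2 /scroll_lam !scroll_wt eqxx /= natrD !natrM.
by rewrite !pmulrn.
Qed.

Let tu_lam i : (tu i)%:R = \sum_al scroll_lam al (cox_wt i) * (if al == ord0 then c + f else c.-1)%:R.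
Proof.
have [h1 h2 h3 h4] := facts i.
have -> : tu i = (wz i * (c + f) + wh i * c.-1)%N.
  rewrite /tu /scroll_ni mulnDl -{2}(prednK c_gt0) mulnS mulnDr.
  by move: (wz i * _)%N (wz i * _)%N (wh i * _)%N => x y z; lia.
rewrite big_ord2 /scroll_lam !scroll_wt eqxx /= natrD !natrM.
by rewrite !pmulrn.
Qed.

Let dTP i i' : EE i * (T i)^`M(i') = \sum_al scroll_lam al (cox_wt i) *: dT al i'.
Proof.
have -> : EE i * (T i)^`M(i') = (if i' == zi j0 then (tz i)%:R *: Zd else 0) +
    (if i' == ui i0 then (tu i)%:R *: Ud else 0).
  rewrite deriv_zu mulrDr; congr (_ + _); case: ifP => _; rewrite ?mulr0 // -scalerAr.
    case E0 : (tz i) => [|n]; first by rewrite !scale0r.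
    rewrite -E0 zuM subnK ?tu_le //; congr (_ *: zu _ _ _ _).
    by have := tz_le i; rewrite E0 /=; lia.
  case E0 : (tu i) => [|n]; first by rewrite !scale0r.
  rewrite -E0 zuM subnK ?tz_le //; congr (_ *: zu _ _ _ _).
  by have := tu_le i; rewrite E0 /=; lia.
rewrite tz_lam tu_lam /dT; under [RHS]eq_bigr do rewrite scalerDr.
rewrite big_split; congr (_ + _); case: ifP => _.
- by rewrite scaler_suml; apply: eq_bigr => al _; rewrite scalerA.
- by rewrite big1 // => al _; rewrite scaler0.
- by rewrite scaler_suml; apply: eq_bigr => al _; rewrite scalerA.
- by rewrite big1 // => al _; rewrite scaler0.
Qed.

Let Z0 : io 'X_(zi j0) != 0.
Proof. exact (io_neq0 io_inj (@mpolyX_neq0 _ A U_(zi j0)%MM)). Qed.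

Let U0 : io 'X_(ui i0) != 0.
Proof. exact (io_neq0 io_inj (@mpolyX_neq0 _ A U_(ui i0)%MM)). Qed.

Let io_zu x y : io (zu j0 i0 x y) = io 'X_(zi j0) ^ x%:Z * io 'X_(ui i0) ^ y%:Z.
Proof. by rewrite rmorphM !rmorphXn. Qed.

(** The linear expressions behind [tz] and [tu], extended to all degrees with integer values. *)
Let chz (g : (int * int)%type) : int := (g.1 + g.2) * a%:Z - g.1.
Let chu (g : (int * int)%type) : int := (g.1 + g.2) * c%:Z - (g.2 - g.1 * f%:Z).

Definition scroll_chi (g : cox_grp A) : cox_frac A :=
  io 'X_(zi j0) ^ chz g * io 'X_(ui i0) ^ chu g.

Let chz_wt i : chz (@cox_wt k A i) = (tz i)%:Z.
Proof. by rewrite /chz scroll_wt /= tz_deg PoszM PoszD. Qed.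

Let chu_wt i : chu (@cox_wt k A i) = (tu i)%:Z.
Proof.
have [h1 h2 h3 h4] := facts i.
rewrite /chu scroll_wt /= /tu /scroll_ni -PoszD -!PoszM.
have h5 : (wh i <= (wz i + wh i) * c + wz i * f)%N.
  apply: leq_trans h2 _; rewrite leq_add2r leq_pmull //.
move: ((wz i + wh i) * c)%N (wz i * f)%N h5 => x y h5; lia.
Qed.

Let chz_D : chz D = ((a + b).-1 * a)%N%:Z.
Proof.
have ab0 : (0 < a + b)%N by rewrite addn_gt0 a_gt0.
rewrite /chz /= -PoszD -PoszM -{1}(prednK ab0) mulSn; move: (_.-1 * a)%N => x; lia.
Qed.

Let chu_D : chu D = ((a + b).-1 * c)%N%:Z.
Proof.
have ab0 : (0 < a + b)%N by rewrite addn_gt0 a_gt0.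
rewrite /chu /= -PoszD -!PoszM -{1}(prednK ab0) mulSn.
have := bE; move: (_.-1 * c)%N (a * f)%N => x y; lia.
Qed.

Definition scroll_chart : chart io 0 D s scroll_nu scroll_ni scroll_lam scroll_e.
Proof.
refine (@Chart k A _ io 0 D N s scroll_nu scroll_ni 2 scroll_lam scroll_e
  (lin l0) l0 (fun i => lin l0 ^+ (scroll_ni i).-1 * lin ('X_i * zu j0 i0 (xz i) (xu i)))
  T scroll_chi (a + b).-1 EE dT _ _ _ _ _ _ _ _ _ _ _ _ _ EET dTP).
- exact: (hlin l0P).1.
- by apply: mulf_neq0; exact (expf_neq0 _ (@mpolyX_neq0 _ A U_(_)%MM)).
- exact: l0P.
- exact: (hlin l0P).2.
- move=> i; have [_ _ h3 _] := facts i.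
  have h := whomogM (whomogX (l := (scroll_ni i).-1) (hlin l0P).1) (hlin (@XxP i)).1.
  by apply: whomog_eq h _; rewrite /= natz; move: h3; rewrite -/(scroll_ni i); lia.
- exact: TP.
- exact: EP.
- move=> i; rewrite substM substXn.
  have -> : 'X_i * T i = l0 ^+ (scroll_ni i).-1 * ('X_i * zu j0 i0 (xz i) (xu i)).
    by rewrite /l0 zuX [RHS]mulrCA zuM -tzE -tuE.
  apply: dvdmMM; last exact: (hlin (@XxP i)).2.
  by apply: dvdmXX; exact: (hlin l0P).2.
- move=> g h; rewrite /scroll_chi.
  have -> : chz (g + h) = chz g + chz h by rewrite /chz /=; ring.
  have -> : chu (g + h) = chu g + chu h by rewrite /chu /=; ring.
  rewrite (expfzDr _ _ Z0) (expfzDr _ _ U0); exact (mulrACA _ _ _ _).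
- by move=> g; apply: mulf_neq0; [exact (expfz_neq0 _ Z0)|exact (expfz_neq0 _ U0)].
- by move=> i; rewrite /scroll_chi chz_wt chu_wt io_zu.
- by rewrite /scroll_chi chz_D chu_D -rmorphXn zuX io_zu.
- by rewrite /scroll_nu /= -PoszD prednK // addn_gt0 a_gt0.
Defined.

End At.
End ScrollChart.

(** * Embeddings of scrolls *)

Section ScrollEmbedding.
Context {k : fieldType} (char0 : forall j, j.+1%:R != 0 :> k).
Context {m : nat} (e : 'I_m.+2 -> nat) (a b : nat).
Local Notation A := (scroll k e).
Local Notation S := (cox_ring A).
Local Notation D := ((a%:Z, b%:Z) : cox_grp A).
Local Notation io := (@iofr k A).
Local Notation ui := (@ui k m.+2 e).
Local Notation zi := (@zi k m.+2 e).
Hypotheses (a_gt0 : (0 < a)%N) (ab : forall j, (a * e j < b)%N).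
Context (N : nat) (s : 'I_N.+1 -> S).
Local Notation R := (cox_ring (proj k N)).
Hypotheses (hs : forall j, whomog D (s j)) (s_nz : forall j, s j != 0).
Hypothesis span : forall p : S, whomog D p -> exists c, dvdm 0 (p - \sum_j c j *: s j).

Lemma scroll_lamD c : forall g h, @scroll_lam k m e c (g + h) = @scroll_lam k m e c g + @scroll_lam k m e c h :> k.
Proof. by move=> g h; rewrite /scroll_lam; case: ifP => _; rewrite /= intrD. Qed.

(** The system is triangular. The first relation involves only the z_j and is solved by the
    derivatives along them, divided by the degree. What is left of the second is a form of degree
    [D *+ j.+1]; by positivity each of its monomials contains some u_i, so it is a combination of
    the u_i. *)
Lemma scroll_euler j (kappa : 'I_2 -> S) : (forall c, whomog (D *+ j.+1) (kappa c)) ->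
  exists kappa' : 'I_(cox_var A) -> S,
    (forall i, whomog (D *+ j.+1 - cox_wt i) (kappa' i)) /\
    forall c, \sum_i @scroll_lam k m e c (cox_wt i) *: ('X_i * kappa' i) = kappa c.
Proof.
move=> hk; pose i1 : 'I_2 := lift ord0 ord0.
have hk0 := @hk ord0; have hk1 := @hk i1.
pose z' j' : S := (j.+1 * a)%:R^-1 *: (kappa ord0)^`M(zi j').
have z'P j' : whomog (D *+ j.+1 - cox_wt (zi j')) (z' j').
  by apply: whomogZ; apply: (@whomog_deriv _ A _ _ (zi j') hk0).
have E0 : \sum_j' 'X_(zi j') * z' j' = kappa ord0.
  have := euler (scroll_lamD ord0) hk0; rewrite sum_vars big1 ?add0r => [|i _]; last first.
    by rewrite /scroll_lam /= split_ui scale0r.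
  have -> : @scroll_lam k m e ord0 (D *+ j.+1) = (j.+1 * a)%:R :> k.
    by rewrite pair_mulrn !Posz_mulrn.
  move=> e0; under eq_bigr do rewrite -scalerAr.
  rewrite -scaler_sumr.
  rewrite [X in _ *: X](_ : _ = (j.+1 * a)%:R *: kappa ord0); last first.
    by rewrite -e0; apply: eq_bigr => j' _; rewrite /scroll_lam /= split_zi scale1r.
  rewrite scalerA mulVf ?scale1r //.
  by rewrite -(prednK a_gt0) mulnS; apply: char0.
pose p := kappa i1 - \sum_j' (e j')%:R *: ('X_(zi j') * z' j').
have pP : whomog (D *+ j.+1) p.
  apply: whomogB => //; apply: whomog_sum => j' _; apply: whomogZ.
  by apply: whomog_eq (whomogM (@whomogXi _ A (zi j')) (@z'P j')) _; zmod.
have [c hc] : exists c, p = \sum_i c i * 'X_(ui i).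
  by apply: mpolyX_ideal => t /pP dt; apply: (scroll_uP a_gt0 ab dt).
pose u' i := wcomp (D *+ j.+1 - cox_wt (ui i)) (c i).
have E1 : \sum_i 'X_(ui i) * u' i = p.
  rewrite -[RHS](wcomp_homog pP) hc wcomp_sum; apply: eq_bigr => i _.
  by rewrite (wcompM _ _ (@whomogXi _ A (ui i))) mulrC.
pose kappa' (i : 'I_(cox_var A)) := match split i with inl i' => u' i' | inr j' => z' j' end.
have kz j' : kappa' (zi j') = z' j' by rewrite /kappa' split_zi.
have ku i : kappa' (ui i) = u' i by rewrite /kappa' split_ui.
exists kappa'; split=> [i|al].
  case: (scroll_varP i) => -[i' ->]; rewrite ?kz ?ku; last exact: z'P.
  exact: whomog_wcomp.
rewrite sum_vars; under eq_bigr do rewrite ku; under [X in _ + X]eq_bigr do rewrite kz.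
have [->|->] : al = ord0 \/ al = i1.
  by case: al => [[|[|//]] h]; [left|right]; apply: val_inj.
- rewrite big1 ?add0r => [|i _]; last by rewrite /scroll_lam /= split_ui scale0r.
  by rewrite -[RHS]E0; apply: eq_bigr => j' _; rewrite /scroll_lam /= split_zi scale1r.
- rewrite -[RHS](subrK (\sum_j' (e j')%:R *: ('X_(zi j') * z' j'))) -/p -E1; congr (_ + _).
    by apply: eq_bigr => i _; rewrite /scroll_lam /= split_ui scale1r.
  by apply: eq_bigr => j' _; rewrite /scroll_lam /= split_zi.
Qed.

Context (lin : S -> R) (hlin : forall p, whomog D p ->
  whomog (1 : cox_grp (proj k N)) (lin p) /\ dvdm 0 (subst s (lin p) - p)).

Let ch (x : ('I_2 * 'I_m.+2)%type) := scroll_chart a_gt0 ab hlin x.2 x.1.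

(* Up to a multiple, the exponent of a monomial of degree D is a combination
   of the exponents of the monomials defining the charts. *)
Lemma monomial_power (t : 'X_{1..cox_var A}) : wdeg t = D ->
  ('X_[t] : S) ^+ (a * \sum_i t (ui i)) =
  \prod_(x : 'I_2 * 'I_m.+2) zu e x.2 x.1 a (b - a * e x.2) ^+ (t (zi x.2) * t (ui x.1)).
Proof.
move=> dt; have ez : (\sum_j t (zi j) = a)%N by have := @scroll_zE k _ e a b 1 t dt; rewrite mul1n.
have eu : (\sum_i t (ui i) + \sum_j t (zi j) * e j = b)%N.
  by have := @scroll_uE k _ e a b 1 t dt; rewrite mul1n.
rewrite -(pair_bigA _ (fun i j => zu e j i a (b - a * e j) ^+ (t (zi j) * t (ui i)))) /=.
pose q := (\sum_i t (ui i))%N.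
have -> : ('X_[t] : S) = (\prod_j 'X_(zi j) ^+ t (zi j)) * \prod_i 'X_(ui i) ^+ t (ui i).
  rewrite mpolyXE_id (@big_split_ord _ _ _ 2 m.+2) mulrC /=.
  by congr (_ * _).
rewrite exprMn -!prodrXl.
under [RHS]eq_bigr do under eq_bigr do rewrite /zu exprMn -!exprM.
under [RHS]eq_bigr do rewrite big_split /=.
rewrite big_split /=; congr (_ * _).
  rewrite exchange_big /=; apply: eq_bigr => j _.
  rewrite prodrXr -exprM -/q; congr (_ ^+ _).
  by rewrite -big_distrr -big_distrr /= -/q mulnCA.
apply: eq_bigr => i _; rewrite prodrXr -exprM -/q; congr (_ ^+ _).
have eq : (\sum_j t (zi j) * (b - a * e j) = a * q)%N.
  have : (\sum_j t (zi j) * (b - a * e j) + \sum_j t (zi j) * (a * e j) = a * b)%N.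
    transitivity ((\sum_j t (zi j)) * b)%N; last by rewrite ez.
    rewrite -big_split big_distrl; apply: eq_bigr => j _ /=.
    by rewrite -mulnDr subnK // ltnW.
  have -> : (\sum_j t (zi j) * (a * e j) = a * \sum_j t (zi j) * e j)%N.
    by rewrite big_distrr; apply: eq_bigr => j _; rewrite /= mulnCA.
  by rewrite -{2}eu mulnDr -/q => /addIn.
rewrite -eq mulnC big_distrl; apply: eq_bigr => j _ /=.
by rewrite mulnA [(_ * t (zi j))%N]mulnC.
Qed.

Lemma scroll_embedding : inhabited (embedding io 0 (0 : cox_grp A) D s).
Proof.
constructor.
refine (@Embedding k A _ io 0 (0 : cox_grp A) D N s _ hs s_nz _ _ 2
  (@scroll_lam k m e) scroll_lamD scroll_euler _ (@scroll_nu k m e) _ (@scroll_ni k m e) _ _ (scroll_e e)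
  ('I_2 * 'I_m.+2)%type ch _).
- exact: whomog0.
- move=> z; case: z => n; rewrite ?NegzE ?mulrNz -?pmulrn pair_mulrn !Posz_mulrn => h.
    by have /(congr1 fst) /= [/eqP] := h; rewrite muln_eq0 [a == 0%N]eqn0Ngt a_gt0 orbF => /eqP->.
  by have /(congr1 fst) /= /eqP := h; rewrite oppr_eq0 eqz_nat muln_eq0 [a == 0%N]eqn0Ngt a_gt0.
- move=> g hg; apply: (scroll_acyclic_mod a_gt0 ab hs s_nz span).
  case: hg => [->|->|[i ->]|[]]; [exact: Or31|exact: Or32|by apply: Or33; exists i|].
  by rewrite eqxx.
- by move=> r _; rewrite !mul0r; apply: dvdm0.
- by move=> g h; rewrite /scroll_nu /=; ring.
- by move=> i; rewrite /scroll_nu scroll_wt.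
- exists (fun=> 1) => g; by rewrite big_ord2 /scroll_lam !mul1r /= -intrD.
- apply: (cover_monomials (lin := lin)) => //; first by move=> p /hlin[].
  move=> t dt; exists (a * \sum_i t (ui i))%N.
  have [j tj] := @scroll_zP k _ e a b a_gt0 0 t dt.
  have [i ti] := @scroll_uP k _ e a b a_gt0 ab 0 t dt.
  pose l x := ch_l (ch x).
  apply: (@cover_ideal_mod _ _ _ _ _ _ _ _
    (\prod_x l x ^+ (t (zi x.2) * t (ui x.1)))).
    have h : (0 < t (zi (i, j).2) * t (ui (i, j).1))%N by rewrite muln_gt0 tj ti.
    rewrite (bigD1 (i, j)) //= -(prednK h) [_ ^+ _.+1]exprS -mulrA mulrC.
    apply: cover_idealM; exact: (@cover_ideal_l _ _ 0 N s _ l (i, j)).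
  have hm : dvdm 0 (subst s (lin 'X_[t]) - 'X_[t]).
    by apply: (hlin _).2; rewrite -dt; apply: whomogXm.
  rewrite substB substXn; apply: dvdm_trans (dvdmXX _ hm) _.
  rewrite monomial_power // subst_prod.
  apply: (big_rec2 (fun x y => dvdm 0 (x - y))); first by rewrite subrr; apply: dvdm0.
  move=> x y y' _ hxy; apply: dvdmMM => //; rewrite substXn; apply: dvdmXX.
  by apply: dvdm_subC; apply: (hlin _).2; apply: whomog_zuD.
Qed.

End ScrollEmbedding.

Lemma scroll_no_carpet (k : fieldType) m (e : 'I_m.+2 -> nat) (a b : int) N
    (s : 'I_N.+1 -> cox_chart (scroll k e) -> cox_frac (scroll k e))
    (W Z : subscheme (proj k N)) : (forall j, j.+1%:R != 0 :> k) ->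
  basis_of_sections (whole (scroll k e)) ((a, b) : cox_grp (scroll k e)) s ->
  closed_immersion (whole (scroll k e)) ((a, b) : cox_grp (scroll k e)) s W ->
  carpet W Z -> ~ canonically_embedded Z m.+2.
Proof.
move=> char0 hs im; pose A := scroll k e; pose i1 n : 'I_n.+2 := lift ord0 ord0.
have cop (i : 'I_(cox_var A)) : @cox_mon k A (ord0, ord0) i = 0%N \/ @cox_mon k A (i1 0%N, i1 m) i = 0%N.
  have e1 (x : cox_chart A) : @cox_mon k A x = (U_(ui e x.1) + U_(zi e x.2))%MM by [].
  rewrite !e1 !mnmDE !mnm1E /=; case: (scroll_varP i) => -[j ->].
    rewrite !(negPf (zi_ui e _ _)) !(inj_eq (@ui_inj _ _ e)) !addn0.
    by case: (eqVneq ord0 j) => [<-|_]; [right|left].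
  rewrite ![ui _ _ == _]eq_sym !(negPf (zi_ui e _ _)) !(inj_eq (@zi_inj _ _ e)) !add0n.
  by case: (eqVneq ord0 j) => [<-|_]; [right|left].
have h0 : whomog (0 : cox_grp A) (0 : cox_ring A) by apply: whomog0.
have [s' [s'D span nz s'E hW]] := poly_sections h0 (@wholeP _ A)
  (fun p => @saturated_coprime k A 0 p (ord0, ord0) (i1 0%N, i1 m) cop) hs (ci_image im)
  (@global_section_coprime k A 0 _ _ (@wholeP _ A) (ord0, ord0) (i1 0%N, i1 m) erefl cop).
have sE j c : s j c = iofr (s' j).
  have [l [p [-> _ /eqP]]] := s'E j c.
  by rewrite tofrac0 mul0r subr_eq0 => /eqP.
have s'0 j : s' j != 0 by apply/eqP => e0; case: (nz j); rewrite e0; apply: dvdm0.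
have [a0 ab] := scroll_positive im s'D sE.
case: a a0 ab hs im s'D span s'E => // a a0 ab hs im s'D span s'E.
case: b ab hs im s'D span s'E => b ab hs im s'D span s'E; last first.
  by have := ab ord0; rewrite -PoszM; lia.
have a0' : (0 < a)%N by [].
have ab' j : (a * e j < b)%N by have := ab j; rewrite -PoszM.
have [lin hlin] := lin_exists span.
apply: (no_carpet (scroll_embedding char0 a0' ab' s'D s'0 span hlin) hW).
exact: not_nilpotent0.
Qed.

Theorem theorem2p4 (R : realType) (m N : nat) (A : coxSpace R[i])
    (Y : subscheme A) (D : cox_grp A)
    (s : 'I_N.+1 -> cox_chart A -> cox_frac A) (W : subscheme (proj R[i] N)) :
  (2 <= m)%N ->
  listed m Y D ->
  basis_of_sections Y D s ->
  closed_immersion Y D s W ->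
  ~ exists Z : subscheme (proj R[i] N), carpet W Z /\ canonically_embedded Z m.
Proof.
have char0 j : j.+1%:R != 0 :> R[i] by rewrite Num.Theory.pnatr_eq0.
case: m => [|[|m]] // _ hY hs im [Z [ZW]].
case: hY s hs im => [e a b _ _|d d0|q Q d m3 hq hQ d0|a b m2 a0 b0] s hs im.
- exact: scroll_no_carpet char0 hs im ZW.
- exact (proj_no_carpet char0 d0 hs im ZW).
- exact (quadric_no_carpet char0 d0 hq hQ hs im ZW).
- case: m2 ZW => -> ZW; exact: scroll_no_carpet char0 hs im ZW.
Qed.
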